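(* Let $N\ge 3$, let $\Omega\subset\mathbb{R}^N$ be a bounded open set, and let $M(x,s)=(m_{ij}(x,s))_{i,j=1,\dots,N}$ be a matrix of Carathéodory functions $m_{ij}:\Omega\times\mathbb{R}\to\mathbb{R}$ for which there are constants $0<\alpha\le\beta$ with $$\alpha|\varsigma|^2\le M(x,s)\varsigma\cdot\varsigma,\qquad |M(x,s)|\le\beta,\qquad\text{for a.e. }x\in\Omega,\ \forall (s,\varsigma)\in\mathbb{R}\times\mathbb{R}^N .$$ Let $f\in L^q(\Omega)$ with $q>\frac N2$, $f\ge0$, $f\not\equiv0$. Let $g:\Omega\times(0,+\infty)\to\mathbb{R}$ be a Carathéodory function such that $$0\le h(s)\le g(x,s)\qquad\text{for a.e. }x\in\Omega,\ \forall s>0,$$ where $h:(0,+\infty)\to[0,+\infty)$ is a continuous function satisfying $$\lim_{s\to0^+}h(s)=+\infty,\qquad \lim_{s\to0^+}\int_s^1\sqrt{h(t)}\,dt=+\infty,$$ and such that the limit $$\lim_{s\to0^+}\sqrt{h(s)}\,\exp\Big(\int_1^s\sqrt{h(t)}\,dt\Big)=h_0$$ exists with $h_0\in[0,+\infty)$. If $\lambda_1(f)>\frac{\beta}{\alpha}$, then the problem $$-\operatorname{div}(M(x,u)\nabla u)+g(x,u)|\nabla u|^2=f\ \text{ in }\Omega,\qquad u=0\ \text{ on }\partial\Omega$$ does not have any finite energy solution.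
   Context: $\lambda_1(f)$ denotes the first positive eigenvalue of $-\Delta u=\lambda f u$ in $\Omega$, $u=0$ on $\partial\Omega$ (Laplacian with zero Dirichlet boundary conditions and weight $f$). A finite energy solution of the problem is a function $u\in H^1_0(\Omega)$ with $u>0$ a.e. in $\Omega$, $g(x,u)|\nabla u|^2\in L^1(\Omega)$, and $$\int_\Omega M(x,u)\nabla u\cdot\nabla\psi+\int_\Omega g(x,u)|\nabla u|^2\psi=\int_\Omega f\psi\qquad\forall\psi\in H^1_0(\Omega)\cap L^\infty(\Omega).$$ Carathéodory means measurable in $x$ for every $s$ and continuous in $s$ for a.e. $x$. $|M(x,s)|$ is the matrix (operator) norm. *)

(* Defs.v *)
From HB Require Import structures.
From mathcomp Require Import all_boot all_order all_algebra.
From mathcomp Require Import all_classical all_reals all_analysis.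

Set Implicit Arguments.
Unset Strict Implicit.
Unset Printing Implicit Defensive.

Import Order.TTheory GRing.Theory Num.Theory.
Import numFieldNormedType.Exports.

Local Open Scope classical_set_scope.
Local Open Scope ring_scope.

(** * Lebesgue measure on R^N

    The Lebesgue outer measure of [A] is the infimum of the total volumes of
    the countable collections of boxes that cover [A]; the Lebesgue measurable
    sets are the Caratheodory measurable ones, so that the measure is complete.
    A box is given by the pair of its extreme corners. *)

Section lebesgue_outer.
Variables (R : realType) (N : nat).
Local Open Scope ereal_scope.

Definition box (p : 'rV[R]_N * 'rV[R]_N) : set 'rV[R]_N :=
  [set x | forall i, (p.1 ord0 i <= x ord0 i <= p.2 ord0 i)%R].

Definition box_volume (p : 'rV[R]_N * 'rV[R]_N) : R :=
  (\prod_(i < N) Num.max 0 (p.2 ord0 i - p.1 ord0 i))%R.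

Definition box_cover (A : set 'rV[R]_N) : set (set ('rV[R]_N * 'rV[R]_N)) :=
  [set C | countable C /\ A `<=` \bigcup_(p in C) box p].

Definition lebesgue_outer (A : set 'rV[R]_N) : \bar R :=
  ereal_inf [set \esum_(p in C) (box_volume p)%:E | C in box_cover A].

Lemma box_volume_ge0 p : (0 <= box_volume p)%R.
Proof. by apply: prodr_ge0 => i _; rewrite le_max lexx. Qed.

Lemma lebesgue_outer_ge0 A : 0 <= lebesgue_outer A.
Proof.
apply: le_ereal_inf_tmp => _ [C _ <-].
by apply: esum_ge0 => p _; rewrite lee_fin box_volume_ge0.
Qed.

Lemma lebesgue_outer0 : lebesgue_outer set0 = 0.
Proof.
apply/eqP; rewrite eq_le lebesgue_outer_ge0 andbT.
apply: ereal_inf_lbound; exists set0; last by rewrite esum_set0.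
by split; [exact: countable0 | exact: sub0set].
Qed.

Lemma le_lebesgue_outer :
  {homo lebesgue_outer : A B / A `<=` B >-> A <= B}.
Proof.
move=> A B AB; apply: ereal_inf_le_tmp => _ [C [cC BC] <-].
by exists C => //; split => //; exact: subset_trans BC.
Qed.

Lemma esum_bigcup_le (T : choiceType) (a : T -> \bar R) (J : nat -> set T) :
  (forall x, 0 <= a x) ->
  \esum_(x in \bigcup_k J k) a x <= \sum_(k <oo) \esum_(x in J k) a x.
Proof.
move=> a0; rewrite nneseries_esumT; last first.
  by move=> n; exact: esum_ge0.
rewrite seqDU_bigcup_eq esum_bigcupT//; apply: le_esum => n _.
apply: ereal_sup_le => _ [X [finX XJ] <-]; exists X => //; split => //.
exact: subset_trans XJ (@subset_seqDU _ _ _).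
Qed.

Lemma lebesgue_outer_sigma_subadditive : sigma_subadditive lebesgue_outer.
Proof.
move=> A; have [[i ioo]|] := pselect (exists i, lebesgue_outer (A i) = +oo).
  rewrite (eseries_pinfty _ _ ioo) ?leey// => n _.
  by rewrite -ltNye (lt_le_trans _ (lebesgue_outer_ge0 _)).
rewrite -forallNE => Aoo.
suff add2e (e : {posnum R}) : lebesgue_outer (\bigcup_n A n) <=
    \sum_(i <oo) lebesgue_outer (A i) + e%:num%:E.
  by apply/lee_addgt0Pr => _/posnumP[].
rewrite (le_trans _ (epsilon_trick _ _ _))//; last first.
  by move=> n; exact: lebesgue_outer_ge0.
pose P n C := box_cover (A n) C /\ \esum_(p in C) (box_volume p)%:E <=
  lebesgue_outer (A n) + (e%:num / (2 ^ n.+1)%:R)%:E.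
have [G PG] : {G : nat -> set ('rV[R]_N * 'rV[R]_N) & forall n, P n (G n)}.
  apply: (@choice _ _ P) => n.
  have en : (0 < e%:num / (2 ^ n.+1)%:R)%R by [].
  have fA : lebesgue_outer (A n) \is a fin_num.
    rewrite ge0_fin_numE ?lebesgue_outer_ge0// lt_neqAle leey andbT.
    exact/eqP.
  have [_ [C AC <-] /ltW CA] := lb_ereal_inf_adherent en fA.
  by exists C.
have vol0 p : 0 <= (box_volume p)%:E by rewrite lee_fin box_volume_ge0.
apply: (@le_trans _ _ (\esum_(p in \bigcup_k G k) (box_volume p)%:E)).
  apply: ereal_inf_lbound; exists (\bigcup_k G k) => //; split.
    by apply: bigcup_countable => // k _; exact: (PG k).1.1.
  move=> x [k _ /((PG k).1.2)[p Gp px]].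
  by exists p => //; exists k.
apply: (le_trans (esum_bigcup_le _ vol0)); apply: lee_nneseries => [n _ _|n _].
  exact: esum_ge0.
exact: (PG n).2.
Qed.

HB.instance Definition _ := isOuterMeasure.Build R 'rV[R]_N lebesgue_outer
  lebesgue_outer0 lebesgue_outer_ge0 le_lebesgue_outer
  lebesgue_outer_sigma_subadditive.

End lebesgue_outer.

(** [lebspace R N] is R^N with the sigma-algebra of the Lebesgue measurable sets;
    it is convertible to ['rV[R]_N], whose topology and derivatives are used. *)
Notation lebspace R N := (caratheodory_type (@lebesgue_outer R N)).

Definition leb (R : realType) (N : nat) : set (lebspace R N) -> \bar R :=
  @lebesgue_outer R N.
HB.instance Definition _ (R : realType) (N : nat) := isMeasure.Build _ _ _
  (@leb R N) (@caratheodory_measure0 _ _ (@lebesgue_outer R N))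
  (@caratheodory_measure_ge0 _ _ (@lebesgue_outer R N))
  (@caratheodory_measure_sigma_additive _ _ (@lebesgue_outer R N)).
Arguments leb {R N}.

Section euclidean.
Variables (R : realType) (N : nat).

Definition dot (v w : 'cV[R]_N) : R := \sum_(i < N) v i ord0 * w i ord0.

(** The library's norm on matrices is the maximum norm, hence the following. *)
Definition enorm (v : 'cV[R]_N) : R := Num.sqrt (dot v v).

Definition opnorm (A : 'M[R]_N) : R :=
  sup [set enorm (A *m v) | v in [set v | enorm v <= 1]].

End euclidean.

Section sobolev.
Variables (R : realType) (N : nat) (Omega : set 'rV[R]_N).

Definition partial (i : 'I_N) (phi : 'rV[R]_N -> R) : 'rV[R]_N -> R :=
  fun x => 'D_(delta_mx ord0 i) phi x.

Definition smooth (phi : 'rV[R]_N -> R) : Prop :=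
  forall (s : seq 'I_N) x, differentiable (foldr partial phi s) x.

Definition test_function (phi : 'rV[R]_N -> R) : Prop :=
  [/\ smooth phi,
      compact (closure [set x | phi x != 0]) &
      closure [set x | phi x != 0] `<=` Omega].

Definition in_Lp (p : \bar R) (u : 'rV[R]_N -> R) : Prop :=
  (u \_ Omega : lebspace R N -> R) \in Lfun leb p.

Definition weak_gradient (u : 'rV[R]_N -> R) (Du : 'rV[R]_N -> 'cV[R]_N) :=
  forall phi, test_function phi -> forall i,
    \int[leb]_(x in Omega) (u x * partial i phi x) =
    - \int[leb]_(x in Omega) (Du x i ord0 * phi x).

(** [H1 u Du]: [u] is in H^1(Omega) and [Du] represents its weak gradient,
    which is determined up to a null subset of [Omega]. *)
Definition H1 (u : 'rV[R]_N -> R) (Du : 'rV[R]_N -> 'cV[R]_N) : Prop :=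
  [/\ in_Lp 2%:E u,
      forall i, in_Lp 2%:E (fun x => Du x i ord0) &
      weak_gradient u Du].

Definition L2dist (u v : 'rV[R]_N -> R) : \bar R :=
  Lnorm leb 2%:E (EFin \o ((u \- v) \_ Omega) : lebspace R N -> \bar R).

(** [H10 u Du]: [u] is in the closure of the test functions in H^1(Omega). *)
Definition H10 (u : 'rV[R]_N -> R) (Du : 'rV[R]_N -> 'cV[R]_N) : Prop :=
  H1 u Du /\
  exists phi : nat -> 'rV[R]_N -> R,
    [/\ forall n, test_function (phi n),
        L2dist (phi n) u @[n --> \oo] --> 0%E &
        forall i, L2dist (partial i (phi n)) (fun x => Du x i ord0)
          @[n --> \oo] --> 0%E].

Definition ae_in (P : 'rV[R]_N -> Prop) : Prop :=
  {ae (@leb R N), forall x : lebspace R N, Omega x -> P x}.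

(** Weak form of -Delta u = lambda f u in Omega, u = 0 on its boundary. *)
Definition dirichlet_eigenvalue (f : 'rV[R]_N -> R) (lambda : R) : Prop :=
  exists u Du,
    [/\ H10 u Du,
        ~ ae_in (fun x => u x = 0) &
        forall v Dv, H10 v Dv ->
          \int[leb]_(x in Omega) dot (Du x) (Dv x) =
          lambda * \int[leb]_(x in Omega) (f x * u x * v x)].

Definition first_positive_eigenvalue (f : 'rV[R]_N -> R) (lambda1 : R) :=
  [/\ 0 < lambda1, dirichlet_eigenvalue f lambda1 &
      forall lambda, 0 < lambda -> dirichlet_eigenvalue f lambda ->
        lambda1 <= lambda].

(** [S] is the range of the second variable. *)
Definition caratheodory_fun (S : set R) (F : 'rV[R]_N -> R -> R) : Prop :=
  (forall s, S s ->
    measurable_fun (Omega : set (lebspace R N)) (F ^~ s)) /\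
  ae_in (fun x => {within S, continuous (F x)}).

(** The values of [g x] on nonpositive reals are irrelevant, as [u] is positive
    almost everywhere. *)
Definition finite_energy_solution (M : 'rV[R]_N -> R -> 'M[R]_N)
    (g : 'rV[R]_N -> R -> R) (f u : 'rV[R]_N -> R) : Prop :=
  exists Du,
    [/\ H10 u Du,
        ae_in (fun x => 0 < u x),
        in_Lp 1%:E (fun x => g x (u x) * enorm (Du x) ^+ 2) &
        forall psi Dpsi, H10 psi Dpsi -> in_Lp +oo%E psi ->
          \int[leb]_(x in Omega) dot (M x (u x) *m Du x) (Dpsi x) +
          \int[leb]_(x in Omega) (g x (u x) * enorm (Du x) ^+ 2 * psi x) =
          \int[leb]_(x in Omega) (f x * psi x)].

End sobolev.

(** The oriented integral from [a] to [b]; one of the two intervals is empty or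
    reduced to a point. *)
Definition oint (R : realType) (F : R -> R) (a b : R) : R :=
  \int[lebesgue_measure]_(t in `[a, b]) F t -
  \int[lebesgue_measure]_(t in `[b, a]) F t.

(* Main.v *)
(* Let [w(s) = W(s) (2 - W(s))] near 0, where [W(s) = exp (int_1^s (sqrt h))]; by the
   hypotheses on [h], [w] extends to an odd bounded C^1 function with bounded derivative
   such that [w'^2 <= h w^2].  For a solution [u], testing the equation with [w(u)^2]
   makes the elliptic term nonnegative and gives
     int |D w(u)|^2 <= int g |Du|^2 w(u)^2 <= int f w(u)^2,
   whose last member is positive.  By the Rayleigh inequality
   [lambda1 int f v^2 <= int |Dv|^2] this forces [lambda1 <= 1 <= beta / alpha].

   The Rayleigh inequality amounts to the existence of a maximizer of [int f v^2] on the
   unit ball of H^1_0: it solves the Euler-Lagrange equation, so the inverse of the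
   supremum is an eigenvalue.  The needed compactness, for a weight in L^q with q > N/2,
   comes from Poincare inequalities on dyadic cubes: up to a small multiple of the energy,
   [int f v^2] is controlled by finitely many means of [v].  The chain rule in H^1_0 is
   obtained by approximating C^1 functions by polynomials, which keep test functions
   smooth. *)

(* The relation [W' = sqrt h * W] is what lets [g |Du|^2 W(u)^2] dominate [|D W(u)|^2]. The
   divergence of the integral of [sqrt h] gives [W = 0] at 0, hence zero boundary values, and the
   finite limit [h0] bounds [W'] near 0. For large arguments nothing bounds [W] or [h], so [W] gives
   way to a function that becomes constant; a square keeps the junction C^1.

   As [lambda1] is only known to be the least positive eigenvalue, a Rayleigh inequality has to be
   earned by producing an eigenfunction. The condition q > N/2 enters by scaling: on a cube of side
   l, Hoelder bounds the mass of [f] by a multiple of l^(N (1 - 1/q)); multiplied by the Poincare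
   factor l^2 / l^N, this leaves l^(2 - N/q), a positive power that tends to 0 along dyadic scales.

   Estimates are proved for test functions and passed to the limit. Those along a direction apply
   the mean value theorem to the integral of a translate, so that translation invariance does the
   work of Fubini's theorem. *)
Require Import Defs.
From HB Require Import structures.
From mathcomp Require Import all_boot all_order all_algebra.
From mathcomp Require Import all_classical all_reals all_analysis.
From mathcomp Require Import measurable_realfun ess_sup_inf.
From mathcomp Require Import ring lra.

Set Implicit Arguments.
Unset Strict Implicit.
Unset Printing Implicit Defensive.

Import Order.TTheory GRing.Theory Num.Theory.
Import numFieldNormedType.Exports.

Local Open Scope classical_set_scope.
Local Open Scope ring_scope.

(** * Lebesgue measure *)

Section invariant_measure.
Context d (T : measurableType d) (R : realType) (mu : {measure set T -> \bar R}).
Variable t : T -> T.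
Hypothesis mt : measurable_fun setT t.
Hypothesis mu_t : forall A, measurable A -> mu (t @^-1` A) = mu A.
Local Open Scope ereal_scope.

Lemma ge0_integral_invariant (F : T -> \bar R) :
  measurable_fun setT F -> (forall x, 0 <= F x) ->
  \int[mu]_x F (t x) = \int[mu]_x F x.
Proof.
move=> mF F0.
have := @ge0_integral_pushforward _ _ _ _ R _ mt mu setT F
  measurableT mF (fun x _ => F0 x).
rewrite preimage_setT => <-; apply: eq_measure_integral => A mA _.
exact: mu_t.
Qed.

Lemma integral_invariant (F : T -> \bar R) :
  measurable_fun setT F -> \int[mu]_x F (t x) = \int[mu]_x F x.
Proof.
move=> mF; rewrite [LHS]integralE [RHS]integralE; congr (_ - _).
  rewrite -(ge0_integral_invariant (F := F^\+))//; last exact: measurable_funepos.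
  by apply: eq_integral => x _; rewrite !funeposE.
rewrite -(ge0_integral_invariant (F := F^\-))//; last exact: measurable_funeneg.
by apply: eq_integral => x _; rewrite !funenegE.
Qed.

Lemma integrable_invariant (F : T -> \bar R) :
  mu.-integrable setT F -> mu.-integrable setT (fun x => F (t x)).
Proof.
move=> /integrableP[mF iF]; apply/integrableP; split.
  exact: measurableT_comp mF mt.
rewrite (ge0_integral_invariant (F := fun x => `|F x|))//.
exact: measurableT_comp.
Qed.

End invariant_measure.

Section lebesgue_measure_rV.
Variables (R : realType) (N : nat).
Local Open Scope ereal_scope.
Implicit Types (p : 'rV[R]_N * 'rV[R]_N) (A : set 'rV[R]_N) (c x : 'rV[R]_N).

Local Lemma vol_ge0 p : 0 <= (box_volume p)%:E.
Proof. by rewrite lee_fin box_volume_ge0. Qed.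
Local Hint Resolve vol_ge0 : core.

(** [e] need not be injective: choosing one preimage [g y] of each [y] turns the sum over the image
    into a sub-sum of the right-hand side. Covers can thus be moved or cut box by box without
    tracking coincidences. *)
Lemma esum_image_le (T : choiceType) (S : set T) (e : T -> T)
    (a : T -> \bar R) : (forall y, 0 <= a y) ->
  \esum_(y in e @` S) a y <= \esum_(t in S) a (e t).
Proof.
move=> a0; have /choice[g gP] : forall y, exists t, (e @` S) y -> S t /\ e t = y.
  by move=> y; have [[t St ety]|nSy] := pselect ((e @` S) y); [exists t|exists y].
have -> : \esum_(y in e @` S) a y = \esum_(y in e @` S) a (e (g y)).
  by apply: eq_esum => y /gP[_ ->].
rewrite -(@esum_image _ _ _ (e @` S) g (fun t => a (e t))).
  rewrite [leRHS](esumID (g @` (e @` S)))// setIidr.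
    by rewrite leeDl//; exact: esum_ge0.
  by move=> _ [y /gP[Sg _] <-].
move=> y z /set_mem/gP[_ yE] /set_mem/gP[_ zE] gyz.
by rewrite -yE gyz zE.
Qed.

Lemma lebesgue_outer_translate_le c A :
  lebesgue_outer ((fun x => x + c)%R @^-1` A) <= lebesgue_outer A.
Proof.
apply: le_ereal_inf_tmp => _ [C [cC AC] <-].
pose e p := (p.1 - c, p.2 - c)%R.
have eC : box_cover ((fun x => x + c)%R @^-1` A) (e @` C).
  split; first exact: card_le_trans (card_image_le _ _) cC.
  move=> x /= /AC[p Cp px]; exists (e p); first by exists p.
  by move=> i /=; have := px i; rewrite !mxE lerBlDr lerBrDr.
apply: (@le_trans _ _ (\esum_(p in e @` C) (box_volume p)%:E)).
  by apply: ereal_inf_lbound; exists (e @` C).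
apply: (le_trans (esum_image_le _ _ _)) => //.
apply: le_esum => p _; rewrite lee_fin /box_volume le_eqVlt; apply/orP; left.
apply/eqP; apply: eq_bigr => i _; congr (Num.max _ _); rewrite !mxE; ring.
Qed.

Lemma lebesgue_outer_translate c A :
  lebesgue_outer ((fun x => x + c)%R @^-1` A) = lebesgue_outer A.
Proof.
apply/eqP; rewrite eq_le lebesgue_outer_translate_le /=.
have := lebesgue_outer_translate_le (- c) ((fun x => x + c)%R @^-1` A).
by congr (lebesgue_outer _ <= _); apply/seteqP; split => x /=; rewrite subrK.
Qed.

Lemma lebesgue_outer_box p : lebesgue_outer (box p) <= (box_volume p)%:E.
Proof.
apply: ereal_inf_lbound; exists [set p]; last by rewrite esum_set1.
by split; [exact: countable1 | move=> x xp; exists p].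
Qed.

Lemma ler_coord_norm x (i : 'I_N) : (`|x ord0 i| <= `|x|)%R.
Proof.
rewrite /Num.norm/= mx_normrE.
exact: (le_bigmax_cond _ (fun i : 'I_1 * 'I_N => `|x i.1 i.2|%R) (j := (ord0, i))).
Qed.

Lemma lebesgue_outer_bounded A : bounded_set A -> lebesgue_outer A < +oo.
Proof.
move=> [M [_ AM]]; pose r := (`|M| + 1)%R.
apply: (@le_lt_trans _ _ (lebesgue_outer (box (const_mx (- r)%R, const_mx r)))).
  apply: le_lebesgue_outer => x /AM xM i; rewrite !mxE -ler_norml.
  have /= xr := xM r.
  apply: le_trans (ler_coord_norm _ _) (xr _).
  by rewrite (le_lt_trans (ler_norm _))// ltrDl.
by apply: le_lt_trans (lebesgue_outer_box _) _; rewrite ltry.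
Qed.

(** Additivity of length when the interval from [a] to [b] is cut at [c], including the cases where
    it or one of its pieces is empty. *)
Local Lemma max_sub_split (a b c : R) : (Num.max 0 (b - a) =
  Num.max 0 (Num.min b c - a) + Num.max 0 (b - Num.max a c))%R.
Proof.
by have [?|?] := leP b c; have [?|?] := leP a c; rewrite /Num.max;
  do 3?[case: ifPn => [?|/negbTE]; [|move=> /negbT; rewrite -leNgt => ?]]; lra.
Qed.

(** Caratheodory's criterion: the hyperplane [x_i = c] cuts each box of a cover of [X] into two
    boxes whose volumes add up, and the two families of pieces cover the two parts of [X]. *)
Lemma halfspace_measurable (i : 'I_N) (c : R) :
  measurable ([set x | x ord0 i < c]%R : set (lebspace R N)).
Proof.
apply: le_caratheodory_measurable => X.
apply: le_ereal_inf_tmp => _ [C [cC XC] <-].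
pose lo p := (p.1, \row_j if j == i then Num.min (p.2 ord0 i) c else p.2 ord0 j)%R.
pose hi p := (\row_j if j == i then Num.max (p.1 ord0 i) c else p.1 ord0 j, p.2)%R.
have volD p : (box_volume p)%:E = (box_volume (lo p))%:E + (box_volume (hi p))%:E.
  rewrite -EFinD; congr (_%:E); rewrite /box_volume (bigD1 i)//=.
  rewrite [X in (_ = X + _)%R](bigD1 i)//= [X in (_ = _ + X)%R](bigD1 i)//=.
  rewrite [X in (_ + _ * X)%R](eq_bigr
    (fun j => Num.max 0 (p.2 ord0 j - p.1 ord0 j))%R); last first.
    by move=> j /negPf ji; rewrite !mxE ji.
  rewrite [X in (_ * X + _)%R](eq_bigr
    (fun j => Num.max 0 (p.2 ord0 j - p.1 ord0 j))%R); last first.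
    by move=> j /negPf ji; rewrite !mxE ji.
  rewrite -mulrDl; congr (_ * _)%R; rewrite !mxE eqxx.
  exact: max_sub_split.
rewrite (eq_esum (fun p _ => volD p)) esumD//.
apply: leeD.
  apply: le_trans (esum_image_le C lo vol_ge0).
  apply: ereal_inf_lbound; exists (lo @` C) => //; split.
    exact: card_le_trans (card_image_le _ _) cC.
  move=> x [/XC[p Cp px] Hx]; exists (lo p); first by exists p.
  move=> j /=; rewrite mxE; case: eqVneq => [->|_]; last exact: px.
  have /andP[-> /= ?] := px i; rewrite le_min; apply/andP; split => //.
  exact/ltW.
apply: le_trans (esum_image_le C hi vol_ge0).
apply: ereal_inf_lbound; exists (hi @` C) => //; split.
  exact: card_le_trans (card_image_le _ _) cC.
move=> x [/XC[p Cp px] /negP]; rewrite -leNgt => Hx; exists (hi p); first by exists p.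
move=> j /=; rewrite mxE; case: eqVneq => [->|_]; last exact: px.
by have /andP[? ->] := px i; rewrite ge_max andbT; apply/andP; split.
Qed.

Lemma coord_measurable (i : 'I_N) :
  measurable_fun setT (fun x : lebspace R N => (x : 'rV[R]_N) ord0 i).
Proof.
apply: (measurability _ (measurable_realfun.RGenInftyO.measurableE R)) => _ [_ [a ->] <-].
rewrite setTI; have := halfspace_measurable i a.
by congr (measurable _); apply/seteqP; split => x /=; rewrite in_itv.
Qed.

(** An open set is the union of the open boxes with rational corners that it contains, and these are
    countably many. *)
Lemma open_measurable_rV (A : set 'rV[R]_N) : open A ->
  measurable (A : set (lebspace R N)).
Proof.
move=> oA.
pose B (q : 'rV[rat]_N * 'rV[rat]_N) : set (lebspace R N) :=
  [set x : 'rV[R]_N | forall i, (ratr (q.1 ord0 i) < x ord0 i < ratr (q.2 ord0 i))%R].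
have mB q : measurable (B q).
  rewrite (_ : B q = \bigcap_(i in [set: 'I_N])
    ((fun x : lebspace R N => (x : 'rV[R]_N) ord0 i) @^-1`
      `](ratr (q.1 ord0 i)), (ratr (q.2 ord0 i))[%classic)).
    apply: fin_bigcap_measurable => // i _; rewrite -[X in measurable X]setTI.
    exact: coord_measurable.
  apply/seteqP; split => [x xq i _|x xq i].
    by rewrite /= in_itv/=; exact: xq.
  by have := xq i I; rewrite /= in_itv.
pose C q : set (lebspace R N) := if `[< B q `<=` A >] then B q else set0.
have -> : A = \bigcup_q C q.
  apply/seteqP; split => [x Ax|x [q _]]; last first.
    by rewrite /C; case: asboolP => // BA /BA.
  have /nbhs_ballP[e /= e0 eA] := open_nbhs_nbhs (conj oA Ax).
  have lt1 i : (x ord0 i - e < x ord0 i)%R by rewrite ltrBlDr ltrDl.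
  have lt2 i : (x ord0 i < x ord0 i + e)%R by rewrite ltrDl.
  have [q1 q1P] := @choice _ _ (fun i (q : rat) =>
     ratr q \in `](x ord0 i - e)%R, (x ord0 i)[%R) (fun i => rat_in_itvoo (lt1 i)).
  have [q2 q2P] := @choice _ _ (fun i (q : rat) =>
     ratr q \in `](x ord0 i)%R, (x ord0 i + e)[%R) (fun i => rat_in_itvoo (lt2 i)).
  exists (\row_i q1 i, \row_i q2 i) => //; rewrite /C asboolT.
    move=> i; rewrite !mxE; have := q1P i; have := q2P i; rewrite !in_itv/=.
    by move=> /andP[-> _] /andP[_ ->].
  move=> y yq; apply: eA; split => // i j; rewrite (ord1 i) /ball/= ltr_distl.
  have := q1P j; have := q2P j; have := yq j; rewrite !mxE !in_itv/=.
  by move=> /andP[? ?] /andP[? ?] /andP[? ?]; apply/andP; split; lra.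
apply: countable_bigcupT_measurable; first exact: countableP.
by move=> q; rewrite /C; case: ifPn => _ //; exact: mB.
Qed.

Lemma continuous_measurable_rV (F : 'rV[R]_N -> R) : continuous F ->
  measurable_fun setT (F : lebspace R N -> R).
Proof.
move=> cF; apply: (measurability _ (measurable_realfun.RGenOpens.measurableE R)) => _ [_ [a [b ->]] <-].
rewrite setTI; apply: open_measurable_rV.
by apply: open_comp; [move=> x _; exact: cF | exact: interval_open].
Qed.

(** The translation is moved to the test set: Caratheodory's condition for the preimage of [Y]
    against [X] is the condition for [Y] against a translate of [X]. *)
Lemma translate_measurable c :
  measurable_fun setT ((fun x => x + c)%R : lebspace R N -> lebspace R N).
Proof.
move=> _ Y mY; rewrite setTI; apply: le_caratheodory_measurable => X.
have tX (Z : set 'rV[R]_N) : lebesgue_outer Z =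
    lebesgue_outer ((fun x => x - c)%R @^-1` Z).
  by rewrite (lebesgue_outer_translate (- c)).
set s := (fun x => x + c)%R; set t := (fun x => x - c)%R.
have mYX : lebesgue_outer (t @^-1` X) =
    lebesgue_outer (t @^-1` X `&` Y) + lebesgue_outer (t @^-1` X `&` ~` Y) := mY _.
change (lebesgue_outer (X `&` s @^-1` Y) + lebesgue_outer (X `&` ~` (s @^-1` Y)) <=
  lebesgue_outer X).
rewrite (tX X) mYX (tX (X `&` s @^-1` Y)) (tX (X `&` ~` (s @^-1` Y))).
have sub (Z : set 'rV[R]_N) : t @^-1` (X `&` s @^-1` Z) = t @^-1` X `&` Z.
  by apply/seteqP; split => x /=; rewrite /s /t subrK.
by rewrite preimage_setC !sub.
Qed.

Lemma integral_translate c (F : lebspace R N -> \bar R) :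
  measurable_fun setT F ->
  \int[leb]_x F (x + c)%R = \int[leb]_x F x.
Proof.
apply: (integral_invariant (translate_measurable c)) => A _.
exact: lebesgue_outer_translate.
Qed.

Lemma integrable_translate c (F : lebspace R N -> \bar R) :
  leb.-integrable setT F -> leb.-integrable setT (fun x => F (x + c)%R).
Proof.
apply: (integrable_invariant (translate_measurable c)) => A _.
exact: lebesgue_outer_translate.
Qed.

(** A set of outer measure 0 satisfies Caratheodory's condition, so it needs no measurable envelope
    other than itself. *)
Lemma ae_lebP (P : 'rV[R]_N -> Prop) :
  {ae (@leb R N), forall x : lebspace R N, P x} <->
  lebesgue_outer [set x | ~ P x] = 0.
Proof.
split => [[A [mA A0 PA]]|P0].
  by apply/eqP; rewrite eq_le lebesgue_outer_ge0 andbT -A0; exact: le_lebesgue_outer.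
exists [set x | ~ P x]; split => //; apply: le_caratheodory_measurable => X.
rewrite -[leRHS]add0e leeD ?le_lebesgue_outer//.
by rewrite -P0; exact: le_lebesgue_outer.
Qed.

End lebesgue_measure_rV.

Lemma sqr_normr (R : realType) (x : R) : `|x| ^+ 2 = x ^+ 2.
Proof. by rewrite real_normK// num_real. Qed.

Lemma ler_normr_sqr (R : realType) (x y : R) : 0 <= y -> x ^+ 2 <= y ^+ 2 -> `|x| <= y.
Proof. by move=> y0; rewrite -(sqr_normr x) ler_sqr ?nnegrE. Qed.

(** * Scalar product, convergence and completeness in L^2 *)

Section L2_theory.
Context d (T : measurableType d) (R : realType) (mu : {measure set T -> \bar R}).
Implicit Types F G H : T -> R.

(** Shaped for the completeness of L^2, where the limit exists almost everywhere and the bound holds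
    eventually. Where the limit exists, it is the lower limit to which Fatou's lemma applies. *)
Lemma fatou_le (H_ : nat -> T -> R) H (c : \bar R) :
  (forall n, measurable_fun setT (H_ n)) -> measurable_fun setT H ->
  (forall n x, 0 <= H_ n x) -> (forall x, 0 <= H x) ->
  {ae mu, forall x, H_ n x @[n --> \oo] --> H x} ->
  (\forall n \near \oo, (\int[mu]_x (H_ n x)%:E <= c)%E) ->
  (\int[mu]_x (H x)%:E <= c)%E.
Proof.
move=> mH_ mH H_0 H0 cvgH [n0 _ Hc].
pose f n x : \bar R := (H_ n x)%:E.
have mf n : measurable_fun setT (f n) by apply/measurable_EFinP.
have f0 n x : (0 <= f n x)%E by rewrite lee_fin.
apply: (@le_trans _ _ (\int[mu]_x limn_einf (f ^~ x))%E).
  apply: ae_ge0_le_integral => //.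
  - by move=> x _; rewrite lee_fin.
  - exact/measurable_EFinP.
  - move=> x _; rewrite limn_einf_lim; apply: lime_ge; first exact: is_cvg_einfs.
    by apply: nearW => n; apply: le_ereal_inf_tmp => _ [m _ <-].
  - apply: (emeasurable_fun_cvg (fun n x => einfs (f ^~ x) n)).
      by move=> n; exact: measurable_fun_einfs.
    by move=> x _; rewrite limn_einf_lim; exact: is_cvg_einfs.
  apply: filterS cvgH => x cx _.
  have cfx : f ^~ x @ \oo --> (H x)%:E by apply: cvg_EFin cx; exact: nearW.
  by rewrite (cvg_limn_einf_sup cfx).1.
apply: le_trans (fatou _ measurableT mf _) _ => //.
rewrite limn_einf_lim; apply: lime_le; first exact: is_cvg_einfs.
(* The infimum over the tail from [n] is at most the term of index [maxn n n0], where the bound is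
   available. *)
apply: nearW => n; apply: le_trans (Hc (maxn n n0) _); last exact: leq_maxr.
by apply: ereal_inf_lbound; exists (maxn n n0) => //=; exact: leq_maxl.
Qed.

Definition L2 F := measurable_fun setT F /\
  mu.-integrable setT (fun x => (F x ^+ 2)%:E).

Definition ip F G : R := \int[mu]_x (F x * G x).

Lemma L2P F : F \in Lfun mu 2%:E <-> L2 F.
Proof.
split => [F2|[mF iF]].
  split; last exact: Lfun2_integrable_sqr.
  by move: F2; rewrite inE => /andP[/[!inE]].
rewrite inE; apply/andP; split; first by rewrite inE.
rewrite inE /= /finite_norm unlock; apply: poweR_lty.
have /integrableP[_] := iF; congr (_ < _)%E; apply: eq_integral => x _ /=.
by rewrite powR_mulrn// normrX.
Qed.

Lemma L2_measurable F : L2 F -> measurable_fun setT F.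
Proof. by case. Qed.

Lemma L2M F G : L2 F -> L2 G -> mu.-integrable setT (fun x => (F x * G x)%:E).
Proof.
move=> /L2P F2 /L2P G2.
by have /Lfun1_integrable := Lfun2_mul_Lfun1 F2 G2.
Qed.

Lemma L2_bounded_mul F G (c : R) : L2 F -> measurable_fun setT G ->
  (forall x, `|G x| <= c) -> L2 (fun x => G x * F x).
Proof.
move=> [mF iF] mG Gc; split; first exact: measurable_funM.
apply: (@le_integrable _ _ _ _ _ measurableT _ (fun x => ((c ^+ 2) * (F x ^+ 2))%:E)).
- by apply/measurable_EFinP; apply: measurable_funX; exact: measurable_funM.
- move=> x _; have c0 : 0 <= c by exact: le_trans (Gc x).
  have Gc2 : G x ^+ 2 <= c ^+ 2 by rewrite -(sqr_normr (G x)) ler_sqr ?nnegrE.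
  rewrite !abse_EFin lee_fin exprMn.
  rewrite !(ger0_norm (mulr_ge0 (sqr_ge0 _) (sqr_ge0 _))).
  by rewrite ler_wpM2r ?sqr_ge0.
- exact: (integrableZl measurableT (c ^+ 2) iF).
Qed.

Lemma L2Z c F : L2 F -> L2 (fun x => c * F x).
Proof. by move=> F2; apply: (L2_bounded_mul (c := `|c|)) => //. Qed.

Lemma L2_le F G : measurable_fun setT F -> L2 G ->
  (forall x, F x ^+ 2 <= G x ^+ 2) -> L2 F.
Proof.
move=> mF [mG iG] FG; split => //.
apply: (le_integrable _ _ _ iG) => //.
  by apply/measurable_EFinP; exact: measurable_funX.
by move=> x _; rewrite !abse_EFin lee_fin !ger0_norm ?sqr_ge0.
Qed.

Lemma L2D F G : L2 F -> L2 G -> L2 (fun x => F x + G x).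
Proof.
move=> F2 G2; have [mF iF] := F2; have [mG iG] := G2.
split; first exact: measurable_funD.
have -> : (fun x => ((F x + G x) ^+ 2)%:E) =
    (fun x => (F x ^+ 2)%:E + (2 * (F x * G x))%:E + (G x ^+ 2)%:E)%E.
  by apply/funext => x; rewrite -!EFinD; congr EFin; ring.
apply: integrableD => //; apply: integrableD => //.
exact: (integrableZl measurableT 2 (L2M F2 G2)).
Qed.

Lemma L2N F : L2 F -> L2 (fun x => - F x).
Proof. by move=> /(@L2Z (-1)); under eq_fun do rewrite mulN1r. Qed.

Lemma L2B F G : L2 F -> L2 G -> L2 (fun x => F x - G x).
Proof. by move=> F2 /L2N; exact: L2D. Qed.

Lemma L20 : L2 (fun=> 0).
Proof.
split; first exact: measurable_cst.
by rewrite expr0n/=; exact: integrable0.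
Qed.

Lemma L2_sum (I : Type) (r : seq I) (F_ : I -> T -> R) :
  (forall i, L2 (F_ i)) -> L2 (fun x => \sum_(i <- r) F_ i x).
Proof.
move=> F2; elim: r => [|i r IH]; first by under eq_fun do rewrite big_nil; exact: L20.
by under eq_fun do rewrite big_cons; exact: L2D.
Qed.

Lemma ipC F G : ip F G = ip G F.
Proof. by apply: eq_Rintegral => x _; rewrite mulrC. Qed.

Lemma ipDl F G H : L2 F -> L2 G -> L2 H -> ip (fun x => F x + G x) H = ip F H + ip G H.
Proof.
move=> F2 G2 H2; rewrite /ip -RintegralD//; [|exact: L2M..].
by apply: eq_Rintegral => x _; rewrite mulrDl.
Qed.

Lemma ipZl c F G : L2 F -> L2 G -> ip (fun x => c * F x) G = c * ip F G.
Proof.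
move=> F2 G2; rewrite /ip -RintegralZl//; last exact: L2M.
by apply: eq_Rintegral => x _; rewrite mulrA.
Qed.

Lemma ipDr F G H : L2 F -> L2 G -> L2 H -> ip H (fun x => F x + G x) = ip H F + ip H G.
Proof. by move=> *; rewrite ipC ipDl// ![ip _ H]ipC. Qed.

Lemma ipZr c F G : L2 F -> L2 G -> ip G (fun x => c * F x) = c * ip G F.
Proof. by move=> *; rewrite ipC ipZl// [ip _ G]ipC. Qed.

Lemma ipNl F G : L2 F -> L2 G -> ip (fun x => - F x) G = - ip F G.
Proof.
move=> F2 G2; rewrite -mulN1r -ipZl//.
by apply: eq_Rintegral => x _; rewrite mulN1r.
Qed.

Lemma ipBl F G H : L2 F -> L2 G -> L2 H -> ip (fun x => F x - G x) H = ip F H - ip G H.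
Proof. by move=> F2 G2 H2; rewrite ipDl ?ipNl//; exact: L2N. Qed.

Lemma ipBr F G H : L2 F -> L2 G -> L2 H -> ip H (fun x => F x - G x) = ip H F - ip H G.
Proof. by move=> *; rewrite ipC ipBl// ![ip _ H]ipC. Qed.

Lemma ip_ge0 F : 0 <= ip F F.
Proof. by apply: Rintegral_ge0 => x _; rewrite -expr2 sqr_ge0. Qed.

Lemma ip_fin F : L2 F -> (ip F F)%:E = (\int[mu]_x (F x ^+ 2)%:E)%E.
Proof.
move=> F2; rewrite /ip /Rintegral; under eq_integral do rewrite -expr2.
by rewrite fineK//; apply: integrable_fin_num => //; exact: F2.2.
Qed.

Lemma ip_sqrD F G : L2 F -> L2 G ->
  ip (fun x => F x + G x) (fun x => F x + G x) = ip F F + 2 * ip F G + ip G G.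
Proof.
move=> F2 G2; rewrite ipDl ?ipDr//; [|exact: L2D].
rewrite (ipC G F); ring.
Qed.

Lemma ip_sqrB F G : L2 F -> L2 G ->
  ip (fun x => F x - G x) (fun x => F x - G x) = ip F F - 2 * ip F G + ip G G.
Proof.
move=> F2 G2; rewrite ipBl ?ipBr//; [|exact: L2B].
rewrite (ipC G F); ring.
Qed.

Lemma ip_sqrZ c F : L2 F -> ip (fun x => c * F x) (fun x => c * F x) = c ^+ 2 * ip F F.
Proof. by move=> F2; rewrite ipZl ?ipZr//; [ring | exact: L2Z]. Qed.

Lemma ip_sqrD_le F G : L2 F -> L2 G ->
  ip (fun x => F x + G x) (fun x => F x + G x) <= 2 * ip F F + 2 * ip G G.
Proof.
move=> F2 G2; have := ip_ge0 (fun x => F x - G x).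
by rewrite (ip_sqrB F2 G2) (ip_sqrD F2 G2); lra.
Qed.

(** The polynomial [t -> ip (F + t G) (F + t G)] is nonnegative; its value at the minimizer
    [- b / c] gives the inequality. *)
Lemma cauchy_schwarz F G : L2 F -> L2 G -> ip F G ^+ 2 <= ip F F * ip G G.
Proof.
move=> F2 G2; set a := ip F F; set b := ip F G; set c := ip G G.
have h t : 0 <= a + 2 * t * b + t ^+ 2 * c.
  have := ip_ge0 (fun x => F x + t * G x).
  by rewrite ip_sqrD//; [rewrite ipZr// ip_sqrZ// mulrA | exact: L2Z].
have a0 : 0 <= a by exact: ip_ge0.
have c0 : 0 <= c by exact: ip_ge0.
have [c_eq0|c_neq0] := eqVneq c 0.
  have [->|b0] := eqVneq b 0; first by rewrite expr0n/= mulr_ge0.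
  (* If [c = 0] the polynomial is affine; unless [b = 0], this [t] gives it the value -1. *)
  have := h (- (a + 1) / (2 * b)); rewrite c_eq0 mulr0 addr0.
  have -> : 2 * (- (a + 1) / (2 * b)) * b = - (a + 1) by field.
  lra.
have cp : 0 < c by rewrite lt_neqAle eq_sym c_neq0.
have := h (- b / c).
have -> : a + 2 * (- b / c) * b + (- b / c) ^+ 2 * c = (a * c - b ^+ 2) / c by field.
by rewrite pmulr_lge0 ?invr_gt0// subr_ge0.
Qed.

Lemma ip_cvg0 (F_ G_ : nat -> T -> R) (c : R) : (forall n, L2 (F_ n)) -> (forall n, L2 (G_ n)) ->
  (forall n, ip (G_ n) (G_ n) <= c) ->
  ip (F_ n) (F_ n) @[n --> \oo] --> 0 -> ip (F_ n) (G_ n) @[n --> \oo] --> 0.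
Proof.
move=> F2 G2 Gc F0; apply/cvgrPdist_le => e e0.
have c0 : 0 <= c by apply: le_trans (Gc 0%N); exact: ip_ge0.
have ec : 0 < e ^+ 2 / (c + 1) by rewrite divr_gt0 ?exprn_gt0//; lra.
move/cvgrPdist_le : F0 => /(_ _ ec); apply: filterS => n.
rewrite !sub0r !normrN (ger0_norm (ip_ge0 _)) => Fe.
apply: ler_normr_sqr; first exact: ltW.
apply: le_trans (cauchy_schwarz (F2 n) (G2 n)) _.
apply: le_trans (ler_pM (ip_ge0 _) (ip_ge0 _) Fe (Gc n)) _.
rewrite mulrAC ler_pdivrMr; last lra.
by rewrite ler_wpM2l ?exprn_ge0 ?ltW//; lra.
Qed.

Lemma nneseries_fin_cvg (a : nat -> R) : (forall n, 0 <= a n) ->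
  (\sum_(n <oo) (a n)%:E < +oo)%E -> cvgn (series a).
Proof.
move=> a0 aoo; apply: nondecreasing_is_cvgn.
  by apply/nondecreasing_seqP => n; rewrite /series/= big_nat_recr//= lerDl.
exists (fine (\sum_(n <oo) (a n)%:E)%E) => _ [n _ <-].
rewrite -lee_fin fineK; last first.
  by rewrite ge0_fin_numE// nneseries_ge0// => k _ _; rewrite lee_fin.
rewrite /series/= -sumEFin; apply: nneseries_lim_ge => k _ _; by rewrite lee_fin.
Qed.

(** By monotone convergence the integral of the sum is at most [2 c], so the sum is finite almost
    everywhere. *)
Lemma ae_summable (H_ : nat -> T -> R) (c : R) :
  (forall n, measurable_fun setT (H_ n)) -> (forall n x, 0 <= H_ n x) ->
  (forall n, (\int[mu]_x (H_ n x)%:E <= (c / 2 ^+ n)%:E)%E) ->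
  {ae mu, forall x, cvgn (series (H_ ^~ x))}.
Proof.
move=> mH H0 Hc.
pose S x := (\sum_(n <oo) (H_ n x)%:E)%E.
have mHE n : measurable_fun setT (fun x => (H_ n x)%:E) by apply/measurable_EFinP.
have S0 x : (0 <= S x)%E by apply: nneseries_ge0 => n _ _; rewrite lee_fin.
have mS : measurable_fun setT S.
  by apply: ge0_emeasurable_sum => // n x _ _; rewrite lee_fin.
have iS : mu.-integrable setT S.
  apply/integrableP; split => //.
  under eq_integral do rewrite gee0_abs//.
  rewrite integral_nneseries//; last by move=> n x _; rewrite lee_fin.
  apply: (@le_lt_trans _ _ (\sum_(n <oo) (c / 2 ^+ n)%:E)%E).
    apply: lee_nneseries => n *; last exact: Hc.
    by apply: integral_ge0 => x _; rewrite lee_fin.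
  have -> : (fun n => \sum_(0 <= k < n) (c / 2 ^+ k)%:E)%E = EFin \o (series (geometric c 2^-1)).
    apply/funext => n /=; rewrite sumEFin; congr EFin; apply: eq_bigr => k _.
    by rewrite /geometric/= exprVn.
  have /cvg_geometric_series : `|2^-1 : R| < 1 by rewrite ger0_norm ?invf_lt1// ltr1n.
  move=> /(_ c) cg; rewrite (@cvg_lim _ _ _ _ _ _ (c * (1 - 2^-1)^-1)%:E)//.
    exact: ltry.
  by apply: cvg_EFin cg; exact: nearW.
have := integrable_ae measurableT iS; apply: filterS => x /(_ I) Sx.
apply: nneseries_fin_cvg => //; rewrite -/(S x) -ge0_fin_numE//.
Qed.

(** Along indices with squared norm at most [2^-n] the series of squares converges almost
    everywhere, so its terms tend to 0. The condition [n <= k n] is enough for [k] to preserve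
    limits. *)
Lemma ip_subseq_ae (F_ : nat -> T -> R) : (forall n, L2 (F_ n)) ->
  ip (F_ n) (F_ n) @[n --> \oo] --> 0 ->
  exists k : nat -> nat, (forall n, (n <= k n)%N) /\
    {ae mu, forall x, F_ (k n) x @[n --> \oo] --> 0}.
Proof.
move=> F2 F0.
have /choice[k kP] : forall n, exists m, (n <= m)%N /\ ip (F_ m) (F_ m) <= 1 / 2 ^+ n.
  move=> n; have e0 : 0 < 1 / 2 ^+ n :> R by rewrite divr_gt0// exprn_gt0.
  move/cvgrPdist_le : F0 => /(_ _ e0)[m _ mP]; exists (maxn n m).
  rewrite leq_maxl; split => //; have := mP (maxn n m) (leq_maxr _ _).
  by rewrite sub0r normrN ger0_norm// ip_ge0.
exists k; split; first by move=> n; case: (kP n).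
have : {ae mu, forall x, cvgn (series (fun n => F_ (k n) x ^+ 2))}.
  apply: (ae_summable (c := 1)) => [n|n x|n].
  - exact: measurable_funX (F2 _).1.
  - exact: sqr_ge0.
  - by rewrite -ip_fin// lee_fin; case: (kP n).
apply: filterS => x /cvg_series_cvg_0 cx.
apply/cvgrPdist_le => e e0; move/cvgrPdist_le : cx => /(_ _ (exprn_gt0 2 e0)).
apply: filterS => n; rewrite !sub0r !normrN => h.
by apply: ler_normr_sqr; [exact: ltW | exact: le_trans (ler_norm _) h].
Qed.

(** Riesz-Fischer: a rapidly Cauchy subsequence converges almost everywhere, and Fatou's lemma shows
    that its limit is the L^2 limit of the whole sequence. *)
Lemma L2_complete (F_ : nat -> T -> R) : (forall n, L2 (F_ n)) ->
  (forall e : R, 0 < e -> exists n0, forall m n, (n0 <= m)%N -> (n0 <= n)%N ->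
    ip (fun x => F_ m x - F_ n x) (fun x => F_ m x - F_ n x) <= e) ->
  exists2 F, L2 F &
    ip (fun x => F_ n x - F x) (fun x => F_ n x - F x) @[n --> \oo] --> 0.
Proof.
move=> F2 cauchyF.
have /choice[k0 k0P] : forall j, exists n0, forall m n, (n0 <= m)%N -> (n0 <= n)%N ->
    ip (fun x => F_ m x - F_ n x) (fun x => F_ m x - F_ n x) <= (4 ^+ j)^-1.
  by move=> j; apply: cauchyF; rewrite invr_gt0 exprn_gt0.
(* The maximum makes the index [k j] valid for every tolerance [4^-i] with [i <= j]. *)
pose k j := (\max_(i < j.+1) k0 i)%N.
have k0k i j : (i <= j)%N -> (k0 i <= k j)%N.
  by move=> ij; rewrite /k (leq_bigmax_cond (Ordinal (ij : (i < j.+1)%N))).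
pose D j x := F_ (k j.+1) x - F_ (k j) x.
have D2 j : L2 (D j) by exact: L2B.
(* The margin between [4^-j] and [2^-j] pays for the weight [2 ^+ j], which is what allows [|D j|],
   and not only its square, to be summed. *)
have aeD : {ae mu, forall x, cvgn (series (fun j => 2 ^+ j * D j x ^+ 2))}.
  apply: (ae_summable (c := 1)) => [j|j x|j].
  - by apply: measurable_funM => //; exact: measurable_funX (D2 j).1.
  - by rewrite mulr_ge0 ?sqr_ge0 ?exprn_ge0.
  - under eq_integral do rewrite EFinM.
    rewrite integralZl//; last exact: (D2 j).2.
    rewrite -ip_fin// -EFinM lee_fin.
    have /(ler_wpM2l (exprn_ge0 j (ler0n R 2))) := k0P j _ _ (k0k j j.+1 (leqnSn _)) (k0k j j (leqnn _)).
    move/le_trans; apply; rewrite div1r (_ : 4 = 2 * 2)%R; last by ring.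
    by rewrite exprMn invfM mulrA divff ?mul1r// expf_neq0.
have [A [mA A0 DA]] := aeD.
(* Set to 0 on the exceptional set, the subsequence converges everywhere and its limit is
   measurable. *)
pose G j x := if x \in A then 0 else F_ (k j) x.
have GE j : G j = (F_ (k j)) \_ (~` A).
  by apply/funext => x; rewrite /G /patch in_setC; case: (x \in A).
have mG j : measurable_fun setT (G j).
  rewrite GE; apply/(measurable_restrictT _ (measurableC mA)).
  exact: measurable_funTS (F2 _).1.
have cG x : cvgn (G ^~ x).
  have [xA|xA] := boolP (x \in A).
    rewrite (_ : G ^~ x = cst 0); first exact: is_cvg_cst.
    by apply/funext => j; rewrite /G xA.
  rewrite (_ : G ^~ x = fun j => F_ (k j) x); last first.
    by apply/funext => j; rewrite /G (negPf xA).
  have : cvgn (series (fun j => 2 ^+ j * D j x ^+ 2)).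
    by apply: contrapT => /DA xA'; move: xA; rewrite mem_set.
  move=> c2; have : cvgn (series (fun j => D j x)).
    apply: normed_cvg; apply: (@series_le_cvg _ _ (fun j => 2 ^+ j * D j x ^+ 2 + geometric 1 2^-1 j)).
    - by move=> j; exact: normr_ge0.
    - move=> j; rewrite addr_ge0//; first by rewrite mulr_ge0 ?sqr_ge0 ?exprn_ge0.
      by rewrite /geometric/= mul1r exprn_ge0.
    - move=> j /=; rewrite mul1r exprVn; set a := D j x; set b := 2 ^+ j.
      have b0 : 0 < b by rewrite exprn_gt0.
      (* This square gives [|a| <= b a^2 + 1/b], the sum of two summable terms. *)
      have : 0 <= (b * `|a| - 1) ^+ 2 / b by rewrite divr_ge0 ?sqr_ge0// ltW.
      have -> : (b * `|a| - 1) ^+ 2 / b = b * `|a| ^+ 2 - 2 * `|a| + b^-1.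
        by field; rewrite gt_eqF.
      by rewrite sqr_normr; have := normr_ge0 a; lra.
    - by rewrite (_ : (fun j => _) = (fun j => 2 ^+ j * D j x ^+ 2) + geometric 1 2^-1)//;
        apply: is_cvg_seriesD => //; apply: is_cvg_geometric_series;
        rewrite ger0_norm ?invf_lt1// ltr1n.
  rewrite (_ : (fun j => F_ (k j) x) = (fun j => series (fun j => D j x) j + F_ (k 0) x)).
    move=> ?; apply: is_cvgD => //; exact: is_cvg_cst.
  by apply/funext => j; rewrite /series/= telescope_sumr// subrK.
pose F x : R := limn (G ^~ x).
have cGF x : G ^~ x @ \oo --> F x by exact: cG.
have mF : measurable_fun setT F by apply: measurable_fun_cvg => // x _; exact: cGF.
have aeA : {ae mu, forall x, x \notin A}.
  exists A; split => // x /= /negP; rewrite negbK; exact: set_mem.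
(* Fatou's lemma in the index [i] of the subsequence, with [m] fixed. *)
have FF j m : (k0 j <= m)%N ->
    (\int[mu]_x ((F_ m x - F x) ^+ 2)%:E <= ((4 ^+ j)^-1)%:E)%E.
  move=> jm; apply: (fatou_le (H_ := fun i x => (F_ m x - G i x) ^+ 2)).
  - by move=> i; apply: measurable_funX; apply: measurable_funB => //; exact: (F2 m).1.
  - by apply: measurable_funX; apply: measurable_funB => //; exact: (F2 m).1.
  - by move=> i x; exact: sqr_ge0.
  - by move=> x; exact: sqr_ge0.
  - apply: aeW => x; under eq_fun do rewrite expr2; rewrite expr2.
    by apply: cvgM; apply: cvgB => //; exact: cvg_cst.
  - exists j => // i /= ji.
    have -> : (\int[mu]_x ((F_ m x - G i x) ^+ 2)%:E =
        \int[mu]_x ((F_ m x - F_ (k i) x) ^+ 2)%:E)%E.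
      apply: ge0_ae_eq_integral => //.
      + apply/measurable_EFinP; apply: measurable_funX; apply: measurable_funB => //.
        exact: (F2 m).1.
      + by apply/measurable_EFinP; apply: measurable_funX; apply: measurable_funB => //; exact: (F2 _).1.
      + by move=> x _; rewrite lee_fin sqr_ge0.
      + by move=> x _; rewrite lee_fin sqr_ge0.
      + by apply: filterS aeA => x /negPf xA _; rewrite /G xA.
    by rewrite -ip_fin ?lee_fin; [apply: k0P => //; exact: k0k|exact: L2B].
have F2' : L2 F.
  have D0 : L2 (fun x => F_ (k0 0%N) x - F x).
    split; first by apply: measurable_funB => //; exact: (F2 _).1.
    apply/integrableP; split.
      by apply/measurable_EFinP; apply: measurable_funX; apply: measurable_funB => //; exact: (F2 _).1.
    under eq_integral do rewrite gee0_abs ?lee_fin ?sqr_ge0//.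
    exact: le_lt_trans (FF 0%N (k0 0%N) (leqnn _)) (ltry _).
  have := L2B (F2 (k0 0%N)) D0; congr (L2 _).
  by apply/funext => x; rewrite opprB addrC subrK.
exists F => //; apply/cvgrPdist_le => e e0.
have [j je] : exists j, (4 ^+ j)^-1 <= e.
  have : geometric 1 4^-1 j @[j --> \oo] --> (0 : R).
    by apply: cvg_geometric; rewrite ger0_norm ?invf_lt1// ltr1n.
  move=> /cvgrPdist_le/(_ _ e0)[j _ /(_ j (leqnn _))].
  by rewrite sub0r normrN /geometric/= mul1r exprVn => /ler_normlW; exists j.
exists (k0 j) => // m jm; rewrite sub0r normrN ger0_norm ?ip_ge0//.
apply: le_trans je; rewrite -lee_fin ip_fin; [exact: FF | exact: L2B].
Qed.

Lemma Lnorm2E F : L2 F -> Lnorm mu 2%:E (EFin \o F) = (Num.sqrt (ip F F))%:E.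
Proof.
move=> F2; rewrite unlock /=.
have -> : (\int[mu]_x (`|F x| `^ 2)%:E = (ip F F)%:E)%E.
  rewrite ip_fin//; apply: eq_integral => x _.
  by rewrite powR_mulrn// sqr_normr.
by rewrite poweR_EFin powR12_sqrt// ip_ge0.
Qed.

(** Bridge between the extended [Lnorm] in the definition of [H10] and the squared norms used
    throughout. *)
Lemma Lnorm2_cvg0 (F_ : nat -> T -> R) : (forall n, L2 (F_ n)) ->
  (Lnorm mu 2%:E (EFin \o F_ n) @[n --> \oo] --> 0%E) <->
  (ip (F_ n) (F_ n) @[n --> \oo] --> 0).
Proof.
move=> F2; under eq_fun do rewrite Lnorm2E//; split.
  move=> /fine_cvg h0.
  rewrite (_ : (fun n => ip (F_ n) (F_ n)) = (fun n =>
      Num.sqrt (ip (F_ n) (F_ n)) * Num.sqrt (ip (F_ n) (F_ n)))).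
    by rewrite -[X in _ --> X](mulr0 0); exact: cvgM.
  by apply/funext => n /=; rewrite -expr2 sqr_sqrtr ?ip_ge0.
move=> h0; apply: cvg_EFin; first exact: nearW.
rewrite -[X in _ --> X](sqrtr0 R).
apply: (@continuous_cvg _ _ _ _ _ _ Num.sqrt) => //; exact: sqrt_continuous.
Qed.

End L2_theory.

Section integrable_EFin.
Context d (T : measurableType d) (R : realType) (mu : {measure set T -> \bar R}).
Variable D : set T.
Hypothesis mD : measurable D.

Lemma integrable_EFinD (F G : T -> R) : mu.-integrable D (EFin \o F) ->
  mu.-integrable D (EFin \o G) -> mu.-integrable D (EFin \o (fun x => F x + G x)).
Proof. by move=> iF iG; exact: (integrableD mD iF iG). Qed.

Lemma integrable_EFinZ (c : R) (F : T -> R) : mu.-integrable D (EFin \o F) ->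
  mu.-integrable D (EFin \o (fun x => c * F x)).
Proof. by move=> iF; exact: (integrableZl mD c iF). Qed.

Lemma integrable_bounded_mul (F G : T -> R) (c : R) : mu.-integrable D (EFin \o F) ->
  measurable_fun D G -> (forall x, `|G x| <= c) ->
  mu.-integrable D (EFin \o (fun x => F x * G x)).
Proof.
move=> iF mG Gc; have /measurable_EFinP mF := measurable_int _ iF.
apply: (le_integrable mD _ _ (integrableZl mD c iF)).
  by apply/measurable_EFinP; exact: measurable_funM.
move=> x _ /=; rewrite lee_fin !normrM mulrC ler_wpM2r//.
exact: le_trans (Gc x) (ler_norm c).
Qed.

Lemma bounded_integrable (F : T -> R) (c : R) : (mu D < +oo)%E ->
  measurable_fun setT F -> (forall x, `|F x| <= c) -> mu.-integrable D (EFin \o F).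
Proof.
move=> Dfin mF Fc; apply: measurable_bounded_integrable => //; first exact: measurable_funTS.
exists c; split; first exact: num_real.
by move=> r cr x _ /=; exact: le_trans (Fc x) (ltW cr).
Qed.

Lemma le_Rintegral_subset (A : set T) (F : T -> R) : measurable A -> A `<=` D ->
  (forall x, 0 <= F x) -> mu.-integrable setT (EFin \o F) ->
  \int[mu]_(x in A) F x <= \int[mu]_(x in D) F x.
Proof.
move=> mA AD F0 iF; have mF := measurable_int _ iF.
apply: fine_le.
- by apply: integrable_fin_num => //; exact: integrableS iF.
- by apply: integrable_fin_num => //; exact: integrableS iF.
- apply: ge0_subset_integral => //; first exact: measurable_funTS mF.
  by move=> x _; rewrite lee_fin.
Qed.

Lemma le_normr_Rintegral_bound (F G : T -> R) : mu.-integrable D (EFin \o F) ->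
  mu.-integrable D (EFin \o G) -> (forall x, `|F x| <= G x) ->
  `|\int[mu]_(x in D) F x| <= \int[mu]_(x in D) G x.
Proof.
move=> iF iG FG; apply: le_trans (le_normr_Rintegral mD iF) _.
by apply: le_Rintegral => //; exact: integrable_abse iF.
Qed.

Lemma indic_L2 : (mu D < +oo)%E -> L2 mu (\1_D : T -> R).
Proof.
move=> Dfin; split; first exact: measurable_indic.
rewrite (_ : (fun x => _) = EFin \o (\1_D)); last first.
  by apply/funext => x /=; rewrite indicE; case: (x \in _); rewrite ?expr1n ?expr0n.
rewrite (_ : EFin \o _ = (EFin \o (cst 1 : T -> R)) \_ D); last first.
  by apply/funext => x /=; rewrite indicE /patch; case: (x \in _).
apply: (integrable_mkcond _ mD).1; apply: (bounded_integrable (c := 1)) => //.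
by move=> x; rewrite /= normr1.
Qed.

Lemma L2_abs (F : T -> R) : L2 mu F -> L2 mu (fun x => `|F x|).
Proof.
move=> F2; apply: (L2_le _ F2) => [|x]; last by rewrite sqr_normr.
by apply: measurableT_comp => //; exact: F2.1.
Qed.

Lemma L2_patch (F : T -> R) : L2 mu F -> L2 mu (F \_ D).
Proof.
move=> F2; apply: (L2_le _ F2) => [|x].
  by apply/(measurable_restrictT _ mD); exact: measurable_funTS F2.1.
by rewrite /patch; case: ifPn => // _; rewrite expr0n sqr_ge0.
Qed.

End integrable_EFin.

(** * Test functions *)

Section test_functions.
Variables (R : realType) (N : nat).
Notation V := 'rV[R]_N.
Notation e_ i := (delta_mx ord0 i : 'rV[R]_N).
Implicit Types (phi psi : V -> R) (i : 'I_N) (x v : V).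

(** Smoothness quantifies over all iterated partial derivatives; bounding their order makes room for
    an induction in the product rule. *)
Definition smooth_upto (n : nat) phi := forall (s : seq 'I_N) x,
  (size s <= n)%N -> differentiable (foldr (@partial R N) phi s) x.

Lemma smooth_uptoP phi : smooth phi <-> forall n, smooth_upto n phi.
Proof. by split => [h n s x _|h s x]; [exact: h | exact: (h (size s))]. Qed.

Lemma foldr_partialD n phi psi (s : seq 'I_N) : smooth_upto n phi -> smooth_upto n psi ->
  (size s <= n.+1)%N ->
  foldr (@partial R N) (phi + psi) s = foldr (@partial R N) phi s + foldr (@partial R N) psi s.
Proof.
move=> h1 h2; elim: s => //= i s IH sn.
rewrite IH 1?ltnW//; apply/funext => x; rewrite /partial deriveD//;
  by apply: diff_derivable; (apply: h1 || apply: h2).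
Qed.

Lemma smooth_uptoD n phi psi : smooth_upto n phi -> smooth_upto n psi ->
  smooth_upto n (phi + psi).
Proof.
move=> h1 h2 s x sn; rewrite (foldr_partialD h1 h2) 1?leqW//.
by apply: differentiableD; [apply: h1|apply: h2].
Qed.

Lemma foldr_partial_rcons phi s i :
  foldr (@partial R N) phi (rcons s i) = foldr (@partial R N) (partial i phi) s.
Proof. by rewrite foldr_rcons. Qed.

Lemma smooth_partial i phi : smooth phi -> smooth (partial i phi).
Proof. by move=> h s x; rewrite -foldr_partial_rcons; exact: h. Qed.

Lemma smooth_differentiable phi x : smooth phi -> differentiable phi x.
Proof. by move=> /(_ [::] x). Qed.

Lemma partialM i phi psi : smooth phi -> smooth psi ->
  partial i (phi * psi) = phi * partial i psi + psi * partial i phi.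
Proof.
by move=> h1 h2; apply/funext => x; rewrite /partial deriveM//;
  apply: diff_derivable; exact: smooth_differentiable.
Qed.

Lemma smoothD phi psi : smooth phi -> smooth psi -> smooth (phi + psi).
Proof.
move=> /smooth_uptoP h1 /smooth_uptoP h2; apply/smooth_uptoP => n.
exact: smooth_uptoD.
Qed.

(** Induction on the order: a partial derivative of a product is a sum of two products of smooth
    functions, both covered at the previous order. *)
Lemma smoothM phi psi : smooth phi -> smooth psi -> smooth (phi * psi).
Proof.
move=> h1 h2; apply/smooth_uptoP => n.
elim: n phi psi h1 h2 => [|n IH] phi psi h1 h2 s x sn.
  move: s sn => [|//] _ /=.
  by apply: differentiableM; exact: smooth_differentiable.
(* [foldr] applies the last index first, so the list is taken apart from its end. *)
case/lastP: s sn => [_|s i] /=.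
  by apply: differentiableM; exact: smooth_differentiable.
rewrite size_rcons ltnS foldr_partial_rcons partialM// => sn.
by apply: (smooth_uptoD (n := n)) => //; apply: IH => //; exact: smooth_partial.
Qed.

Lemma smooth_cst (c : R) : smooth (cst c : V -> R).
Proof.
have cst_foldr (s : seq 'I_N) : exists c', foldr (@partial R N) (cst c : V -> R) s = cst c'.
  elim: s => [|i s [c' IH]] /=; first by exists c.
  by exists 0; rewrite IH; apply/funext => x; rewrite /partial derive_cst.
move=> s x; have [c' ->] := cst_foldr s; exact: differentiable_cst.
Qed.

Lemma smooth_horner (p : {poly R}) phi : smooth phi -> smooth (fun x => p.[phi x]).
Proof.
move=> h; elim/poly_ind: p => [|p c IH].
  by under eq_fun do rewrite horner0; exact: smooth_cst.
rewrite (_ : (fun x => _) = (fun x => p.[phi x]) * phi + cst c); last first.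
  by apply/funext => x; rewrite hornerMXaddC.
by apply: smoothD (smooth_cst c); exact: smoothM.
Qed.

(** Induction on the polynomial, with the product rule at each step. These composites are the test
    functions that approximate a C^1 function of [u]. *)
Lemma partial_horner i (p : {poly R}) phi x : smooth phi ->
  partial i (fun x => p.[phi x]) x = p^`().[phi x] * partial i phi x.
Proof.
move=> h; elim/poly_ind: p => [|p c IH].
  rewrite deriv0 horner0 mul0r (_ : (fun x => _) = cst 0); last first.
    by apply/funext => y; rewrite horner0.
  by rewrite /partial derive_cst.
have dphi y : derivable phi y (e_ i) by apply: diff_derivable; exact: smooth_differentiable.
have sp := smooth_horner p h.
have dp y : derivable (fun x => p.[phi x]) y (e_ i).
  by apply: diff_derivable; exact: smooth_differentiable.
rewrite (_ : (fun x => _) = (fun x => p.[phi x]) * phi + cst c); last first.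
  by apply/funext => y; rewrite hornerMXaddC.
rewrite {1}/partial deriveD//; last exact: derivableM.
rewrite derive_cst addr0 deriveM// -/(partial i phi x) -/(partial i (fun x => p.[phi x]) x).
rewrite IH derivD derivM derivC addr0 derivX mulr1 !hornerE /GRing.scale/=; ring.
Qed.

Lemma smoothZ (c : R) phi : smooth phi -> smooth (fun x => c * phi x).
Proof. by move=> h; apply: (smoothM (phi := cst c)) => //; exact: smooth_cst. Qed.

Lemma partialZ i (c : R) phi x : smooth phi ->
  partial i (fun x => c * phi x) x = c * partial i phi x.
Proof.
move=> h; have /= -> := partialM i (smooth_cst c) h.
rewrite -[LHS]/(c * partial i phi x + phi x * partial i (cst c : V -> R) x).
by rewrite {2}/partial derive_cst mulr0 addr0.
Qed.

Lemma partialD i phi psi x : smooth phi -> smooth psi ->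
  partial i (fun x => phi x + psi x) x = partial i phi x + partial i psi x.
Proof.
move=> h1 h2; rewrite /partial -(deriveD (f := phi) (g := psi))//;
  by apply: diff_derivable; exact: smooth_differentiable.
Qed.

Lemma smooth_continuous phi : smooth phi -> continuous phi.
Proof.
by move=> h x; apply: differentiable_continuous; exact: smooth_differentiable.
Qed.

Lemma derive_partial phi x v : smooth phi ->
  'D_v phi x = \sum_i v ord0 i * partial i phi x.
Proof.
move=> h; have dphi := smooth_differentiable x h.
rewrite deriveE// [in LHS](row_sum_delta v) linear_sum; apply: eq_bigr => i _.
by rewrite linearZ /partial deriveE.
Qed.

Lemma is_derive_line phi x v (t : R) : smooth phi ->
  is_derive t 1 (fun t : R => phi (x + t *: v)) ('D_v phi (x + t *: v)).
Proof.
move=> sphi; have dphi : derivable phi (x + t *: v) v.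
  by apply: diff_derivable; exact: smooth_differentiable.
have hE : (fun h : R => h^-1 *: (((fun t : R => phi (x + t *: v)) \o shift t) (h *: 1) -
    phi (x + t *: v))) =
  (fun h : R => h^-1 *: ((phi \o shift (x + t *: v)) (h *: v) - phi (x + t *: v))).
  apply/funext => h /=; congr (_ *: (phi _ - _)).
  by rewrite scalerDl (mulr1 h : h%:A = h) addrCA.
split; first by rewrite /derivable hE.
by rewrite /derive hE.
Qed.

Variable Omega : set V.
Local Notation test := (test_function Omega).

Lemma test_smooth phi : test phi -> smooth phi.
Proof. by case. Qed.

Lemma test_out phi x : test phi -> ~ Omega x -> phi x = 0.
Proof.
move=> [_ _ h] nOx; apply: contrapT => /eqP phix.
by apply: nOx; apply: h; exact: subset_closure.
Qed.

Lemma test_patch phi : test phi -> phi \_ Omega = phi.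
Proof.
move=> h; apply/funext => x; rewrite /patch; case: ifPn => // /negP xO.
by rewrite (test_out h)// => Ox; apply: xO; rewrite inE.
Qed.

Lemma test_sub phi psi : smooth psi -> test phi ->
  (forall x, psi x != 0 -> closure [set x | phi x != 0] x) -> test psi.
Proof.
move=> spsi [_ cphi phiO] sub.
have clsub : closure [set x | psi x != 0] `<=` closure [set x | phi x != 0].
  by rewrite ((closure_id (closure [set x | phi x != 0])).1 (@closed_closure _ _)); exact: closureS.
split => //; last exact: subset_trans phiO.
apply: subclosed_compact cphi clsub; exact: closed_closure.
Qed.

Lemma testM phi psi : test phi -> smooth psi -> test (fun x => phi x * psi x).
Proof.
move=> tphi spsi; apply: (test_sub _ tphi).
  by apply: (smoothM (phi := phi)) => //; exact: test_smooth.
by move=> x; rewrite mulf_eq0 negb_or => /andP[? _]; exact: subset_closure.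
Qed.

Lemma testZ c phi : test phi -> test (fun x => c * phi x).
Proof.
move=> tphi; have := testM tphi (smooth_cst c); congr test_function.
by apply/funext => x; rewrite mulrC.
Qed.

(** The condition [p.[0] = 0] keeps the support inside that of [phi]. *)
Lemma test_horner (p : {poly R}) phi : test phi -> p.[0] = 0 -> test (fun x => p.[phi x]).
Proof.
move=> tphi p0; apply: (test_sub _ tphi).
  by apply: smooth_horner; exact: test_smooth.
move=> x px; apply: subset_closure => /=; apply: contra_neq px => ->; exact: p0.
Qed.

Lemma testD phi psi : test phi -> test psi -> test (fun x => phi x + psi x).
Proof.
move=> [s1 c1 o1] [s2 c2 o2].
have sub : closure [set x | phi x + psi x != 0] `<=`
    closure [set x | phi x != 0] `|` closure [set x | psi x != 0].
  rewrite -closureU; apply: closureS => x /=.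
  have [->|?] := eqVneq (phi x) 0; last by left.
  by rewrite add0r; right.
split; first exact: (smoothD s1 s2).
- by apply: subclosed_compact (compactU c1 c2) sub; exact: closed_closure.
- by move=> x /sub[/o1|/o2].
Qed.

Lemma test0 : test (fun=> 0).
Proof.
rewrite /test_function (_ : [set x | _] = set0); last first.
  by apply/seteqP; split => // x /=; rewrite eqxx.
by rewrite closure0; split; [exact: smooth_cst | exact: compact0 | exact: sub0set].
Qed.

Lemma test_sum (I : Type) (r : seq I) (F : I -> V -> R) : (forall k, test (F k)) ->
  test (fun x => \sum_(k <- r) F k x).
Proof.
move=> tF; elim: r => [|k r IH]; first by under eq_fun do rewrite big_nil; exact: test0.
by under eq_fun do rewrite big_cons; exact: testD.
Qed.

(** Off its closed support [phi] vanishes on a neighbourhood, hence so do its derivatives. *)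
Lemma test_partial i phi : test phi -> test (partial i phi).
Proof.
move=> tphi; apply: (test_sub _ tphi).
  by apply: smooth_partial; exact: test_smooth.
move=> x; apply: contra_neqP => nx; rewrite /partial.
have : open (~` closure [set x | phi x != 0]) by apply/closed_openC; exact: closed_closure.
move=> oC; have h := open_nbhs_nbhs (conj oC nx).
rewrite (near_eq_derive (f := phi) (g := cst 0)) ?derive_cst//.
apply: filterS h => y ny; apply: contrapT => /eqP phiy.
by apply: ny; exact: subset_closure.
Qed.

Lemma test_bounded_support phi : test phi ->
  exists2 r : R, 0 < r & forall x, r <= `|x| -> phi x = 0.
Proof.
move=> [_ /compact_bounded[M [_ HM]] _].
exists (`|M| + 2) => [|x xM]; first by have := normr_ge0 M; lra.
apply: contrapT => /eqP phix.
have /HM : M < `|M| + 1 by have := ler_norm M; lra.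
by move=> /(_ x (@subset_closure _ _ x phix)) /=; lra.
Qed.

Lemma test_bounded phi : test phi -> exists2 M : R, 0 < M & forall x, `|phi x| <= M.
Proof.
move=> tphi; have [_ cphi _] := tphi.
have cont : continuous (fun x => `|phi x|).
  move=> x; apply: (@continuous_comp _ _ _ phi (fun y : R => `|y|)).
    exact: (smooth_continuous (test_smooth tphi)).
  exact: norm_continuous.
have [[x0 phix0]|h0] := pselect (exists x, phi x != 0); last first.
  exists 1 => // x; rewrite (_ : phi x = 0) ?normr0//.
  by apply: contrapT => /eqP phix; apply: h0; exists x.
have [|c _ cP] := compact_EVT_max _ cphi (continuous_subspaceT cont).
  by exists x0; exact: subset_closure.
exists (`|phi c| + 1) => [|x]; first by have := normr_ge0 (phi c); lra.
have [->|phix] := eqVneq (phi x) 0; first by rewrite normr0; have := normr_ge0 (phi c); lra.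
have : x \in closure [set x | phi x != 0] by rewrite inE; exact: subset_closure.
by move=> /cP; lra.
Qed.

Lemma test_measurable phi : test phi -> measurable_fun setT (phi : lebspace R N -> R).
Proof.
by move=> /test_smooth/smooth_continuous; exact: continuous_measurable_rV.
Qed.

Lemma bounded_support_integrable (F : V -> R) (M r : R) :
  measurable_fun setT (F : lebspace R N -> R) ->
  (forall x, `|F x| <= M) -> (forall x, r <= `|x| -> F x = 0) ->
  leb.-integrable setT (EFin \o (F : lebspace R N -> R)).
Proof.
move=> mF FM Fr.
pose D : set (lebspace R N) := [set x : V | `|x| < r].
have mD : measurable D.
  apply: open_measurable_rV; rewrite (_ : D = (fun x : V => `|x|) @^-1` [set y | y < r])//.
  by apply: open_comp; [move=> x _; exact: norm_continuous | exact: open_lt].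
have FE : F = F \_ D.
  apply/funext => x; rewrite /patch; case: ifPn => // /negP xD.
  by apply: Fr; rewrite leNgt; apply/negP => ?; apply: xD; rewrite inE.
rewrite FE -restrict_EFin; apply: (integrable_mkcond _ mD).1.
apply: measurable_bounded_integrable => //.
- apply: lebesgue_outer_bounded; exists r; split; first exact: num_real.
  by move=> s rs x /= xr; exact/ltW/(lt_trans xr).
- exact: measurable_funTS.
- exists M; split; first exact: num_real.
  by move=> s Ms x _ /=; exact: le_trans (FM x) (ltW Ms).
Qed.

Lemma test_integrable phi : test phi -> leb.-integrable setT (EFin \o (phi : lebspace R N -> R)).
Proof.
move=> tphi; have [M _ HM] := test_bounded tphi; have [r _ Hr] := test_bounded_support tphi.
exact: bounded_support_integrable (test_measurable tphi) HM Hr.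
Qed.

Lemma test_L2 phi : test phi -> L2 leb (phi : lebspace R N -> R).
Proof.
move=> tphi; split; first exact: test_measurable.
exact: (test_integrable (testM tphi (test_smooth tphi))).
Qed.

Lemma test_derive_bounded phi v : test phi ->
  exists2 M : R, 0 < M & forall x, `|'D_v phi x| <= M.
Proof.
move=> tphi.
have /choice[M MP] : forall i, exists M : R, forall x, `|partial i phi x| <= M.
  by move=> i; have [M _ ?] := test_bounded (test_partial i tphi); exists M.
exists (\sum_i `|v ord0 i| * `|M i| + 1) => [|x].
  by rewrite ltr_pwDr// sumr_ge0// => i _; rewrite mulr_ge0.
rewrite derive_partial; last exact: test_smooth.
apply: (@le_trans _ _ (\sum_i `|v ord0 i| * `|M i|)); last by rewrite lerDl.
apply: le_trans (ler_norm_sum _ _ _) _; apply: ler_sum => i _.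
by rewrite normrM ler_wpM2l// (le_trans (MP i x))// ler_norm.
Qed.

Lemma test_derive v phi : test phi -> test ('D_v phi).
Proof.
move=> tphi; rewrite (_ : 'D_v phi = fun x => \sum_i v ord0 i * partial i phi x).
  by apply: test_sum => i; apply: testZ; exact: test_partial.
by apply/funext => x; rewrite derive_partial//; exact: test_smooth tphi.
Qed.

(** Mean value theorem on the segment from [y] to [x]. This crude control is what the dyadic
    induction starts from. *)
Lemma test_lipschitz phi : test phi -> exists2 L : R, 0 < L &
  forall x y, `|phi x - phi y| <= L * \sum_i `|x ord0 i - y ord0 i|.
Proof.
move=> tphi.
have /choice[M MP] : forall i, exists M : R, forall x, `|partial i phi x| <= M.
  by move=> i; have [M _ ?] := test_bounded (test_partial i tphi); exists M.
pose L := \sum_i `|M i| + 1.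
have ML i : M i <= L.
  rewrite /L (bigD1 i)//= (le_trans (ler_norm _))// -addrA lerDl addr_ge0//.
  exact: sumr_ge0.
have L0 : 0 < L by rewrite /L ltr_pwDr// sumr_ge0.
exists L => // x y; set v := x - y.
have der (t : R) : is_derive t 1 (fun t : R => phi (y + t *: v)) ('D_v phi (y + t *: v)).
  exact/is_derive_line/test_smooth.
have cont : {within `[0, 1], continuous (fun t : R => phi (y + t *: v))}.
  by apply: derivable_within_continuous => t _; have [] := der t.
have [c _] := MVT ltr01 (fun t _ => der t) cont.
rewrite scale1r scale0r addr0 subr0 mulr1 /v (addrC y) subrK => ->.
rewrite derive_partial; last exact: test_smooth.
rewrite mulr_sumr; apply: le_trans (ler_norm_sum _ _ _) _; apply: ler_sum => i _.
rewrite normrM mulrC !mxE; apply: ler_wpM2r => //.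
exact: le_trans (MP i _) (ML i).
Qed.

Lemma Rintegral_translate (c : V) (F : V -> R) :
  measurable_fun setT (F : lebspace R N -> R) ->
  \int[leb]_x F (x + c) = \int[leb]_(x in [set: lebspace R N]) F x.
Proof.
move=> mF; rewrite /Rintegral; congr fine.
by apply: (integral_translate c (F := EFin \o F)); exact/measurable_EFinP.
Qed.

Lemma measurable_translate (F : V -> R) c : measurable_fun setT (F : lebspace R N -> R) ->
  measurable_fun setT ((fun x => F (x + c)) : lebspace R N -> R).
Proof.
move=> mF; exact: (measurableT_comp (f := F : lebspace R N -> R) mF (translate_measurable c)).
Qed.

(** Differentiation under the integral sign, with a constant dominating function on a set of finite
    measure. With the mean value theorem in [t], it turns translations into estimates by
    derivatives, in place of integration along lines. *)
Lemma shift_integral_derive phi v (D : set (lebspace R N)) (t : R) : test phi ->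
  measurable D -> (leb D < +oo)%E ->
  is_derive t 1 (fun t : R => \int[leb]_(x in D) phi (x + t *: v))
    (\int[leb]_(x in D) 'D_v phi (x + t *: v)).
Proof.
move=> tphi mD Dfin.
have [M M0 HM] := test_derive_bounded v tphi.
have [M' _ HM'] := test_bounded tphi.
pose f (t : R) (x : lebspace R N) : R := phi (x + t *: v).
have d1f x (s : R) : is_derive s 1 (f ^~ x) ('D_v phi (x + s *: v)).
  exact/is_derive_line/test_smooth.
have t_in : `](t - 1), (t + 1)[%classic t by rewrite /= in_itv/=; lra.
have intf s : `](t - 1), (t + 1)[%classic s -> leb.-integrable D (EFin \o f s).
  move=> _; apply: measurable_bounded_integrable => //.
    apply: measurable_funTS.
    exact: (measurable_translate (s *: v) (test_measurable tphi)).
  exists M'; split; first exact: num_real.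
  by move=> r M'r x _ /=; exact: le_trans (HM' _) (ltW M'r).
have derf s x : `](t - 1), (t + 1)[%classic s -> D x -> derivable (f ^~ x) s 1.
  by move=> _ _; have [] := d1f x s.
have intM : leb.-integrable D (EFin \o (cst M : lebspace R N -> R)).
  apply: measurable_bounded_integrable => //; exists M; split; first exact: num_real.
  by move=> r Mr x _ /=; rewrite gtr0_norm// ltW.
have d1fE s x : partial1of2 f s x = 'D_v phi (x + s *: v).
  by rewrite partial1of2E; have [_ ->] := d1f x s.
have ub s x : `](t - 1), (t + 1)[%classic s -> D x -> `|partial1of2 f s x| <= cst M x.
  by move=> _ _; rewrite d1fE.
split.
  exact: (derivable_under_integral mD t_in intf derf (fun=> ltW M0) intM ub).
rewrite -derive1E (differentiation_under_integral mD t_in intf derf (fun=> ltW M0) intM ub).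
by apply: eq_Rintegral => x _; rewrite d1fE.
Qed.

Lemma openball_measurable (r : R) :
  measurable ([set x : V | `|x| < r] : set (lebspace R N)).
Proof.
apply: open_measurable_rV.
rewrite (_ : [set x : V | `|x| < r] = (fun x : V => `|x|) @^-1` [set y | y < r])//.
by apply: open_comp; [move=> x _; exact: norm_continuous | exact: open_lt].
Qed.

Lemma openball_finite (r : R) : (leb ([set x : V | (`|x| < r)%R] : set (lebspace R N)) < +oo)%E.
Proof.
apply: lebesgue_outer_bounded; exists r; split; first exact: num_real.
by move=> s rs x /= xr; exact/ltW/(lt_trans xr).
Qed.

(** By translation invariance the integral of [phi (x + t e_i)] does not depend on [t], and its
    derivative at [t = 0] is the integral of the partial derivative. *)
Lemma test_integral_partial i phi : test phi ->
  \int[leb]_(x in [set: lebspace R N]) partial i phi x = 0.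
Proof.
move=> tphi; have tp := test_partial i tphi.
have [r1 r10 Hr1] := test_bounded_support tphi.
have [r2 r20 Hr2] := test_bounded_support tp.
pose K := `|e_ i|.
(* A ball containing the supports of the partial derivative and of all translates with [|t| <= 1],
   so that integrals over it are integrals over the whole space. *)
pose D : set (lebspace R N) := [set x : V | `|x| < r1 + r2 + K].
have outD (t : R) x : `|t| <= 1 -> ~ D x -> phi (x + t *: e_ i) = 0.
  move=> t1 /negP; rewrite -leNgt => xD; apply: Hr1.
  have : `|t *: e_ i| <= K by rewrite normrZ ler_piMl.
  by have := lerB_normD x (t *: e_ i); lra.
have FE (t : R) : `|t| <= 1 -> \int[leb]_(x in D) phi (x + t *: e_ i) =
    \int[leb]_(x in [set: lebspace R N]) phi x.
  move=> t1; rewrite -(Rintegral_translate (t *: e_ i) (test_measurable tphi)).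
  rewrite [LHS]Rintegral_mkcond; apply: eq_Rintegral => x _.
  rewrite /patch; case: ifPn => // /negP xD; rewrite outD// => Dx.
  by apply: xD; rewrite inE.
have [_] := @shift_integral_derive phi (e_ i) D 0 tphi (openball_measurable _) (openball_finite _).
have -> : \int[leb]_(x in D) 'D_(e_ i) phi (x + 0 *: e_ i) =
    \int[leb]_(x in [set: lebspace R N]) partial i phi x.
  rewrite [LHS]Rintegral_mkcond; apply: eq_Rintegral => x _.
  rewrite /patch scale0r addr0; case: ifPn => // /negP xD; apply/esym/Hr2.
  rewrite leNgt; apply/negP => xr; apply: xD; rewrite inE /D/=.
  by have := normr_ge0 (e_ i); rewrite -/K; lra.
move=> <-; rewrite (near_eq_derive (g := cst (\int[leb]_(x in [set: lebspace R N]) phi x))).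
  by rewrite derive_cst.
near=> t; apply: FE; near: t.
by apply/nbhs_ballP; exists 1 => //= t; rewrite /ball/= sub0r normrN => /ltW.
Unshelve. all: by end_near. Qed.

Lemma test_byparts i phi psi : test phi -> test psi ->
  \int[leb]_(x in [set: lebspace R N]) (phi x * partial i psi x) =
  - \int[leb]_(x in [set: lebspace R N]) (partial i phi x * psi x).
Proof.
move=> tphi tpsi; have sphi := test_smooth tphi; have spsi := test_smooth tpsi.
have := test_integral_partial i (testM tphi spsi).
have -> : partial i (fun x => phi x * psi x) =
   fun x => phi x * partial i psi x + partial i phi x * psi x.
  have /= -> := partialM i sphi spsi; apply/funext => x.
  by rewrite -[LHS]/(phi x * partial i psi x + psi x * partial i phi x) (mulrC (psi x)).
rewrite RintegralD//; first by move/eqP; rewrite addr_eq0 => /eqP.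
- exact: (test_integrable (testM tphi (test_smooth (test_partial i tpsi)))).
- exact: (test_integrable (testM (test_partial i tphi) spsi)).
Qed.

End test_functions.

(** * Poincare inequality and weighted compactness on dyadic cubes *)

Section poincare.
Variables (R : realType) (N : nat) (Omega : set 'rV[R]_N).
Notation V := 'rV[R]_N.
Notation leb := (@leb R N).
Notation test := (test_function Omega).
Implicit Types (phi psi : V -> R) (i : 'I_N) (x v : V).

(** Let [F t] be the integral over [Omega] of the translate by [t e] of [phi^2]. Then [F 0] is the
    squared norm, and [F (2 a) = 0] because a shift by [2 a] leaves the slab that contains [Omega].
    The mean value theorem bounds [F 0] by [2 a] times the integral of [2 |phi| |partial i phi|]. *)
Lemma poincare (a : R) i phi : measurable (Omega : set (lebspace R N)) ->
  (leb Omega < +oo)%E ->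
  0 < a -> (forall x, Omega x -> `|x ord0 i| < a) -> test phi ->
  ip leb phi phi <= 16 * a ^+ 2 * ip leb (partial i phi) (partial i phi).
Proof.
move=> mO Ofin a0 Oa tphi; pose e : V := delta_mx ord0 i.
have sphi := test_smooth tphi.
have tpsi : test (fun x => phi x * phi x) := testM tphi sphi.
set psi := fun x => phi x * phi x in tpsi.
have tdphi := test_partial i tphi.
pose F (t : R) := \int[leb]_(x in Omega) psi (x + t *: e).
have dF (t : R) : is_derive t 1 F (\int[leb]_(x in Omega) 'D_e psi (x + t *: e)).
  exact: shift_integral_derive tpsi mO Ofin.
clear Ofin.
have F0 : F 0 = ip leb phi phi.
  rewrite /F Rintegral_mkcond; apply: eq_Rintegral => x _.
  by rewrite /patch scale0r addr0; case: ifPn => // /negP xO; rewrite (test_out tphi) ?mul0r// => Ox;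
    apply: xO; rewrite inE.
have F2a : F (2 * a) = 0.
  rewrite /F Rintegral_mkcond (_ : (fun _ => _) \_ Omega = cst 0).
    by rewrite Rintegral_cst// mul0r.
  apply/funext => x; rewrite /patch; case: ifPn => //; rewrite inE => /Oa xa.
  rewrite (test_out tpsi)// => /Oa; rewrite !mxE !eqxx mulr1.
  by move: xa; rewrite !ltr_norml => /andP[? ?] /andP[? ?]; lra.
have [||c _] := @MVT R F (fun t => \int[leb]_(x in Omega) 'D_e psi (x + t *: e)) 0 (2 * a).
- by rewrite mulr_gt0.
- by apply: derivable_within_continuous => t _; have [] := dF t.
rewrite F2a F0 sub0r subr0 => ipE.
have dpsi x : 'D_e psi x = 2 * (phi x * partial i phi x).
  rewrite -[LHS]/(partial i psi x); have /= -> := partialM i sphi sphi.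
  by rewrite -[LHS]/(phi x * partial i phi x + phi x * partial i phi x); ring.
pose G x := `|2 * (phi x * partial i phi x)|.
have tprod : test (fun x => 2 * (phi x * partial i phi x)).
  by apply: testZ; exact: testM tphi (test_smooth tdphi).
have iprod := test_integrable tprod.
have iG : leb.-integrable setT (EFin \o (G : lebspace R N -> R)) := integrable_abse iprod.
have le1 : `|\int[leb]_(x in Omega) 'D_e psi (x + c *: e)| <= \int[leb]_(x in [set: lebspace R N]) G x.
  rewrite -(Rintegral_translate (c *: e)); last exact/measurable_EFinP/(measurable_int _ iG).
  under eq_Rintegral do rewrite dpsi.
  have iGc := integrable_translate (c *: e) iG.
  apply: (@le_trans _ _ (\int[leb]_(x in Omega) G (x + c *: e))).
    apply: (le_normr_Rintegral_bound mO).
    - exact: (integrableS measurableT mO _ (integrable_translate (c *: e) iprod)).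
    - exact: (integrableS measurableT mO _ iGc).
    - by [].
  apply: (le_Rintegral_subset measurableT mO _ _ iGc); first exact: subsetT.
  by move=> x; exact: normr_ge0.
(* Young's inequality [4 a p q <= p^2 / 2 + 8 a^2 q^2]; absorbing the term [p^2 / 2] on the left
   turns 8 into 16. *)
have le2 : \int[leb]_(x in [set: lebspace R N]) (2 * a * G x) <=
    2^-1 * ip leb phi phi + 8 * a ^+ 2 * ip leb (partial i phi) (partial i phi).
  have p2 := test_L2 tphi; have d2 := test_L2 tdphi.
  rewrite /ip -!RintegralZl//; [|exact: L2M..].
  rewrite -RintegralD//; last 2 first.
    + exact: (integrableZl measurableT 2^-1 (L2M p2 p2)).
    + exact: (integrableZl measurableT (8 * a ^+ 2) (L2M d2 d2)).
  apply: le_Rintegral => //.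
    + exact: (integrableZl measurableT (2 * a) iG).
    + apply: integrable_EFinD => //.
      * exact: (integrableZl measurableT 2^-1 (L2M p2 p2)).
      * exact: (integrableZl measurableT (8 * a ^+ 2) (L2M d2 d2)).
  move=> x _; rewrite /G !normrM (ger0_norm (ler0n _ 2)).
  rewrite -!expr2 -(sqr_normr (phi x)) -(sqr_normr (partial i phi x)).
  have := sqr_ge0 (`|phi x| - 4 * a * `|partial i phi x|).
  by set p := `|phi x|; set q := `|partial i phi x|; nra.
have : ip leb phi phi <= 2 * a * \int[leb]_(x in [set: lebspace R N]) G x.
  apply: le_trans (ler_norm _) _; rewrite -normrN ipE normrM mulrC (ger0_norm (_ : 0 <= 2 * a)).
    by apply: ler_wpM2l => //; rewrite mulr_ge0// ltW.
  by rewrite mulr_ge0// ltW.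
move: le2; rewrite RintegralZl//; have := ip_ge0 leb phi.
by set P := ip leb phi phi; set Q := ip leb _ _; set I := Rintegral _ _ _; nra.
Qed.

End poincare.

Section dyadic_cubes.
Variables (R : realType) (N : nat).
Notation V := 'rV[R]_N.
Notation leb := (@leb R N).
Implicit Types (p x v : V) (l : R).

(** Half-open, so that the [2 ^ N] halved cubes form an exact partition. *)
Definition cube p l : set (lebspace R N) :=
  [set x : V | forall i, p ord0 i <= x ord0 i < p ord0 i + l].

Definition subcorner p l (S : {ffun 'I_N -> bool}) : V :=
  p + \row_i ((l / 2) * (S i)%:R).

Lemma cube_measurable p l : measurable (cube p l).
Proof.
rewrite (_ : cube p l = \bigcap_(i in [set: 'I_N])
  ((fun x : lebspace R N => (x : V) ord0 i) @^-1`
    `[(p ord0 i), (p ord0 i + l)[%classic)).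
  apply: fin_bigcap_measurable => // i _; rewrite -[X in measurable X]setTI.
  exact: coord_measurable.
apply/seteqP; split => [x xq i _|x xq i].
  by rewrite /= in_itv/=; exact: xq.
by have := xq i I; rewrite /= in_itv.
Qed.

Lemma cube_bounded p l : bounded_set (cube p l : set V).
Proof.
exists (`|p| + `|l|); split; first exact: num_real.
move=> r rl x xp /=; apply: le_trans (ltW rl); rewrite [leLHS]mx_normrE.
apply: bigmax_le => [|[k i] _ /=]; first by rewrite addr_ge0.
rewrite (ord1 k); have /andP[x1 x2] := xp i; have := ler_coord_norm p i.
by have := ler_norm l; rewrite !ler_norml => ? /andP[? ?]; apply/andP; split; lra.
Qed.

Lemma cube_finite p l : (leb (cube p l) < +oo)%E.
Proof. by apply: lebesgue_outer_bounded; exact: cube_bounded. Qed.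

(** Kept without a formula in [l]: translation invariance and division by [2 ^ N] under halving are
    enough. Positivity is a separate hypothesis where it matters. *)
Definition cube_volume l : R := fine (leb (cube 0 l)).

Lemma cube_volumeE p l : leb (cube p l) = (cube_volume l)%:E.
Proof.
rewrite /cube_volume fineK; last by rewrite ge0_fin_numE ?measure_ge0 ?cube_finite.
rewrite -[RHS](lebesgue_outer_translate (- p)); congr (lebesgue_outer _).
apply/seteqP; split => x h i; have := h i; rewrite !mxE.
  by move=> /andP[? ?]; apply/andP; split; lra.
by move=> /andP[? ?]; apply/andP; split; lra.
Qed.

Lemma cube_volume_ge0 l : 0 <= cube_volume l.
Proof. by rewrite fine_ge0// measure_ge0. Qed.

Lemma Rintegral_cube_translate (F : V -> R) p l v :
  measurable_fun setT (F : lebspace R N -> R) ->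
  \int[leb]_(x in cube p l) F (x + v) = \int[leb]_(x in cube (p + v) l) F x.
Proof.
move=> mF; rewrite [LHS]Rintegral_mkcond [RHS]Rintegral_mkcond.
rewrite -[RHS](Rintegral_translate v); last first.
  exact/(measurable_restrictT _ (cube_measurable _ _))/measurable_funTS.
apply: eq_Rintegral => x _; rewrite /patch; congr (if _ then _ else _).
apply/idP/idP; rewrite !inE => h i; have := h i; rewrite !mxE.
  by move=> /andP[? ?]; apply/andP; split; lra.
by move=> /andP[? ?]; apply/andP; split; lra.
Qed.

Lemma cube_split p l : 0 < l -> cube p l =
  \big[setU/set0]_(S <- enum {ffun 'I_N -> bool}) cube (subcorner p l S) (l / 2).
Proof.
move=> l0; rewrite -bigcup_seq; apply/seteqP; split => [x xp|x [S _] xS].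
  exists [ffun i => p ord0 i + l / 2 <= x ord0 i]; first by rewrite /= mem_enum.
  move=> i; rewrite !mxE ffunE; have /andP[? ?] := xp i.
  by case: (lerP (p ord0 i + l / 2)) => /=; rewrite ?(mulr1, mulr0) => ?; apply/andP; split; lra.
move=> i; have /andP[] := xS i; rewrite !mxE; case: (S i) => /=;
  by rewrite ?(mulr1, mulr0) => ? ?; apply/andP; split; lra.
Qed.

Lemma cube_trivIset p l : 0 < l ->
  trivIset [set` enum {ffun 'I_N -> bool}] (fun S => cube (subcorner p l S) (l / 2)).
Proof.
move=> l0 S T _ _ [x [xS xT]]; apply/ffunP => i.
have /andP[] := xS i; have /andP[] := xT i; rewrite !mxE.
by case: (S i); case: (T i) => //=; rewrite ?(mulr1, mulr0) => *; lra.
Qed.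

Lemma Rintegral_cube_split (F : V -> R) p l : 0 < l ->
  leb.-integrable setT (EFin \o (F : lebspace R N -> R)) ->
  \int[leb]_(x in cube p l) F x =
  \sum_(S : {ffun 'I_N -> bool}) \int[leb]_(x in cube (subcorner p l S) (l / 2)) F x.
Proof.
move=> l0 iF; rewrite {1}/Rintegral (cube_split p l0).
have mF := measurable_int _ iF.
rewrite integral_bigsetU_EFin/=; first last.
- exact: measurable_funTS mF.
- exact: cube_trivIset.
- exact: enum_uniq.
- by move=> S; exact: cube_measurable.
rewrite big_enum /= -sum_fine//.
by move=> S _; apply: integrable_fin_num (integrableS measurableT _ _ iF) => //; exact: cube_measurable.
Qed.

(** The [2 ^ N] subcubes are disjoint and are translates of one another. *)
Lemma cube_volume_half l : 0 < l -> cube_volume l = 2 ^+ N * cube_volume (l / 2).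
Proof.
move=> l0; rewrite {1}/cube_volume (cube_split 0 l0).
have -> : leb (\big[setU/set0]_(S <- enum {ffun 'I_N -> bool}) cube (subcorner 0 l S) (l / 2)) =
    (\sum_(S <- enum {ffun 'I_N -> bool}) leb (cube (subcorner 0 l S) (l / 2)))%E.
  rewrite -bigcup_seq measure_fin_bigcup.
  + by rewrite -fsbig_seq//; exact: enum_uniq.
  + exact: finite_seq.
  + exact: cube_trivIset.
  + by move=> S _; exact: cube_measurable.
under eq_bigr do rewrite cube_volumeE.
rewrite sumEFin/= big_enum/= sumr_const card_ffun card_bool card_ord.
by rewrite -natrX mulr_natl.
Qed.

Lemma cube_volume_dyadic l j : 0 < l ->
  cube_volume (l / 2 ^+ j) = cube_volume l / (2 ^+ N) ^+ j.
Proof.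
move=> l0; elim: j => [|j IH]; first by rewrite !expr0 !divr1.
have lj : 0 < l / 2 ^+ j by rewrite divr_gt0 ?exprn_gt0.
have := cube_volume_half lj; rewrite IH.
have -> : l / 2 ^+ j / 2 = l / 2 ^+ j.+1.
  by rewrite exprSr invfM mulrA.
have N0 : (2 : R) ^+ N != 0 by rewrite expf_neq0.
move=> h; have -> : cube_volume l / 2 ^+ N ^+ j.+1 = cube_volume l / 2 ^+ N ^+ j / 2 ^+ N.
  by rewrite exprSr invfM mulrA.
by rewrite h [2 ^+ N * _]mulrC mulfK.
Qed.

(** The partition is recorded by its effect on integrals, which is the form in which local estimates
    get summed. *)
Lemma dyadic_partition l p j : 0 < l -> exists s : seq V, forall F : V -> R,
  leb.-integrable setT (EFin \o (F : lebspace R N -> R)) ->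
  \int[leb]_(x in cube p l) F x = \sum_(p' <- s) \int[leb]_(x in cube p' (l / 2 ^+ j)) F x.
Proof.
move=> l0; elim: j p => [|j IH] p.
  by exists [:: p] => F iF; rewrite big_seq1 expr0 divr1.
have [s sP] := IH p.
exists [seq subcorner p' (l / 2 ^+ j) b | p' <- s, b <- enum {ffun 'I_N -> bool}] => F iF.
have lj : 0 < l / 2 ^+ j by rewrite divr_gt0 ?exprn_gt0.
rewrite (sP F iF) big_allpairs_dep; apply: eq_bigr => p' _.
rewrite (Rintegral_cube_split _ lj iF) big_enum; apply: eq_bigr => S _.
by rewrite exprSr invfM mulrA.
Qed.

End dyadic_cubes.

Section weighted_dyadic.
Variables (R : realType) (N : nat) (Omega : set 'rV[R]_N).
Notation V := 'rV[R]_N.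
Notation leb := (@leb R N).
Notation test := (test_function Omega).
Implicit Types (phi : V -> R) (p x v : V) (l : R).

Definition grad2 phi x : R := \sum_i (partial i phi x) ^+ 2.

Definition cube_avg phi p l : R :=
  (\int[leb]_(x in cube p l) phi x) / cube_volume N l.

(** Sum over all pairs of [2 a_i a_j <= a_i^2 + a_j^2]. *)
Lemma sqr_sum_le (a : 'I_N -> R) : (\sum_i a i) ^+ 2 <= N%:R * \sum_i a i ^+ 2.
Proof.
have -> : (\sum_i a i) ^+ 2 = \sum_i \sum_j a i * a j.
  by rewrite expr2 mulr_suml; apply: eq_bigr => i _; rewrite mulr_sumr.
have -> : N%:R * \sum_i a i ^+ 2 = \sum_i \sum_j (2^-1 * (a i ^+ 2 + a j ^+ 2)).
  under [RHS]eq_bigr do rewrite -mulr_sumr big_split/= sumr_const card_ord.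
  rewrite -mulr_sumr big_split/= sumr_const card_ord sumrMnl.
  set X := \sum_i a i ^+ 2; by rewrite -(mulr_natl X N); field.
apply: ler_sum => i _; apply: ler_sum => j _.
by have := sqr_ge0 (a i - a j); rewrite sqrrB; lra.
Qed.

Lemma test_grad2_integrable phi : test phi ->
  leb.-integrable setT (EFin \o (grad2 phi : lebspace R N -> R)).
Proof.
move=> tphi; rewrite (_ : EFin \o _ =
    fun x : lebspace R N => (\sum_i (partial i phi x ^+ 2)%:E)%E); last first.
  by apply/funext => x /=; rewrite sumEFin.
apply: integrable_sum => // i _.
exact: (test_L2 (test_partial i tphi)).2.
Qed.

Lemma grad2_ge0 phi x : 0 <= grad2 phi x.
Proof. by apply: sumr_ge0 => i _; exact: sqr_ge0. Qed.

(** The l^1 norm of the gradient, dual to the maximum norm in which the displacements between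
    subcubes are bounded. *)
Definition abs_partial phi x : R := \sum_i `|partial i phi x|.

Lemma abs_partial_ge0 phi x : 0 <= abs_partial phi x.
Proof. exact: sumr_ge0. Qed.

Lemma test_abs_partial_L2 phi : test phi -> L2 leb (abs_partial phi : lebspace R N -> R).
Proof.
by move=> tphi; apply: L2_sum => i; exact/L2_abs/test_L2/(test_partial i tphi). Qed.

Lemma test_abs_partial_integrable phi : test phi ->
  leb.-integrable setT (EFin \o (abs_partial phi : lebspace R N -> R)).
Proof.
move=> tphi; rewrite (_ : EFin \o _ =
    fun x : lebspace R N => (\sum_i (`|partial i phi x|)%:E)%E); last first.
  by apply/funext => x /=; rewrite sumEFin.
apply: (integrable_sum measurableT) => i _.
exact: (integrable_abse (test_integrable (test_partial i tphi))).
Qed.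

Lemma cube_indic_L2 p l : L2 leb (\1_(cube p l) : lebspace R N -> R).
Proof. exact: (indic_L2 (cube_measurable p l) (cube_finite p l)). Qed.

Lemma Rintegral_indic_mul p l (F : V -> R) :
  \int[leb]_(x in cube p l) F x = ip leb (\1_(cube p l)) F.
Proof.
rewrite Rintegral_mkcond; apply: eq_Rintegral => x _.
by rewrite patch_indic/= mulrC.
Qed.

Lemma Rintegral_cube_ge0 p l (F : V -> R) : (forall x, 0 <= F x) ->
  0 <= \int[leb]_(x in cube p l) F x.
Proof. by move=> F0; apply: Rintegral_ge0 => x _; exact: F0. Qed.

(** Cauchy-Schwarz against the indicator of the cube, then [sqr_sum_le] pointwise to pass from the
    l^1 to the l^2 norm of the gradient. *)
Lemma cube_sqr_abs_partial p l phi : test phi ->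
  (\int[leb]_(x in cube p l) abs_partial phi x) ^+ 2 <=
  cube_volume N l * (N%:R * \int[leb]_(x in cube p l) grad2 phi x).
Proof.
move=> tphi; have mc := cube_measurable p l.
have a2 := test_abs_partial_L2 tphi.
pose G := (abs_partial phi) \_ (cube p l).
have -> : \int[leb]_(x in cube p l) abs_partial phi x = ip leb (\1_(cube p l)) G.
  rewrite Rintegral_mkcond; apply: eq_Rintegral => x _.
  by rewrite /G patch_indic/= indicE; case: (x \in _); rewrite ?mulr1 ?mulr0// mul1r.
have G2 : L2 leb (G : lebspace R N -> R) := L2_patch mc a2.
apply: le_trans (cauchy_schwarz (cube_indic_L2 p l) G2) _.
have -> : ip leb (\1_(cube p l)) (\1_(cube p l)) = cube_volume N l.
  rewrite -Rintegral_indic_mul; have /= := Rintegral_cst leb mc 1.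
  rewrite mul1r (_ : fine _ = cube_volume N l); last by rewrite cube_volumeE.
  move=> <-; apply: eq_Rintegral => x xc.
  by rewrite indicE xc.
apply: ler_wpM2l; first exact: cube_volume_ge0.
have ig := test_grad2_integrable tphi.
rewrite -RintegralZl//; last exact: integrableS ig.
rewrite [leRHS]Rintegral_mkcond; apply: le_Rintegral => //.
- exact: L2M.
- rewrite -restrict_EFin; apply: (integrable_mkcond _ mc).1.
  apply: (integrableS measurableT) => //.
  exact: (integrableZl measurableT N%:R ig).
- move=> x _; rewrite /G /patch; case: ifPn => // _; last by rewrite mul0r.
  rewrite -expr2; apply: le_trans (sqr_sum_le _) _; apply: ler_wpM2l => //.
  by apply: ler_sum => i _; rewrite sqr_normr.
Qed.

(** By convexity, the intermediate positions of a subcube sliding onto another one stay in the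
    parent cube; the mean value theorem stops at such a position. *)
Lemma subcube_sub p l S (c : R) v : 0 < l -> 0 <= c <= 1 ->
  (exists S', v = subcorner p l S' - subcorner p l S) ->
  cube (subcorner p l S + c *: v) (l / 2) `<=` cube p l.
Proof.
move=> l0 /andP[c0 c1] [S' ->] x xc i.
have : 0 <= l * c /\ l * c <= l by split; nra.
have /andP[] := xc i; rewrite !mxE.
by case: (S i); case: (S' i); rewrite /= ?(mulr1, mulr0) => ? ? [? ?]; apply/andP; split; nra.
Qed.

Lemma subcorner_diff_le p l S S' i : 0 < l ->
  `|(subcorner p l S' - subcorner p l S) ord0 i| <= l / 2.
Proof.
move=> l0; rewrite !mxE; case: (S i); case: (S' i); rewrite /= ?(mulr1, mulr0) ler_norml;
  by apply/andP; split; lra.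
Qed.

(** One subcube slides onto the other along [v], whose coordinates are at most [l / 2]. The
    derivative of the integral during the motion is bounded by [l / 2] times the integral of
    [abs_partial] over an intermediate position. *)
Lemma subcube_integral_diff p l S S' phi : 0 < l -> test phi ->
  `|\int[leb]_(x in cube (subcorner p l S') (l / 2)) phi x -
    \int[leb]_(x in cube (subcorner p l S) (l / 2)) phi x| <=
  l / 2 * \int[leb]_(x in cube p l) abs_partial phi x.
Proof.
move=> l0 tphi; set A := cube (subcorner p l S) (l / 2).
pose v := subcorner p l S' - subcorner p l S.
have mA : measurable A := cube_measurable _ _.
pose F (t : R) := \int[leb]_(x in A) phi (x + t *: v).
have dF (t : R) : is_derive t 1 F (\int[leb]_(x in A) 'D_v phi (x + t *: v)).
  by apply: (shift_integral_derive _ _ tphi mA); exact: (cube_finite (subcorner p l S) (l / 2)).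
have F0 : F 0 = \int[leb]_(x in A) phi x.
  by apply: eq_Rintegral => x _; rewrite scale0r addr0.
have F1 : F 1 = \int[leb]_(x in cube (subcorner p l S') (l / 2)) phi x.
  rewrite /F /A; under eq_Rintegral do rewrite scale1r.
  rewrite (Rintegral_cube_translate _ _ _ (test_measurable tphi)).
  have -> // : subcorner p l S + v = subcorner p l S' by rewrite addrC subrK.
have [||c c01] := @MVT R F (fun t => \int[leb]_(x in A) 'D_v phi (x + t *: v)) 0 1.
- exact: ltr01.
- by apply: derivable_within_continuous => t _; have [] := dF t.
rewrite F0 F1 subr0 mulr1 => ->.
have cle : 0 <= c <= 1 by move: c01; rewrite in_itv/= => /andP[? ?]; rewrite !ltW.
have a2 := test_abs_partial_L2 tphi.
have vle i : `|v ord0 i| <= l / 2 by exact: subcorner_diff_le.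
have Dle x : `|'D_v phi x| <= l / 2 * abs_partial phi x.
  rewrite derive_partial; last exact: (test_smooth tphi).
  rewrite /abs_partial mulr_sumr; apply: le_trans (ler_norm_sum _ _ _) _.
  by apply: ler_sum => i _; rewrite normrM ler_wpM2r.
have iabs := test_abs_partial_integrable tphi.
have iabsc := integrable_translate (c *: v) iabs.
have iDvc := integrable_translate (c *: v) (test_integrable (test_derive v tphi)).
apply: (@le_trans _ _ (\int[leb]_(x in A) (l / 2 * abs_partial phi (x + c *: v)))).
  apply: (le_normr_Rintegral_bound mA).
  - exact: (integrableS measurableT mA _ iDvc).
  - exact: (integrable_EFinZ mA (l / 2) (integrableS measurableT mA _ iabsc)).
  - by move=> x; exact: Dle.
rewrite (RintegralZl _ mA (integrableS measurableT mA (@subsetT _ _) iabsc)).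
apply: ler_wpM2l; first by rewrite divr_ge0// ltW.
rewrite (Rintegral_cube_translate _ _ _ (L2_measurable a2)).
apply: (le_Rintegral_subset (cube_measurable _ _) (cube_measurable _ _) _ _ iabs).
- by apply: subcube_sub => //; exists S'.
- exact: abs_partial_ge0.
Qed.

Lemma sum_cst_corners (a : R) : \sum_(S : {ffun 'I_N -> bool}) a = 2 ^+ N * a.
Proof. by rewrite sumr_const card_ffun card_bool card_ord -[LHS]mulr_natl natrX. Qed.

Lemma cube_avg_split p l phi : 0 < l -> 0 < cube_volume N l -> test phi ->
  cube_avg phi p l = (2 ^+ N)^-1 * \sum_(S : {ffun 'I_N -> bool})
    cube_avg phi (subcorner p l S) (l / 2).
Proof.
move=> l0 v0 tphi; rewrite /cube_avg (Rintegral_cube_split _ l0 (test_integrable tphi)).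
rewrite mulr_suml mulr_sumr; apply: eq_bigr => S _.
move: v0; rewrite (cube_volume_half N l0); set m := cube_volume N (l / 2) => m0.
have mn0 : m != 0 by apply: contraTneq m0 => ->; rewrite mulr0 ltxx.
by rewrite invfM mulrCA.
Qed.

(** The average over the parent is the mean of the averages over the subcubes, so the difference is
    a mean of differences between subcubes. The factor [4 ^+ N] is the squared ratio of the two
    volumes. *)
Lemma subcube_avg_diff p l S phi : 0 < l -> 0 < cube_volume N l -> test phi ->
  (cube_avg phi (subcorner p l S) (l / 2) - cube_avg phi p l) ^+ 2 <=
  N%:R * 4 ^+ N * l ^+ 2 / cube_volume N l * \int[leb]_(x in cube p l) grad2 phi x.
Proof.
move=> l0 v0 tphi; have v2 := cube_volume_half N l0.
set m := cube_volume N (l / 2) in v2 *; set I := \int[leb]_(x in cube p l) abs_partial phi x.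
have p0 : 0 < (2 : R) ^+ N by rewrite exprn_gt0.
have m0 : 0 < m by move: v0; rewrite v2 pmulr_rgt0.
have I0 : 0 <= I by apply: Rintegral_cube_ge0; exact: abs_partial_ge0.
have diff S' : `|cube_avg phi (subcorner p l S) (l / 2) - cube_avg phi (subcorner p l S') (l / 2)|
    <= l / 2 / m * I.
  rewrite /cube_avg -/m -mulrBl normrM (gtr0_norm (_ : 0 < m^-1)) ?invr_gt0//.
  rewrite mulrAC ler_pM2r ?invr_gt0//; exact: subcube_integral_diff.
have avg_diff : `|cube_avg phi (subcorner p l S) (l / 2) - cube_avg phi p l| <= l / 2 / m * I.
  rewrite (cube_avg_split p l0 v0 tphi).
  have -> : cube_avg phi (subcorner p l S) (l / 2) =
    (2 ^+ N)^-1 * \sum_(S' : {ffun 'I_N -> bool}) cube_avg phi (subcorner p l S) (l / 2).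
    by rewrite sum_cst_corners mulKf// gt_eqF.
  rewrite -mulrBr -sumrB normrM gtr0_norm ?invr_gt0//.
  rewrite ler_pdivrMl//; apply: le_trans (ler_norm_sum _ _ _) _.
  apply: (@le_trans _ _ (\sum_(S' : {ffun 'I_N -> bool}) (l / 2 / m * I))).
    by apply: ler_sum => S' _; exact: diff.
  by rewrite sum_cst_corners.
rewrite -sqr_normr; apply: (@le_trans _ _ ((l / 2 / m * I) ^+ 2)).
  by rewrite ler_sqr ?nnegrE// mulr_ge0// divr_ge0 ?divr_ge0// ltW.
have Isq := cube_sqr_abs_partial p l tphi; rewrite -/I in Isq.
rewrite exprMn; set J := \int[leb]_(x in cube p l) grad2 phi x in Isq *.
have J0 : 0 <= J by apply: Rintegral_cube_ge0; exact: grad2_ge0.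
apply: (@le_trans _ _ ((l / 2 / m) ^+ 2 * (cube_volume N l * (N%:R * J)))).
  by rewrite ler_wpM2l ?sqr_ge0.
have -> : (4 : R) ^+ N = (2 ^+ N) ^+ 2 by rewrite -exprM mulnC exprM; congr (_ ^+ N); ring.
rewrite v2; set P := 2 ^+ N in p0 *.
have -> : (l / 2 / m) ^+ 2 * (P * m * (N%:R * J)) = (l ^+ 2 * P / m * N%:R * J) / 4.
  by field; rewrite gt_eqF.
have -> : N%:R * P ^+ 2 * l ^+ 2 / (P * m) * J = l ^+ 2 * P / m * N%:R * J.
  by field; rewrite !gt_eqF.
(* The factor 1/4 that comes from [(l / 2)^2] is dropped. *)
rewrite ler_pdivrMr// ler_peMr//; last by rewrite ler1n.
by rewrite !mulr_ge0 ?invr_ge0 ?sqr_ge0// ltW.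
Qed.

Lemma sqrD_le_weighted (e a b : R) : 0 < e ->
  (a + b) ^+ 2 <= (1 + e) * a ^+ 2 + (1 + e^-1) * b ^+ 2.
Proof.
move=> e0; have : 0 <= (e * a - b) ^+ 2 / e by rewrite divr_ge0 ?sqr_ge0// ltW.
have -> : (e * a - b) ^+ 2 / e = (1 + e) * a ^+ 2 + (1 + e^-1) * b ^+ 2 - (a + b) ^+ 2.
  by field; rewrite gt_eqF.
by rewrite subr_ge0.
Qed.

Variable wf : V -> R.
Hypothesis wf_ge0 : forall x, 0 <= wf x.
Hypothesis wf_int : leb.-integrable setT (EFin \o (wf : lebspace R N -> R)).
Variables (l0 K th : R).
Hypothesis l0_gt0 : 0 < l0.
Hypothesis v0_gt0 : 0 < cube_volume N l0.
Hypothesis K_ge0 : 0 <= K.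
Hypothesis th_bounds : 2^-1 <= th < 1.
(* Hoelder's inequality gives this decay when [wf] is in L^q with q > N/2. *)
Hypothesis wf_cube : forall j p, \int[leb]_(x in cube p (l0 / 2 ^+ j)) wf x <=
  K * (4 * th) ^+ j / (2 ^+ N) ^+ j.

Lemma wf_sqr_integrable phi (k : R) : test phi ->
  leb.-integrable setT (EFin \o ((fun x => wf x * (phi x - k) ^+ 2) : lebspace R N -> R)).
Proof.
move=> tphi; have [M M0 HM] := test_bounded tphi.
apply: (integrable_bounded_mul (c := (M + `|k|) ^+ 2) measurableT wf_int).
  apply: measurable_funX; apply: measurable_funB; last exact: measurable_cst.
  exact: (test_measurable tphi).
move=> x; rewrite normrX ler_sqr ?nnegrE ?addr_ge0// ?(ltW M0)//.
by rewrite (le_trans (ler_normB _ _))// lerD2r.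
Qed.

Let l_ j : R := l0 / 2 ^+ j.

Let l_gt0 j : 0 < l_ j.
Proof. by rewrite divr_gt0 ?exprn_gt0. Qed.

Let l_half j : l_ j / 2 = l_ j.+1.
Proof. by rewrite /l_ exprSr invfM mulrA. Qed.

Let v_gt0 j : 0 < cube_volume N (l_ j).
Proof. by rewrite /l_ cube_volume_dyadic// divr_gt0 ?exprn_gt0. Qed.

Let A0 : R := N%:R * 4 ^+ N * l0 ^+ 2 / cube_volume N l0 * K.

Let A0_ge0 : 0 <= A0.
Proof. by rewrite /A0 mulr_ge0// divr_ge0 ?mulr_ge0 ?sqr_ge0 ?exprn_ge0 ?ler0n// ltW. Qed.

(** The scales balance: [l_ j ^+ 2] brings [4^-j], the inverse volume brings [2^(N j)], the mass of
    [wf] brings [(4 th)^j 2^(- N j)], and only [th^j] is left. *)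
Let cst_D_W j p : N%:R * 4 ^+ N * l_ j ^+ 2 / cube_volume N (l_ j) *
  \int[leb]_(x in cube p (l_ j)) wf x <= A0 * th ^+ j.
Proof.
have th0 : 0 < th by have /andP[? _] := th_bounds; lra.
apply: (@le_trans _ _ (N%:R * 4 ^+ N * l_ j ^+ 2 / cube_volume N (l_ j) *
    (K * (4 * th) ^+ j / (2 ^+ N) ^+ j))).
  apply: ler_wpM2l; last exact: wf_cube.
  by rewrite divr_ge0 ?mulr_ge0 ?sqr_ge0 ?exprn_ge0 ?ler0n// ltW.
rewrite le_eqVlt; apply/orP; left; apply/eqP.
rewrite /l_ cube_volume_dyadic// /A0 [(4 * th) ^+ j]exprMn (_ : (4 : R) ^+ j = (2 ^+ j) ^+ 2); last first.
  by rewrite -exprM mulnC exprM; congr (_ ^+ j); ring.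
set P := 2 ^+ j; set Q := (2 ^+ N) ^+ j; set v := cube_volume N l0.
have P0 : P != 0 by rewrite expf_neq0.
have Q0 : Q != 0 by rewrite !expf_neq0.
by field; rewrite P0 Q0 gt_eqF.
Qed.

(** The fixed point of the induction: the [C] with [C = (1 + th) / 2 * C + (1 + th) / (1 - th) *
    A0]. *)
Definition dyadic_const : R :=
  (1 + th) / (1 - th) * A0 * (2 / (1 - th)).

Lemma dyadic_const_ge0 : 0 <= dyadic_const.
Proof.
have /andP[th1 th2] := th_bounds; rewrite /dyadic_const.
apply: mulr_ge0; last by apply: divr_ge0; lra.
by apply: mulr_ge0 => //; apply: divr_ge0; lra.
Qed.

(* Induction on [n], from small cubes to larger ones: on cubes of side [l_ (j + n)] the
   oscillation is bounded by Lipschitz continuity, and that error disappears as n grows. *)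
Lemma dyadic_oscillation_step phi (L : R) : test phi -> 0 <= L ->
  (forall x y, `|phi x - phi y| <= L * \sum_i `|x ord0 i - y ord0 i|) ->
  forall n j p,
  \int[leb]_(x in cube p (l_ j)) (wf x * (phi x - cube_avg phi p (l_ j)) ^+ 2) <=
  dyadic_const * th ^+ j * \int[leb]_(x in cube p (l_ j)) grad2 phi x +
  (3 / 2) ^+ n * (L * N%:R * l_ j / 2 ^+ n) ^+ 2 * \int[leb]_(x in cube p (l_ j)) wf x.
Proof.
move=> tphi L0 lip; have /andP[th1 th2] := th_bounds.
have th0 : 0 < th by lra.
have c0 := dyadic_const_ge0.
have ig := test_grad2_integrable tphi.
elim=> [|n IH] j p.
  have G0 : 0 <= \int[leb]_(x in cube p (l_ j)) grad2 phi x.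
    by apply: Rintegral_cube_ge0; exact: grad2_ge0.
  have mc := cube_measurable p (l_ j).
  have iwc := integrableS measurableT mc (@subsetT _ _) wf_int.
  rewrite !expr0 mul1r divr1; apply: (@le_trans _ _ ((L * N%:R * l_ j) ^+ 2 *
    \int[leb]_(x in cube p (l_ j)) wf x)); last first.
    by rewrite lerDr; apply: mulr_ge0 => //; apply: mulr_ge0 => //; apply: exprn_ge0; exact: ltW.
  rewrite -(RintegralZl _ mc iwc); apply: (le_Rintegral mc).
  - exact: (integrableS measurableT mc (@subsetT _ _) (wf_sqr_integrable _ tphi)).
  - exact: (integrable_EFinZ mc _ iwc).
  move=> x xc; rewrite mulrC; apply: ler_wpM2r => //.
  have iphi := integrableS measurableT mc (@subsetT _ _) (test_integrable tphi).
  have v0 := v_gt0 j.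
  have volE : fine (leb (cube p (l_ j))) = cube_volume N (l_ j) by rewrite cube_volumeE.
  have avgE : phi x - cube_avg phi p (l_ j) =
      (\int[leb]_(y in cube p (l_ j)) (phi x - phi y)) / cube_volume N (l_ j).
    have icst : leb.-integrable (cube p (l_ j)) (EFin \o (cst (phi x) : lebspace R N -> R)).
      by apply: (bounded_integrable (c := `|phi x|) mc) => //; exact: cube_finite.
    rewrite (RintegralB mc icst iphi) (Rintegral_cst leb mc) mulrBl.
    by rewrite volE mulfK ?gt_eqF.
  rewrite -sqr_normr ler_sqr ?nnegrE//; last by rewrite !mulr_ge0// ltW.
  rewrite avgE normrM (gtr0_norm (_ : 0 < _^-1)) ?invr_gt0// ler_pdivrMr//.
  have icst : leb.-integrable (cube p (l_ j)) (EFin \o (cst (L * N%:R * l_ j) : lebspace R N -> R)).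
    apply: (bounded_integrable (c := `|L * N%:R * l_ j|) mc) => //; exact: cube_finite.
  have -> : L * N%:R * l_ j * cube_volume N (l_ j) =
      \int[leb]_(y in cube p (l_ j)) (cst (L * N%:R * l_ j) y).
    by rewrite (Rintegral_cst leb mc) volE.
  have idiff : leb.-integrable (cube p (l_ j)) (EFin \o ((fun y => phi x - phi y) : lebspace R N -> R)).
    have [M _ HM] := test_bounded tphi.
    apply: (bounded_integrable (c := `|phi x| + M) mc).
    - exact: cube_finite.
    - by apply: measurable_funB; [exact: measurable_cst | exact: (test_measurable tphi)].
    - by move=> y; rewrite (le_trans (ler_normB _ _))// lerD2l.
  apply: le_trans (le_normr_Rintegral mc idiff) _.
  apply: (le_Rintegral mc (integrable_abse idiff) icst) => y yc /=.
  apply: le_trans (lip x y) _; rewrite -mulrA ler_wpM2l//.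
  apply: (@le_trans _ _ (\sum_(i < N) l_ j)); last by rewrite sumr_const card_ord mulr_natl.
  apply: ler_sum => i _; have /andP[? ?] := xc i; have /andP[? ?] := yc i.
  by rewrite ler_norml; apply/andP; split; lra.
(* With this Young weight [(1 + e) * th] is the midpoint [(1 + th) / 2] of [th] and 1, still below
   1, while [th >= 1/2] gives [1 + e <= 3/2], the growth allowed to the error term. *)
pose e := (1 - th) / (2 * th).
have e0 : 0 < e by rewrite divr_gt0 ?mulr_gt0//; lra.
have rth : (1 + e) * th = (1 + th) / 2 by rewrite /e; field; rewrite gt_eqF.
have r_le : 1 + e <= 3 / 2.
  by rewrite -lerBrDl /e ler_pdivrMr ?mulr_gt0//; lra.
have sE : 1 + e^-1 = (1 + th) / (1 - th).
  have th1' : 1 - th != 0 by rewrite gt_eqF// subr_gt0.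
  by rewrite /e invf_div; apply: (mulIf th1'); rewrite mulrDl !divfK//; ring.
set Q := cube p (l_ j); set aQ := cube_avg phi p (l_ j).
set G := \int[leb]_(x in Q) grad2 phi x; set W := \int[leb]_(x in Q) wf x.
have G0 : 0 <= G by apply: Rintegral_cube_ge0; exact: grad2_ge0.
have W0 : 0 <= W by exact: Rintegral_cube_ge0.
pose D := N%:R * 4 ^+ N * l_ j ^+ 2 / cube_volume N (l_ j).
pose err := (3 / 2) ^+ n * (L * N%:R * l_ j.+1 / 2 ^+ n) ^+ 2.
have err0 : 0 <= err by rewrite mulr_ge0 ?sqr_ge0// exprn_ge0//; lra.
pose GS S := \int[leb]_(x in cube (subcorner p (l_ j) S) (l_ j.+1)) grad2 phi x.
pose WS S := \int[leb]_(x in cube (subcorner p (l_ j) S) (l_ j.+1)) wf x.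
have GE : \sum_(S : {ffun 'I_N -> bool}) GS S = G.
  by rewrite /G /Q (Rintegral_cube_split _ (l_gt0 j) ig); apply: eq_bigr => S _; rewrite l_half.
have WE : \sum_(S : {ffun 'I_N -> bool}) WS S = W.
  by rewrite /W /Q (Rintegral_cube_split _ (l_gt0 j) wf_int); apply: eq_bigr => S _; rewrite l_half.
have DW : D * W <= A0 * th ^+ j by exact: cst_D_W.
(* On a subcube, [phi - aQ] is split as [(phi - aS) + (aS - aQ)]: the induction hypothesis at level
   [j.+1] bounds the first part and [subcube_avg_diff] the second. *)
have stepS S : \int[leb]_(x in cube (subcorner p (l_ j) S) (l_ j.+1)) (wf x * (phi x - aQ) ^+ 2) <=
    (1 + e) * (dyadic_const * th ^+ j.+1 * GS S + err * WS S) +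
    (1 + e^-1) * (D * G * WS S).
  set aS := cube_avg phi (subcorner p (l_ j) S) (l_ j.+1).
  have mc := cube_measurable (subcorner p (l_ j) S) (l_ j.+1).
  have i1 := integrableS measurableT mc (@subsetT _ _) (wf_sqr_integrable aS tphi).
  have i2 := integrableS measurableT mc (@subsetT _ _) wf_int.
  apply: (@le_trans _ _ (\int[leb]_(x in cube (subcorner p (l_ j) S) (l_ j.+1))
    ((1 + e) * (wf x * (phi x - aS) ^+ 2) + (1 + e^-1) * (aS - aQ) ^+ 2 * wf x))).
    apply: (le_Rintegral mc).
    - exact: (integrableS measurableT mc (@subsetT _ _) (wf_sqr_integrable aQ tphi)).
    - apply: (integrable_EFinD mc); exact: (integrable_EFinZ mc).
    - move=> x _; have -> : phi x - aQ = (phi x - aS) + (aS - aQ) by ring.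
      have := ler_wpM2l (wf_ge0 x) (sqrD_le_weighted (phi x - aS) (aS - aQ) e0).
      by rewrite mulrDr; set X := _ ^+ 2; set Y := _ ^+ 2; lra.
  rewrite (RintegralD mc (integrable_EFinZ mc _ i1) (integrable_EFinZ mc _ i2)).
  rewrite (RintegralZl _ mc i1) (RintegralZl _ mc i2) -/(WS S).
  apply: lerD.
    by apply: ler_wpM2l; [lra | exact: IH].
  rewrite -[leLHS]mulrA; apply: ler_wpM2l; first by rewrite addr_ge0// invr_ge0 ltW.
  apply: ler_wpM2r; first exact: Rintegral_cube_ge0.
  by rewrite /aS -l_half; exact: subcube_avg_diff.
rewrite (Rintegral_cube_split _ (l_gt0 j) (wf_sqr_integrable aQ tphi)).
apply: (@le_trans _ _ (\sum_(S : {ffun 'I_N -> bool})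
    ((1 + e) * (dyadic_const * th ^+ j.+1 * GS S + err * WS S) +
    (1 + e^-1) * (D * G * WS S)))).
  by apply: ler_sum => S _; rewrite l_half; exact: stepS.
rewrite big_split/= -!mulr_sumr big_split/= -!mulr_sumr GE WE.
(* Since [l_ j / 2^(n+1) = l_ j.+1 / 2^n], the two error terms differ only by a factor 3/2. *)
have errE : (3 / 2) ^+ n.+1 * (L * N%:R * l_ j / 2 ^+ n.+1) ^+ 2 = 3 / 2 * err.
  rewrite /err -l_half exprS [2 ^+ n.+1]exprS; set P := 2 ^+ n.
  have P0 : P != 0 by rewrite expf_neq0.
  by field.
rewrite errE mulrDr -addrA addrCA -[leRHS]addrC; apply: lerD.
  by rewrite -[leRHS]mulrA; apply: ler_wpM2r; [exact: mulr_ge0 | exact: r_le].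
have -> : (1 + e) * (dyadic_const * th ^+ j.+1 * G) = (1 + th) / 2 * dyadic_const * th ^+ j * G.
  by rewrite exprS -rth; ring.
have -> : D * G * W = D * W * G by ring.
have : (1 + e^-1) * (D * W * G) <= (1 + e^-1) * (A0 * th ^+ j * G).
  by apply: ler_wpM2l; [rewrite addr_ge0// invr_ge0 ltW | exact: ler_wpM2r].
have -> : (1 + e^-1) * (A0 * th ^+ j * G) = (1 - th) / 2 * dyadic_const * th ^+ j * G.
  by rewrite sE /dyadic_const; field; rewrite gt_eqF//; lra.
set X := _ * (D * W * G) => hX.
suff -> : dyadic_const * th ^+ j * G = (1 + th) / 2 * dyadic_const * th ^+ j * G +
  (1 - th) / 2 * dyadic_const * th ^+ j * G by rewrite lerD2l.
by field.
Qed.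

(** The limit [n -> oo] of the previous estimate: each level multiplies the error by 3/2 for the
    weights and by 1/4 for the squared side, so it decays like [(3/8)^n]. *)
Lemma dyadic_oscillation phi j p : test phi ->
  \int[leb]_(x in cube p (l_ j)) (wf x * (phi x - cube_avg phi p (l_ j)) ^+ 2) <=
  dyadic_const * th ^+ j * \int[leb]_(x in cube p (l_ j)) grad2 phi x.
Proof.
move=> tphi; have [L L0 lip] := test_lipschitz tphi.
have step n := dyadic_oscillation_step tphi (ltW L0) lip n j p.
rewrite leNgt; apply/negP => lt.
set X := Rintegral _ _ _ in step lt; set Y := dyadic_const * _ * _ in step lt.
set W := \int[leb]_(x in cube p (l_ j)) wf x in step.
pose B := (L * N%:R * l_ j) ^+ 2 * W.
have cvg : geometric B (3 / 8) n @[n --> \oo] --> (0 : R).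
  by apply: cvg_geometric; rewrite ger0_norm; lra.
have d0 : 0 < X - Y by rewrite subr_gt0.
move/cvgrPdist_lt : cvg => /(_ _ d0)[n _ /(_ n (leqnn n))].
rewrite sub0r normrN => /(le_lt_trans (ler_norm _)) h.
have := step n.
have -> : (3 / 2) ^+ n * (L * N%:R * l_ j / 2 ^+ n) ^+ 2 * W = geometric B (3 / 8) n.
  rewrite /geometric/= /B !expr_div_n (_ : (8 : R) ^+ n = (2 ^+ n) ^+ 3); last first.
    by rewrite -exprM mulnC exprM; congr (_ ^+ n); ring.
  set P := 2 ^+ n; have P0 : P != 0 by rewrite expf_neq0.
  by field.
lra.
Qed.

(** At a level [j] with [2 * dyadic_const * th ^+ j <= eta], write [phi^2 <= 2 (phi - a)^2 + 2 a^2]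
    on each cell, [a] being the average there. The oscillations cost at most [eta] times the energy,
    and the averages are finitely many linear functionals. *)
Lemma compact_estimate (p0 : V) (eta : R) : Omega `<=` cube p0 l0 -> 0 < eta ->
  exists (C : R) (s : seq (V * R)), 0 <= C /\ forall phi, test phi ->
    \int[leb]_(x in [set: lebspace R N]) (wf x * phi x ^+ 2) <=
    eta * \int[leb]_(x in [set: lebspace R N]) grad2 phi x +
    C * \sum_(q <- s) (ip leb (\1_(cube q.1 q.2)) phi) ^+ 2.
Proof.
move=> OQ eta0; have /andP[th1 th2] := th_bounds.
have [j jP] : exists j, 2 * dyadic_const * th ^+ j <= eta.
  have cvg : geometric (2 * dyadic_const) th n @[n --> \oo] --> (0 : R).
    by apply: cvg_geometric; rewrite ger0_norm; lra.
  move/cvgrPdist_le : cvg => /(_ _ eta0)[j _ /(_ j (leqnn j))].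
  by rewrite sub0r normrN => /(le_trans (ler_norm _)) h; exists j.
have [s sP] := dyadic_partition p0 j l0_gt0.
pose Wt := \int[leb]_(x in [set: lebspace R N]) wf x.
have Wt0 : 0 <= Wt by apply: Rintegral_ge0 => x _; exact: wf_ge0.
(* The average is the scalar product with the indicator divided by the volume, and the mass of [wf]
   on a cell is at most the total mass [Wt]. *)
exists (2 * Wt / cube_volume N (l_ j) ^+ 2), [seq (p, l_ j) | p <- s]; split.
  by rewrite divr_ge0 ?sqr_ge0// mulr_ge0.
move=> phi tphi; have ig := test_grad2_integrable tphi.
have iw : leb.-integrable setT (EFin \o ((fun x => wf x * phi x ^+ 2) : lebspace R N -> R)).
  by have := wf_sqr_integrable 0 tphi; under eq_fun do rewrite subr0.
have -> : \int[leb]_(x in [set: lebspace R N]) (wf x * phi x ^+ 2) =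
    \int[leb]_(x in cube p0 l0) (wf x * phi x ^+ 2).
  rewrite [RHS]Rintegral_mkcond; apply: eq_Rintegral => x _.
  rewrite /patch; case: ifPn => // /negP xQ.
  by rewrite (test_out tphi) ?expr0n ?mulr0// => /OQ xQ'; apply: xQ; rewrite inE.
rewrite (sP _ iw) big_map/=.
have cellP p : \int[leb]_(x in cube p (l_ j)) (wf x * phi x ^+ 2) <=
    2 * (dyadic_const * th ^+ j * \int[leb]_(x in cube p (l_ j)) grad2 phi x) +
    2 * Wt / cube_volume N (l_ j) ^+ 2 * (ip leb (\1_(cube p (l_ j))) phi) ^+ 2.
  set a := cube_avg phi p (l_ j).
  have mc := cube_measurable p (l_ j).
  have i1 := integrableS measurableT mc (@subsetT _ _) (wf_sqr_integrable a tphi).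
  have i2 := integrableS measurableT mc (@subsetT _ _) wf_int.
  apply: (@le_trans _ _ (\int[leb]_(x in cube p (l_ j))
    (2 * (wf x * (phi x - a) ^+ 2) + 2 * a ^+ 2 * wf x))).
    apply: (le_Rintegral mc).
    - exact: (integrableS measurableT mc (@subsetT _ _) iw).
    - apply: (integrable_EFinD mc); exact: (integrable_EFinZ mc).
    - move=> x _; have := ler_wpM2l (wf_ge0 x) (sqrD_le_weighted (phi x - a) a (@ltr01 R)).
      by rewrite subrK invr1 mulrDr; set X := _ ^+ 2; set Y := _ ^+ 2; lra.
  rewrite (RintegralD mc (integrable_EFinZ mc _ i1) (integrable_EFinZ mc _ i2)).
  rewrite (RintegralZl _ mc i1) (RintegralZl _ mc i2); apply: lerD.
    by apply: ler_wpM2l => //; exact: dyadic_oscillation.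
  have -> : a = ip leb (\1_(cube p (l_ j))) phi / cube_volume N (l_ j).
    by rewrite /a /cube_avg Rintegral_indic_mul.
  rewrite expr_div_n; set X := _ ^+ 2; set Y := _ ^+ 2.
  have -> : 2 * (X / Y) * \int[leb]_(x in cube p (l_ j)) wf x =
    2 * (X / Y) * \int[leb]_(x in cube p (l_ j)) wf x by [].
  have -> : 2 * Wt / Y * X = 2 * (X / Y) * Wt by ring.
  apply: ler_wpM2l; first by rewrite mulr_ge0 ?divr_ge0 ?sqr_ge0.
  by apply: (le_Rintegral_subset measurableT mc _ wf_ge0 wf_int).
apply: (@le_trans _ _ (\sum_(p <- s)
    (2 * (dyadic_const * th ^+ j * \int[leb]_(x in cube p (l_ j)) grad2 phi x) +
    2 * Wt / cube_volume N (l_ j) ^+ 2 * (ip leb (\1_(cube p (l_ j))) phi) ^+ 2))).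
  by apply: ler_sum => p _; exact: cellP.
rewrite big_split/= -!mulr_sumr -(sP _ ig); apply: lerD => //.
rewrite mulrA; apply: ler_pM.
- rewrite mulr_ge0// mulr_ge0 ?dyadic_const_ge0// exprn_ge0//; lra.
- by apply: Rintegral_cube_ge0; exact: grad2_ge0.
- by rewrite mulrA.
- by apply: (le_Rintegral_subset measurableT (cube_measurable _ _) _ (grad2_ge0 phi) ig).
Qed.

End weighted_dyadic.

(** * Convergence in L^2 and the space H^1_0 *)

Lemma squeeze_cvg0 (R : realType) (a b : nat -> R) : (forall n, 0 <= a n) ->
  (forall n, a n <= b n) -> b n @[n --> \oo] --> 0 -> a n @[n --> \oo] --> 0.
Proof.
move=> a0 ab b0; apply: (squeeze_cvgr (f := fun=> 0) (h := b)) => //; last exact: cvg_cst.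
by apply: nearW => n; rewrite a0 ab.
Qed.

Lemma cvg_ext (R : realType) (u v : nat -> R) (l : R) : (forall n, u n = v n) ->
  u n @[n --> \oo] --> l -> v n @[n --> \oo] --> l.
Proof. by move=> /funext ->. Qed.

Section L2_convergence.
Context d (T : measurableType d) (R : realType) (mu : {measure set T -> \bar R}).
Implicit Types F G H : T -> R.

Definition sqnorm F : R := ip mu F F.

Definition L2cvg (F_ : nat -> T -> R) F := sqnorm (fun x => F_ n x - F x) @[n --> \oo] --> 0.

Lemma L2cvg_ipl (F_ : nat -> T -> R) F H : (forall n, L2 mu (F_ n)) -> L2 mu F -> L2 mu H ->
  L2cvg F_ F -> ip mu (F_ n) H @[n --> \oo] --> ip mu F H.
Proof.
move=> F2_ F2 H2 F0; have := ip_cvg0 (fun n => L2B (F2_ n) F2) (fun=> H2) (fun=> lexx _) F0.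
under eq_fun do rewrite ipBl//.
move=> h; apply: (cvg_ext (u := fun n => ip mu (F_ n) H - ip mu F H + ip mu F H)).
  by move=> n; rewrite subrK.
rewrite -[X in _ --> X]add0r; apply: cvgD => //; exact: cvg_cst.
Qed.

Lemma sqnormD_cvg0 (F_ G_ : nat -> T -> R) : (forall n, L2 mu (F_ n)) ->
  (forall n, L2 mu (G_ n)) -> sqnorm (F_ n) @[n --> \oo] --> 0 ->
  sqnorm (G_ n) @[n --> \oo] --> 0 ->
  sqnorm (fun x => F_ n x + G_ n x) @[n --> \oo] --> 0.
Proof.
move=> F2 G2 F0 G0.
apply: (squeeze_cvg0 (b := fun n => 2 * sqnorm (F_ n) + 2 * sqnorm (G_ n))).
- by move=> n; exact: ip_ge0.
- by move=> n; exact: ip_sqrD_le.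
- rewrite (_ : (0 : R) = 2 * 0 + 2 * 0); last by rewrite mulr0 addr0.
  by apply: cvgD; (apply: cvgM; [exact: cvg_cst|]).
Qed.

Lemma sqnormZ_cvg0 (F_ : nat -> T -> R) (t : R) : (forall n, L2 mu (F_ n)) ->
  sqnorm (F_ n) @[n --> \oo] --> 0 ->
  sqnorm (fun x => t * F_ n x) @[n --> \oo] --> 0.
Proof.
move=> F2 F0; rewrite (_ : (fun n => _) = (fun n => t ^+ 2 * sqnorm (F_ n))); last first.
  by apply/funext => n; rewrite /sqnorm ip_sqrZ.
by rewrite -(mulr0 (t ^+ 2)); apply: cvgM => //; exact: cvg_cst.
Qed.

Lemma L2cvg_comb (F_ G_ : nat -> T -> R) F G (t : R) : (forall n, L2 mu (F_ n)) -> (forall n, L2 mu (G_ n)) ->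
  L2 mu F -> L2 mu G -> L2cvg F_ F -> L2cvg G_ G ->
  L2cvg (fun n x => F_ n x + t * G_ n x) (fun x => F x + t * G x).
Proof.
move=> F_2 G_2 F2 G2 cF cG.
have := sqnormD_cvg0 (fun n => L2B (F_2 n) F2) (fun n => L2Z t (L2B (G_2 n) G2)) cF
  (sqnormZ_cvg0 t (fun n => L2B (G_2 n) G2) cG).
apply: cvg_ext => n; congr sqnorm; apply/funext => x; ring.
Qed.

(** Expansion of the squared norm of [F_ n - F], with the convergence of [ip (F_ n) F] for the cross
    term. *)
Lemma L2cvg_sqnorm (F_ : nat -> T -> R) F : (forall n, L2 mu (F_ n)) -> L2 mu F ->
  L2cvg F_ F -> sqnorm (F_ n) @[n --> \oo] --> sqnorm F.
Proof.
move=> F_2 F2 cF; have c1 := L2cvg_ipl F_2 F2 F2 cF.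
rewrite (_ : (fun n => _) = (fun n => sqnorm (fun x => F_ n x - F x) + 2 * ip mu (F_ n) F - sqnorm F)); last first.
  by apply/funext => n; rewrite /sqnorm ip_sqrB//; ring.
have E : sqnorm F = 0 + 2 * ip mu F F - sqnorm F by rewrite /sqnorm; ring.
rewrite [X in _ --> X]E.
apply: cvgB; last exact: cvg_cst.
by apply: cvgD => //; apply: cvgM => //; exact: cvg_cst.
Qed.

Lemma L2cvg_ae (F_ : nat -> T -> R) F : (forall n, L2 mu (F_ n)) -> L2 mu F -> L2cvg F_ F ->
  exists k : nat -> nat, (forall n, (n <= k n)%N) /\
    {ae mu, forall x, F_ (k n) x @[n --> \oo] --> F x}.
Proof.
move=> F_2 F2 cF; have [k [kn kP]] := ip_subseq_ae (fun n => L2B (F_2 n) F2) cF.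
exists k; split => //; apply: filterS kP => x h.
apply: (cvg_ext (u := fun n => F_ (k n) x - F x + F x)); first by move=> n; rewrite subrK.
rewrite -[X in _ --> X]add0r; apply: cvgD => //; exact: cvg_cst.
Qed.

Lemma cvg_subseq (X : topologicalType) (u : nat -> X) (l : X) (k : nat -> nat) :
  (forall n, (n <= k n)%N) -> u n @[n --> \oo] --> l -> u (k n) @[n --> \oo] --> l.
Proof.
move=> kn ul A /ul[n0 _ nP]; exists n0 => // n n0n; apply: nP => /=.
exact: leq_trans n0n (kn n).
Qed.

End L2_convergence.

Section sobolev_closure.
Variables (R : realType) (N : nat) (Omega : set 'rV[R]_N).
Notation V := 'rV[R]_N.
Notation leb := (@leb R N).
Notation test := (test_function Omega).
Notation sqnorm := (sqnorm leb).
Notation L2cvg := (L2cvg leb).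
Implicit Types (phi psi : V -> R) (U W : V -> R) (G H : 'I_N -> V -> R).

Definition energy G H : R := \sum_i ip leb (G i) (H i).

Definition approximates (phi : nat -> V -> R) U G := [/\ forall n, test (phi n),
  L2cvg phi U & forall i, L2cvg (fun n => partial i (phi n)) (G i)].

(* H^1_0(Omega) as a space of functions on the whole of R^N: [U] and its gradient [G]
   are the extensions by 0 outside [Omega], see [H10P]. *)
Definition H10fun U G := [/\ L2 leb U, forall i, L2 leb (G i) &
  exists phi : nat -> V -> R, approximates phi U G].

Lemma patchB (T : Type) (A : set T) (F F' : T -> R) :
  (F \- F') \_ A = (fun x => (F \_ A) x - (F' \_ A) x).
Proof. by apply/funext => x; rewrite /patch; case: ifPn => //=; rewrite subr0. Qed.

Lemma L2dist_cvg0 (phi : nat -> V -> R) (u : V -> R) : (forall n, test (phi n)) ->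
  L2 leb (u \_ Omega) ->
  (L2dist Omega (phi n) u @[n --> \oo] --> 0%E) <->
  L2cvg phi (u \_ Omega).
Proof.
move=> tphi u2.
have E n : ((phi n \- u) \_ Omega) = (fun x => phi n x - (u \_ Omega) x).
  by rewrite patchB (test_patch (tphi n)).
rewrite /L2dist; under eq_fun do rewrite E.
by apply: Lnorm2_cvg0 => n; apply: L2B => //; exact: test_L2 (tphi n).
Qed.

Lemma Rintegral_patchM (F F' : V -> R) :
  \int[leb]_(x in Omega) (F x * F' x) = ip leb (F \_ Omega) (F' \_ Omega).
Proof.
rewrite Rintegral_mkcond; apply: eq_Rintegral => x _.
by rewrite /patch; case: ifPn => //; rewrite mulr0.
Qed.

(** Integration by parts holds for the approximating test functions, and both sides are continuous
    in L^2. *)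
Lemma H10fun_weak_gradient U G psi i : H10fun U G -> test psi ->
  ip leb U (partial i psi) = - ip leb (G i) psi.
Proof.
move=> [U2 G2 [phi [tphi phiU phiG]]] tpsi.
have c1 := L2cvg_ipl (fun n => test_L2 (tphi n)) U2 (test_L2 (test_partial i tpsi)) phiU.
have c2 := L2cvg_ipl (fun n => test_L2 (test_partial i (tphi n))) (G2 i) (test_L2 tpsi) (phiG i).
have c3 : ip leb (phi n) (partial i psi) @[n --> \oo] --> - ip leb (G i) psi.
  apply: cvg_ext (cvgN c2) => n /=.
  by rewrite /ip (test_byparts i (tphi n) tpsi).
exact: (cvg_unique _ c1 c3).
Qed.

Definition components (Du : V -> 'cV[R]_N) : 'I_N -> V -> R :=
  fun i => (fun x => Du x i ord0) \_ Omega.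

(** Test functions vanish off [Omega], so extension by 0 does not affect the approximation.
    Conversely, the [weak_gradient] clause is recovered from the approximation itself. *)
Lemma H10P u (Du : V -> 'cV[R]_N) :
  H10 Omega u Du <-> H10fun (u \_ Omega) (components Du).
Proof.
split.
  move=> [[/L2P u2 Du2 _] [phi [tphi phiu phiDu]]].
  have Dui2 i : L2 leb (components Du i) by have /L2P := Du2 i.
  split => //; exists phi; split => //; first exact/(L2dist_cvg0 tphi u2).
  by move=> i; exact/(L2dist_cvg0 (fun n => test_partial i (tphi n)) (Dui2 i)).
move=> HU; have [u2 Du2 [phi [tphi phiu phiDu]]] := HU; split.
  split; [exact/L2P | by move=> i; apply/L2P; exact: Du2 |].
  move=> psi tpsi i; rewrite !Rintegral_patchM -/(components Du i).
  rewrite (test_patch tpsi) (test_patch (test_partial i tpsi)).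
  exact: H10fun_weak_gradient.
exists phi; split => //; first exact/(L2dist_cvg0 tphi u2).
by move=> i; exact/(L2dist_cvg0 (fun n => test_partial i (tphi n)) (Du2 i)).
Qed.

Hypothesis mO : measurable (Omega : set (lebspace R N)).

(** Test functions vanish off [Omega], so cutting [U] off there can only bring it closer to them. *)
Lemma sqnorm_patch_le phi U : test phi -> L2 leb U ->
  sqnorm (fun x => phi x - (U \_ Omega) x) <= sqnorm (fun x => phi x - U x).
Proof.
move=> tphi U2; have U2p := L2_patch mO U2; have p2 := test_L2 tphi.
have d1 := L2B p2 U2; have d2 := L2B p2 U2p.
apply: (le_Rintegral measurableT (L2M d2 d2) (L2M d1 d1)) => x _.
rewrite -!expr2 {1}/patch; case: ifPn => // /negP xO.
rewrite (test_out tphi) ?subr0 ?expr0n ?sqr_ge0// => Ox.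
by apply: xO; rewrite inE.
Qed.

Lemma H10fun_patch U G : H10fun U G ->
  H10fun (U \_ Omega) (fun i => (G i) \_ Omega).
Proof.
move=> [U2 G2 [phi [tphi phiU phiG]]]; split.
- exact: L2_patch.
- by move=> i; exact: L2_patch.
exists phi; split => //.
  by apply: squeeze_cvg0 phiU => n; [exact: ip_ge0 | exact: sqnorm_patch_le].
move=> i; apply: squeeze_cvg0 (phiG i) => n; first exact: ip_ge0.
by apply: sqnorm_patch_le => //; exact: test_partial.
Qed.

Lemma H10_H10fun U G : H10fun U G -> H10 Omega U (fun x => \col_i G i x).
Proof.
move=> /H10fun_patch HUG; apply/H10P; have := HUG; congr H10fun.
by apply/funext => i; rewrite /components; congr (_ \_ _); apply/funext => x; rewrite mxE.
Qed.

Lemma H10fun_comb U G W H (t : R) : H10fun U G -> H10fun W H ->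
  H10fun (fun x => U x + t * W x) (fun i x => G i x + t * H i x).
Proof.
move=> [U2 G2 [phi [tphi phiU phiG]]] [W2 H2 [psi [tpsi psiW psiH]]].
split; [exact: L2D U2 (L2Z t W2) | by move=> i; exact: L2D (G2 i) (L2Z t (H2 i)) |].
exists (fun n x => phi n x + t * psi n x); split.
- by move=> n; exact: testD (tphi n) (testZ t (tpsi n)).
- exact: (L2cvg_comb t (fun n => test_L2 (tphi n)) (fun n => test_L2 (tpsi n)) U2 W2 phiU psiW).
move=> i; have E : (fun n => partial i (fun x => phi n x + t * psi n x)) =
    fun n x => partial i (phi n) x + t * partial i (psi n) x.
  apply/funext => n; apply/funext => x; rewrite partialD ?partialZ//.
  - exact: test_smooth (tpsi n).
  - exact: test_smooth (tphi n).
  - exact: (smoothZ t (test_smooth (tpsi n))).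
rewrite E; exact: (L2cvg_comb t (fun n => test_L2 (test_partial i (tphi n)))
  (fun n => test_L2 (test_partial i (tpsi n))) (G2 i) (H2 i) (phiG i) (psiH i)).
Qed.

Lemma test_energy phi : test phi ->
  energy (fun i => partial i phi) (fun i => partial i phi) =
  \int[leb]_(x in [set: lebspace R N]) grad2 phi x.
Proof.
move=> tphi; rewrite /grad2 /energy.
elim: (index_enum _) => [|i r IH].
  by under eq_Rintegral do rewrite big_nil; rewrite big_nil Rintegral_cst// mul0r.
under eq_Rintegral do rewrite big_cons; rewrite big_cons IH RintegralD//.
- exact: (test_L2 (test_partial i tphi)).2.
- rewrite (_ : EFin \o _ = fun x : lebspace R N =>
    (\sum_(j <- r) (partial j phi x ^+ 2)%:E)%E); last first.
    by apply/funext => x /=; rewrite sumEFin.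
  by apply: (integrable_sum measurableT) => j _; exact: (test_L2 (test_partial j tphi)).2.
Qed.

End sobolev_closure.

(** * The Rayleigh quotient *)

Lemma cvg0_le (R : realType) (u : nat -> R) (e : R) : u n @[n --> \oo] --> 0 -> 0 < e ->
  exists n0, forall n, (n0 <= n)%N -> u n <= e.
Proof.
move=> /cvgrPdist_le u0 e0; have [n0 _ n0P] := u0 _ e0; exists n0 => n nn.
by have := n0P n nn; rewrite sub0r normrN; apply: le_trans (ler_norm _).
Qed.

(** Parallelogram identities for two quadratic forms: [d1 + d2 = 2 (a + b) <= 4], while
    [S * d1 >= s1 = 2 (si + sj) - s2] is close to [4 S], so little is left for [d2]. The errors add
    up to at most 5/8 of [e * S]. *)
Lemma almost_max_close (R : realType) (S e a b c cc d1 d2 s1 s2 si sj vi vj : R) :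
  0 < S -> 0 < e -> d1 = a + 2 * 1 * c + 1 ^+ 2 * b -> d2 = a + 2 * -1 * c + (-1) ^+ 2 * b ->
  s1 = si + 2 * 1 * cc + 1 ^+ 2 * sj -> s2 = si + 2 * -1 * cc + (-1) ^+ 2 * sj ->
  s1 <= S * d1 -> s2 <= e * S / 8 -> a <= 1 -> b <= 1 ->
  S - vi <= si -> S - vj <= sj -> vi <= e * S / 8 -> vj <= e * S / 8 -> d2 <= e.
Proof.
move=> S0 e0 h1 h2 g1 g2 hS hD a1 b1 bi bj vie vje; rewrite -(ler_pM2l S0).
have eS : 0 <= S * e by rewrite mulr_ge0 // ltW.
have hd : d2 = 2 * (a + b) - d1 by rewrite h1 h2; ring.
have gs : s1 + s2 = 2 * (si + sj) by rewrite g1 g2; ring.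
clear h1 h2 g1 g2.
have t1 : S * (2 * (a + b)) <= S * 4 by apply: ler_wpM2l; [exact: ltW | lra].
by rewrite hd mulrBr; lra.
Qed.

(** The image filter clusters at some [l] of the compact interval, and an ultrafilter contains
    either the preimage of a ball around [l] or its complement; the latter contradicts
    clustering. *)
Lemma ultra_bounded_cvg (R : realType) (F : set_system nat) (u : nat -> R) (M : R) :
  UltraFilter F -> (forall n, `|u n| <= M) ->
  exists l : R, forall e : R, 0 < e -> F [set n | `|u n - l| < e].
Proof.
move=> FU uM.
have cM : compact (`[- M, M]%classic : set R) by exact: segment_compact.
have PF : ProperFilter (u @ F) by exact: fmap_proper_filter.
have FM : (u @ F) `[- M, M]%classic.
  by apply: (@filterS _ F _ setT) => [n _ /=|]; [rewrite in_itv/= -ler_norml | exact: filterT].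
have [l [_ cl]] := cM _ PF FM.
exists l => e e0; have [h|nF] := in_ultra_setVsetC [set n | ball l e (u n)] FU.
  by apply: filterS h => n; rewrite /ball/= distrC.
have [x [/= nx /= bx]] := cl (~` ball l e) (ball l e) nF (nbhsx_ballx l e e0).
by exfalso; apply: nx.
Qed.

(** [k n] is picked in the intersection of the first [n.+1] sets of small diameter with the tail
    from [n], a member of the filter and hence nonempty. *)
Lemma ultra_cauchy_subseq (R : realType) (F : set_system nat) (D : nat -> nat -> R) :
  UltraFilter F -> (forall n, F [set k | (n <= k)%N]) ->
  (forall e : R, 0 < e -> exists2 A, F A & forall n m, A n -> A m -> D n m <= e) ->
  exists k : nat -> nat, (forall n, (n <= k n)%N) /\
    forall e : R, 0 < e -> exists j0, forall i j, (j0 <= i)%N -> (j0 <= j)%N -> D (k i) (k j) <= e.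
Proof.
move=> FU Foo FD.
have inv0 n : (0 : R) < n.+1%:R^-1 by rewrite invr_gt0.
have /choice[A AP] : forall n, exists A, F A /\ forall i j, A i -> A j -> D i j <= n.+1%:R^-1.
  by move=> n; have [A FA AD] := FD _ (inv0 n); exists A.
have FB n : F [set k | forall i : 'I_n.+1, A i k].
  by apply: (filter_forall (f := fun i : 'I_n.+1 => A i)) => i; have [] := AP i.
have /choice[k kP] : forall n, exists k, (n <= k)%N /\ forall i, (i <= n)%N -> A i k.
  move=> n; have [k [nk Ak]] := filter_ex (filterI (Foo n) (FB n)).
  by exists k; split => // i ik; exact: (Ak (Ordinal (ik : (i < n.+1)%N))).
exists k; split => [n|e e0]; first by have [] := kP n.
have [j0 j0P] : exists j0 : nat, (j0.+1%:R : R)^-1 <= e.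
  by have [n /(_ n (leqnn n))] := cvg0_le (@cvg_harmonic R) e0; exists n.
exists j0 => i j ji jj; apply: le_trans j0P.
by apply: (AP j0).2; [exact: (kP i).2 | exact: (kP j).2].
Qed.

Section L2_ae_equal.
Context d (T : measurableType d) (R : realType) (mu : {measure set T -> \bar R}).
Implicit Types F G : T -> R.

Lemma L2_ae_eq F G : measurable_fun setT F -> L2 mu G ->
  {ae mu, forall x, F x = G x} -> L2 mu F.
Proof.
move=> mF [mG iG] FG; split => //; apply/integrableP; split.
  by apply/measurable_EFinP; exact: measurable_funX.
have /integrableP[_] := iG; congr (_ < _)%E.
apply: ge0_ae_eq_integral => //.
- by apply: measurableT_comp => //; apply/measurable_EFinP; exact: measurable_funX.
- by apply: measurableT_comp => //; apply/measurable_EFinP; exact: measurable_funX.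
- by apply: filterS FG => x FGx _; rewrite FGx.
Qed.

Lemma ip_ae_eq F G F' G' : measurable_fun setT F -> measurable_fun setT G ->
  measurable_fun setT F' -> measurable_fun setT G' ->
  {ae mu, forall x, F x = F' x} -> {ae mu, forall x, G x = G' x} ->
  ip mu F G = ip mu F' G'.
Proof.
move=> mF mG mF' mG' FF GG; rewrite /ip /Rintegral; congr fine.
apply: ae_eq_integral => //.
- by apply/measurable_EFinP; exact: measurable_funM.
- by apply/measurable_EFinP; exact: measurable_funM.
- by apply: filterS2 FF GG => x Fx Gx _; rewrite Fx Gx.
Qed.

Lemma L2cvg_ae_eq (F_ : nat -> T -> R) F G : (forall n, L2 mu (F_ n)) ->
  measurable_fun setT F -> L2 mu G ->
  {ae mu, forall x, F x = G x} -> L2cvg mu F_ G -> L2cvg mu F_ F.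
Proof.
move=> F2 mF G2 FG; apply: cvg_ext => n.
have m1 : measurable_fun setT (fun x => F_ n x - G x).
  by apply: measurable_funB; [exact: (F2 n).1 | exact: G2.1].
have m2 : measurable_fun setT (fun x => F_ n x - F x).
  by apply: measurable_funB => //; exact: (F2 n).1.
by apply: ip_ae_eq => //; apply: filterS FG => x ->.
Qed.

Lemma sqnorm_eq0_ae F : L2 mu F -> sqnorm mu F = 0 -> {ae mu, forall x, F x = 0}.
Proof.
move=> F2 F0.
have : (\int[mu]_x `|(F x ^+ 2)%:E| = 0)%E.
  under eq_integral do rewrite gee0_abs ?lee_fin ?sqr_ge0//.
  by rewrite -ip_fin// -/(sqnorm mu F) F0.
have mF2 : measurable_fun setT (fun x => (F x ^+ 2)%:E).
  by apply/measurable_EFinP; apply: measurable_funX; exact: F2.1.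
move/(ae_eq_integral_abs mu measurableT mF2); apply: filterS => x /(_ I)/= [] /eqP.
by rewrite sqrf_eq0 => /eqP.
Qed.

End L2_ae_equal.

Section rayleigh.
Variables (R : realType) (N : nat) (Omega : set 'rV[R]_N).
Notation V := 'rV[R]_N.
Notation leb := (@leb R N).
Notation test := (test_function Omega).
Notation sqnorm := (sqnorm leb).
Notation L2cvg := (L2cvg leb).
Implicit Types (phi psi U W : V -> R) (G H : 'I_N -> V -> R).

(** Square root of the weight: the integral of [f v^2] becomes a squared L^2 norm, to which
    Cauchy-Schwarz and completeness apply. *)
Variable sw : V -> R.
Hypothesis msw : measurable_fun setT (sw : lebspace R N -> R).
Hypothesis sw_test : forall phi, test phi -> L2 leb ((fun x => sw x * phi x) : lebspace R N -> R).
Variable CP : R.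
Hypothesis CP_ge0 : 0 <= CP.
Local Notation dir phi := (energy (fun i => partial i phi) (fun i => partial i phi)).
Hypothesis sw_poincare : forall phi, test phi -> sqnorm phi <= CP * dir phi.
(** Compactness in quantitative form: up to a small part of the energy, the weighted norm sees only
    finitely many linear functionals. *)
Hypothesis sw_compact : forall eta : R, 0 < eta -> exists (C : R) (n : nat) (chi : 'I_n -> V -> R),
  [/\ 0 <= C, forall k, L2 leb (chi k : lebspace R N -> R) &
  forall phi, test phi ->
  sqnorm (fun x => sw x * phi x) <= eta * dir phi + C * \sum_k (ip leb (chi k) phi) ^+ 2].

Lemma energy_ge0 G : 0 <= energy G G.
Proof. by apply: sumr_ge0 => i _; exact: ip_ge0. Qed.

Lemma energy_sqrD G H : (forall i, L2 leb (G i)) -> (forall i, L2 leb (H i)) ->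
  energy (fun i x => G i x + H i x) (fun i x => G i x + H i x) =
  energy G G + 2 * energy G H + energy H H.
Proof.
move=> G2 H2; rewrite /energy mulr_sumr -!big_split/=; apply: eq_bigr => i _.
by rewrite (ip_sqrD (G2 i) (H2 i)).
Qed.

Lemma energyZr t G H : (forall i, L2 leb (G i)) -> (forall i, L2 leb (H i)) ->
  energy G (fun i x => t * H i x) = t * energy G H.
Proof.
move=> G2 H2; rewrite /energy mulr_sumr; apply: eq_bigr => i _.
exact: (ipZr t (H2 i) (G2 i)).
Qed.

Lemma energy_sqrZ t G : (forall i, L2 leb (G i)) ->
  energy (fun i x => t * G i x) (fun i x => t * G i x) = t ^+ 2 * energy G G.
Proof.
move=> G2; rewrite /energy mulr_sumr; apply: eq_bigr => i _.
exact: (ip_sqrZ t (G2 i)).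
Qed.

Lemma energy_sqrD_le G H : (forall i, L2 leb (G i)) -> (forall i, L2 leb (H i)) ->
  energy (fun i x => G i x + H i x) (fun i x => G i x + H i x) <=
  2 * energy G G + 2 * energy H H.
Proof.
move=> G2 H2; rewrite /energy !mulr_sumr -!big_split/=; apply: ler_sum => i _.
exact: (ip_sqrD_le (G2 i) (H2 i)).
Qed.

Lemma test_L2_partial phi i : test phi -> L2 leb (partial i phi : lebspace R N -> R).
Proof. by move=> tphi; exact: test_L2 (test_partial i tphi). Qed.

Lemma partial_comb phi psi (t : R) i x : test phi -> test psi ->
  partial i (fun x => phi x + t * psi x) x = partial i phi x + t * partial i psi x.
Proof.
move=> tphi tpsi; rewrite partialD ?partialZ//.
- exact: test_smooth tpsi.
- exact: test_smooth tphi.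
- exact: (smoothZ t (test_smooth tpsi)).
Qed.

Lemma dir_comb phi psi (t : R) : test phi -> test psi ->
  dir (fun x => phi x + t * psi x) =
  dir phi + 2 * t * energy (fun i => partial i phi) (fun i => partial i psi) + t ^+ 2 * dir psi.
Proof.
move=> tphi tpsi; have p2 i := test_L2_partial i tphi; have q2 i := test_L2_partial i tpsi.
have -> : (fun i => partial i (fun x => phi x + t * psi x)) =
    (fun i x => partial i phi x + t * partial i psi x).
  by apply/funext => i; apply/funext => x; exact: partial_comb.
rewrite (energy_sqrD p2 (fun i => L2Z t (q2 i))) (energyZr t p2 q2) (energy_sqrZ t q2).
by rewrite mulrA.
Qed.

Lemma sw_comb phi psi (t : R) : test phi -> test psi ->
  sqnorm (fun x => sw x * (phi x + t * psi x)) =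
  sqnorm (fun x => sw x * phi x) +
  2 * t * ip leb (fun x => sw x * phi x) (fun x => sw x * psi x) +
  t ^+ 2 * sqnorm (fun x => sw x * psi x).
Proof.
move=> tphi tpsi; have p2 := sw_test tphi; have q2 := sw_test tpsi.
have -> : (fun x => sw x * (phi x + t * psi x)) =
    (fun x => sw x * phi x + t * (sw x * psi x)) by apply/funext => x; ring.
rewrite /sqnorm (ip_sqrD p2 (L2Z t q2)) (ipZr t q2 p2) (ip_sqrZ t q2); ring.
Qed.

Lemma testDZ phi psi t : test phi -> test psi -> test (fun x => phi x + t * psi x).
Proof. by move=> tphi tpsi; exact: testD tphi (testZ t tpsi). Qed.

(** The compactness estimate with [eta = 1], whose functionals are bounded by Cauchy-Schwarz and the
    Poincare inequality. *)
Lemma sw_bounded : exists2 C0 : R, 0 <= C0 & forall phi, test phi ->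
  sqnorm (fun x => sw x * phi x) <= C0 * dir phi.
Proof.
have [C [n [chi [C0 chi2 chiP]]]] := sw_compact ltr01.
exists (1 + C * \sum_k (sqnorm (chi k) * CP)).
  rewrite addr_ge0// mulr_ge0//; apply: sumr_ge0 => k _; rewrite mulr_ge0//; exact: ip_ge0.
move=> phi tphi; apply: le_trans (chiP _ tphi) _; rewrite mulrDl lerD2l -mulrA.
apply: ler_wpM2l => //; rewrite mulr_suml; apply: ler_sum => k _.
apply: le_trans (cauchy_schwarz (chi2 k) (test_L2 tphi)) _.
by rewrite -mulrA; apply: ler_wpM2l; [exact: ip_ge0 | exact: sw_poincare].
Qed.

Lemma energy_cvg (G_ : nat -> 'I_N -> V -> R) G : (forall n i, L2 leb (G_ n i)) ->
  (forall i, L2 leb (G i)) -> (forall i, L2cvg (fun n => G_ n i) (G i)) ->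
  energy (G_ n) (G_ n) @[n --> \oo] --> energy G G.
Proof.
move=> G_2 G2 cG; rewrite /energy; elim: (index_enum _) => [|i r IH].
  by rewrite big_nil; under eq_fun do rewrite big_nil; exact: cvg_cst.
rewrite big_cons; under eq_fun do rewrite big_cons.
apply: cvgD => //; exact: (L2cvg_sqnorm (fun n => G_2 n i) (G2 i) (cG i)).
Qed.

Lemma energy_diff_cvg0 (G_ : nat -> 'I_N -> V -> R) G :
  (forall i, L2cvg (fun n => G_ n i) (G i)) ->
  energy (fun i x => G_ n i x - G i x) (fun i x => G_ n i x - G i x) @[n --> \oo] --> 0.
Proof.
move=> cG; rewrite /energy; elim: (index_enum _) => [|i r IH].
  by under eq_fun do rewrite big_nil; exact: cvg_cst.
under eq_fun do rewrite big_cons.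
by have h := cvgD (cG i) IH; rewrite addr0 in h; exact: h.
Qed.

Lemma dirB_le phi psi G : test phi -> test psi -> (forall i, L2 leb (G i)) ->
  dir (fun x => phi x + -1 * psi x) <=
  2 * energy (fun i x => partial i phi x - G i x) (fun i x => partial i phi x - G i x) +
  2 * energy (fun i x => partial i psi x - G i x) (fun i x => partial i psi x - G i x).
Proof.
move=> tphi tpsi G2.
have p2 i := L2B (test_L2_partial i tphi) (G2 i).
have q2 i := L2B (test_L2_partial i tpsi) (G2 i).
have -> : (fun i => partial i (fun x => phi x + -1 * psi x)) =
    (fun i x => (partial i phi x - G i x) + -1 * (partial i psi x - G i x)).
  by apply/funext => i; apply/funext => x; rewrite partial_comb//; ring.
apply: le_trans (energy_sqrD_le p2 (fun i => L2Z (-1) (q2 i))) _.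
by rewrite (energy_sqrZ _ q2) sqrrN expr1n mul1r.
Qed.

(** By [sw_bounded], convergence of the gradients makes [sw * phi n] a Cauchy sequence; it remains
    to identify its limit. *)
Lemma sw_approx (phi : nat -> V -> R) U G : L2 leb U -> (forall i, L2 leb (G i)) ->
  approximates Omega phi U G ->
  L2 leb (fun x => sw x * U x) /\ L2cvg (fun n x => sw x * phi n x) (fun x => sw x * U x).
Proof.
move=> U2 G2 [tphi phiU phiG]; have [C0 C0_ge0 C0P] := sw_bounded.
have swphi n : L2 leb (fun x => sw x * phi n x) by exact: sw_test.
have [|Z Z2 cZ] := L2_complete swphi.
  move=> e e0; have d0 : 0 < e / (4 * (C0 + 1)) by rewrite divr_gt0// mulr_gt0//; lra.
  have := energy_diff_cvg0 (G_ := fun n i => partial i (phi n)) phiG.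
  move=> /cvg0_le/(_ d0)[n0 n0P]; exists n0 => m n mn0 nn0.
  have -> : (fun x => sw x * phi m x - sw x * phi n x) =
      (fun x => sw x * (phi m x + -1 * phi n x)) by apply/funext => x; ring.
  apply: le_trans (C0P _ (testDZ (-1) (tphi m) (tphi n))) _.
  apply: le_trans (ler_wpM2l C0_ge0 (dirB_le (tphi m) (tphi n) G2)) _.
  have := n0P m mn0; have := n0P n nn0.
  set a := energy _ _; set b := energy _ _ => ha hb.
  have : C0 * (2 * b + 2 * a) <= C0 * (4 * (e / (4 * (C0 + 1)))) by apply: ler_wpM2l => //; lra.
  move/le_trans; apply.
  have -> : C0 * (4 * (e / (4 * (C0 + 1)))) = e * (C0 / (C0 + 1)) by field; lra.
  by apply: ler_piMr; [exact: ltW | rewrite ler_pdivrMr; lra].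
(* Multiplication by the possibly unbounded [sw] need not be continuous in L^2, so [Z] is compared
   with [sw * U] through almost everywhere limits along nested subsequences. *)
have [k [kn kP]] := L2cvg_ae (fun n => test_L2 (tphi n)) U2 phiU.
have cZk : L2cvg (fun n x => sw x * phi (k n) x) Z.
  exact: (cvg_subseq kn cZ).
have [k' [k'n k'P]] := L2cvg_ae (fun n => swphi (k n)) Z2 cZk.
have ae : {ae leb, forall x : lebspace R N, sw x * U x = Z x}.
  apply: filterS2 kP k'P => x cU cZx.
  have cU' : sw x * phi (k (k' n)) x @[n --> \oo] --> sw x * U x.
    apply: cvgM; first exact: cvg_cst.
    exact: (cvg_subseq (u := fun n => phi (k n) x) k'n cU).
  exact: (cvg_unique _ cU' cZx).
have mswU : measurable_fun setT ((fun x => sw x * U x) : lebspace R N -> R).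
  exact: (measurable_funM msw U2.1).
split; first exact: (L2_ae_eq mswU Z2 ae).
exact: (L2cvg_ae_eq swphi mswU Z2 ae cZ).
Qed.

Lemma limit_le (a b : nat -> R) l l' : (forall n, a n <= b n) ->
  a n @[n --> \oo] --> l -> b n @[n --> \oo] --> l' -> l <= l'.
Proof. by move=> ab al bl; apply: (ler_cvg_to al bl); exact: nearW. Qed.

Lemma sw_H10fun (S : R) U G : (forall phi, test phi -> sqnorm (fun x => sw x * phi x) <= S * dir phi) ->
  H10fun Omega U G ->
  L2 leb (fun x => sw x * U x) /\ sqnorm (fun x => sw x * U x) <= S * energy G G.
Proof.
move=> SP [U2 G2 [phi [tphi phiU phiG]]].
have [swU2 cswU] := sw_approx U2 G2 (And3 tphi phiU phiG); split => //.
apply: (limit_le (fun n => SP (phi n) (tphi n))).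
  exact: (L2cvg_sqnorm (fun n => sw_test (tphi n)) swU2 cswU).
apply: cvgM; first exact: cvg_cst.
exact: (energy_cvg (fun n i => test_L2_partial i (tphi n)) G2 phiG).
Qed.

(** With [dir phi <= 1] rather than [= 1], the zero function already makes the set nonempty. *)
Definition rayleigh_sup : R := sup [set sqnorm (fun x => sw x * phi x) |
  phi in [set phi | test phi /\ dir phi <= 1]].

Let rset := [set sqnorm (fun x => sw x * phi x) |
  phi in [set phi | test phi /\ dir phi <= 1]].

Lemma has_sup_rayleigh : has_sup rset.
Proof.
split.
  exists (sqnorm (fun x => sw x * (fun=> 0) x)); exists (fun=> 0) => //; split; first exact: test0.
  have := dir_comb (-1) (test0 Omega) (test0 Omega).
  have -> : (fun x : V => 0 + -1 * 0) = (fun=> 0 : R) by apply/funext => x; ring.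
  set D := dir _ => h.
  have : D = 0 by lra.
  by move=> ->; exact: ler01.
have [C0 C0_ge0 C0P] := sw_bounded; exists C0 => _ [phi [tphi dphi] <-].
apply: le_trans (C0P _ tphi) _; exact: ler_piMr.
Qed.

Lemma rayleigh_supP phi : test phi -> sqnorm (fun x => sw x * phi x) <= rayleigh_sup * dir phi.
Proof.
move=> tphi; have [C0 C0_ge0 C0P] := sw_bounded.
have d0 : 0 <= dir phi := energy_ge0 _.
(* Without energy [phi] cannot be normalized, but then [sw_bounded] makes its weighted norm 0. *)
have [dphi|dphi] := eqVneq (dir phi) 0; first by have := C0P _ tphi; rewrite dphi !mulr0.
have dp : 0 < dir phi by rewrite lt_neqAle eq_sym dphi.
pose t := (Num.sqrt (dir phi))^-1.
have t2 : t ^+ 2 = (dir phi)^-1 by rewrite /t exprVn sqr_sqrtr.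
have p2 i := test_L2_partial i tphi.
have tE : dir (fun x => t * phi x) = 1.
  have -> : (fun i => partial i (fun x => t * phi x)) = fun i x => t * partial i phi x.
    by apply/funext => i; apply/funext => x; rewrite partialZ//; exact: test_smooth tphi.
  by rewrite (energy_sqrZ t p2) t2 mulVf.
have : sqnorm (fun x => sw x * (t * phi x)) <= rayleigh_sup.
  apply: (sup_upper_bound has_sup_rayleigh); exists (fun x => t * phi x) => //.
  by split; [exact: testZ | rewrite tE].
have -> : (fun x => sw x * (t * phi x)) = (fun x => t * (sw x * phi x)).
  by apply/funext => x; ring.
by rewrite /sqnorm (ip_sqrZ t (sw_test tphi)) t2 ler_pdivrMl// mulrC.
Qed.

(* The bounded coefficients [ip (chi a) (phi m)] all converge along an ultrafilter, so the
   maximizing sequence is Cauchy for the weight by compactness, and then for the Dirichlet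
   energy by the parallelogram identity. *)
Lemma rayleigh_maximizer : 0 < rayleigh_sup -> exists U G,
  [/\ H10fun Omega U G, sqnorm (fun x => sw x * U x) = rayleigh_sup & energy G G <= 1].
Proof.
set S := rayleigh_sup => S0.
have inv0 n : (0 : R) < n.+1%:R^-1 by rewrite invr_gt0.
have /choice[phi phiP] : forall n : nat, exists phi,
    [/\ test phi, dir phi <= 1 & S - n.+1%:R^-1 < sqnorm (fun x => sw x * phi x)].
  move=> n; have [_ [phi [tphi dphi] <-] h] := sup_adherent (inv0 n) has_sup_rayleigh.
  by exists phi.
have tphi n : test (phi n) by have [] := phiP n.
have dphi n : dir (phi n) <= 1 by have [] := phiP n.
have bphi n : S - n.+1%:R^-1 <= sqnorm (fun x => sw x * phi n x) by have [_ _ /ltW] := phiP n.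
have nphi n : sqnorm (phi n) <= CP.
  by apply: le_trans (sw_poincare (tphi n)) _; exact: ler_piMr.
have [F [FU Foo]] := ultraFilterLemma eventually_filter.
have Fge n : F [set k | (n <= k)%N] by apply: Foo; exists n.
pose D n m := sqnorm (fun x => sw x * (phi n x + -1 * phi m x)).
have [|k [kn kD]] := @ultra_cauchy_subseq R F D FU Fge.
  (* The energy of a difference is at most 4, see [dle] below, so the energy term will contribute at
     most [e / 2]. *)
  move=> e e0; have e8 : 0 < e / 8 by rewrite divr_gt0.
  have [C [n [chi [C0 chi2 chiP]]]] := sw_compact e8.
  have /choice[l lP] : forall a, exists l : R, forall e : R, 0 < e ->
      F [set m | `|ip leb (chi a) (phi m) - l| < e].
    move=> a; apply: (@ultra_bounded_cvg R F _ (sqnorm (chi a) * CP + 1) FU) => m.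
    apply: ler_normr_sqr; first by rewrite addr_ge0// mulr_ge0//; exact: ip_ge0.
    apply: le_trans (cauchy_schwarz (chi2 a) (test_L2 (tphi m))) _.
    have : sqnorm (chi a) * sqnorm (phi m) <= sqnorm (chi a) * CP.
      by apply: ler_wpM2l => //; exact: ip_ge0.
    move/le_trans; apply.
    have : 0 <= sqnorm (chi a) * CP by rewrite mulr_ge0//; exact: ip_ge0.
    by set X := _ * _; nra.
  (* Within [dl] of their limits, the [n] coefficients differ by at most [2 dl] and contribute at
     most [e / 2]. *)
  pose dl := Num.sqrt (e / (8 * (C * n%:R + 1))).
  have Cn : 0 < C * n%:R + 1 by rewrite ltr_pwDr// mulr_ge0.
  have dl2 : dl ^+ 2 = e / (8 * (C * n%:R + 1)).
    by rewrite sqr_sqrtr// divr_ge0// ltW// mulr_gt0.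
  have dl0 : 0 < dl by rewrite sqrtr_gt0 divr_gt0// mulr_gt0.
  exists [set m | forall a, `|ip leb (chi a) (phi m) - l a| < dl].
    by apply: (filter_forall (f := fun a => [set m | `|ip leb (chi a) (phi m) - l a| < dl])) => a; exact: lP.
  move=> i j Ai Aj; apply: le_trans (chiP _ (testDZ (-1) (tphi i) (tphi j))) _.
  have dle : dir (fun x => phi i x + -1 * phi j x) <= 4.
    have h1 := dir_comb 1 (tphi i) (tphi j); have h2 := dir_comb (-1) (tphi i) (tphi j).
    have h3 : 0 <= dir (fun x => phi i x + 1 * phi j x) := energy_ge0 _.
    have := dphi i; have := dphi j; move: h1 h2 h3.
    by set a := dir _; set b := dir _; set c := dir _; set d := dir _; set f := energy _ _; lra.
  have sumle : \sum_a (ip leb (chi a) (fun x => phi i x + -1 * phi j x)) ^+ 2 <=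
      n%:R * (4 * dl ^+ 2).
    rewrite -[n in n%:R]card_ord mulr_natl -sumr_const; apply: ler_sum => a _.
    have -> : ip leb (chi a) (fun x => phi i x + -1 * phi j x) =
        (ip leb (chi a) (phi i) - l a) - (ip leb (chi a) (phi j) - l a).
      rewrite (ipDr (test_L2 (tphi i)) (L2Z (-1) (test_L2 (tphi j))) (chi2 a)).
      by rewrite (ipZr (-1) (test_L2 (tphi j)) (chi2 a)); ring.
    rewrite -sqr_normr (_ : 4 * dl ^+ 2 = (dl + dl) ^+ 2); last by ring.
    rewrite ler_sqr ?nnegrE//; last by rewrite addr_ge0 // ltW.
    apply: le_trans (ler_normB _ _) _.
    by apply: lerD; [exact/ltW/Ai | exact/ltW/Aj].
  have t1 : e / 8 * dir (fun x => phi i x + -1 * phi j x) <= e / 8 * 4 by apply: ler_wpM2l => //; exact: ltW.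
  have := ler_wpM2l C0 sumle; rewrite dl2.
  have -> : C * (n%:R * (4 * (e / (8 * (C * n%:R + 1))))) = e / 2 * (C * n%:R / (C * n%:R + 1)).
    by field; rewrite gt_eqF.
  have : C * n%:R / (C * n%:R + 1) <= 1 by rewrite ler_pdivrMr// mul1r lerDl.
  move=> /(ler_wpM2l (ltW (divr_gt0 e0 (@ltr0Sn _ 1)))).
  by move: t1; set X := _ * dir _; set Y := C * _; set Z := e / 2 * _; lra.
pose psi n := phi (k n).
have tpsi n : test (psi n) := tphi (k n).
have bpsi n : S - n.+1%:R^-1 <= sqnorm (fun x => sw x * psi n x).
  apply: le_trans (bphi (k n)); rewrite lerD2l lerN2 lef_pV2 ?posrE//.
  by rewrite ler_nat ltnS.
have bpsi' n : sqnorm (fun x => sw x * psi n x) <= S.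
  apply: le_trans (rayleigh_supP (tpsi n)) _; apply: ler_piMr; [exact: ltW | exact: dphi].
have Dcauchy e : 0 < e -> exists j0, forall i j, (j0 <= i)%N -> (j0 <= j)%N ->
    dir (fun x => psi i x + -1 * psi j x) <= e.
  move=> e0; have eS : 0 < e * S / 8 by rewrite divr_gt0// mulr_gt0.
  have [j1 j1P] := kD _ eS.
  have [j2 j2P] : exists j : nat, (j.+1%:R : R)^-1 <= e * S / 8.
    by have [n /(_ n (leqnn n))] := cvg0_le (@cvg_harmonic R) eS; exists n.
  have inv_le i : (j2 <= i)%N -> (i.+1%:R : R)^-1 <= e * S / 8.
    by move=> ji; apply: le_trans j2P; rewrite lef_pV2 ?posrE// ler_nat ltnS.
  exists (maxn j1 j2) => i j; rewrite !geq_max => /andP[i1 i2] /andP[j1' j2'].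
  have := j1P i j i1 j1'; rewrite /D -/(psi i) -/(psi j) => hD.
  have h1 := dir_comb 1 (tpsi i) (tpsi j); have h2 := dir_comb (-1) (tpsi i) (tpsi j).
  have g1 := sw_comb 1 (tpsi i) (tpsi j); have g2 := sw_comb (-1) (tpsi i) (tpsi j).
  have hS := rayleigh_supP (testDZ 1 (tpsi i) (tpsi j)).
  have di := dphi (k i); have dj := dphi (k j); rewrite -/(psi i) -/(psi j) in di dj.
  have bi := bpsi i; have bj := bpsi j; have vi := inv_le i i2; have vj := inv_le j j2'.
  rewrite -/S in hS.
  move: h1 h2 g1 g2 hS hD di dj bi bj vi vj.
  set d1 := dir (fun x => _ + 1 * _); set d2 := dir (fun x => _ + -1 * _).
  set s1 := sqnorm (fun x => sw x * (_ + 1 * _)); set s2 := sqnorm (fun x => sw x * (_ + -1 * _)).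
  set a := dir (psi i); set b := dir (psi j); set c := energy _ _.
  set si := sqnorm (fun x => sw x * psi i x); set sj := sqnorm (fun x => sw x * psi j x).
  set cc := ip _ _ _; set vi' := _^-1; set vj' := (j.+1%:R)^-1.
  move=> h1 h2 g1 g2 hS hD di dj bi bj vi vj.
  exact: (almost_max_close S0 e0 h1 h2 g1 g2 hS hD di dj bi bj vi vj).
(* The Poincare inequality passes the Cauchy property from the gradients to the functions. *)
have cauchyU : forall e : R, 0 < e -> exists n0, forall m n, (n0 <= m)%N -> (n0 <= n)%N ->
    sqnorm (fun x => psi m x - psi n x) <= e.
  move=> e e0; have CP1 : 0 < CP + 1 by rewrite ltr_wpDl.
  have e' : 0 < e / (CP + 1) by exact: divr_gt0.
  have [n0 n0P] := Dcauchy _ e'; exists n0 => m n mn nn.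
  have -> : (fun x => psi m x - psi n x) = (fun x => psi m x + -1 * psi n x).
    by apply/funext => x; ring.
  apply: le_trans (sw_poincare (testDZ (-1) (tpsi m) (tpsi n))) _.
  apply: le_trans (ler_wpM2l CP_ge0 (n0P m n mn nn)) _.
  rewrite mulrCA; apply: ler_piMr; [exact: ltW | by rewrite ler_pdivrMr// mul1r lerDl].
have [U U2 cU] := L2_complete (fun n => test_L2 (tpsi n)) cauchyU.
have /choice[G GP] : forall i, exists G : V -> R, L2 leb G /\ L2cvg (fun n => partial i (psi n)) G.
  move=> i; have [|G G2 cG] := L2_complete (fun n => test_L2_partial i (tpsi n)); last by exists G.
  move=> e e0; have [n0 n0P] := Dcauchy _ e0; exists n0 => m n mn nn.
  apply: le_trans (n0P m n mn nn); rewrite /energy (bigD1 i)//=.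
  have -> : partial i (fun x => psi m x + -1 * psi n x) = (fun x => partial i (psi m) x - partial i (psi n) x).
    by apply/funext => x; rewrite partial_comb//; ring.
  by rewrite lerDl; apply: sumr_ge0 => j _; exact: ip_ge0.
have G2 i : L2 leb (G i) by have [] := GP i.
have cG i : L2cvg (fun n => partial i (psi n)) (G i) by have [] := GP i.
have app : approximates Omega psi U G by [].
exists U, G; split.
- by split => //; exists psi.
- have [swU2 cswU] := sw_approx U2 G2 app.
  have c1 := L2cvg_sqnorm (fun n => sw_test (tpsi n)) swU2 cswU.
  apply/eqP; rewrite eq_le; apply/andP; split.
    exact: (limit_le bpsi' c1 (cvg_cst S)).
  apply: (limit_le bpsi _ c1).
  rewrite -[X in _ --> X](subr0 S); apply: cvgB; [exact: cvg_cst | exact: cvg_harmonic].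
- have cE := energy_cvg (G_ := fun n i => partial i (psi n)) (fun n i => test_L2_partial i (tpsi n)) G2 cG.
  have c1 : (fun=> 1 : R) n @[n --> \oo] --> (1 : R) by exact: cvg_cst.
  exact: (limit_le (fun n => dphi (k n)) cE c1).
Qed.

(** First variation: by maximality a quadratic polynomial in [t] without constant term is
    nonnegative on the whole line, which forces its linear coefficient [2 (S * c - b)] to vanish. *)
Lemma rayleigh_euler_lagrange U G W H : H10fun Omega U G ->
  sqnorm (fun x => sw x * U x) = rayleigh_sup -> energy G G <= 1 -> 0 < rayleigh_sup ->
  H10fun Omega W H ->
  ip leb (fun x => sw x * U x) (fun x => sw x * W x) = rayleigh_sup * energy G H.
Proof.
set S := rayleigh_sup => HU SU EG S0 HW.
have [swU2 _] := sw_H10fun rayleigh_supP HU; have [swW2 _] := sw_H10fun rayleigh_supP HW.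
have G2 i : L2 leb (G i) by have [] := HU.
have H2 i : L2 leb (H i) by have [] := HW.
set b := ip leb _ _; set c := energy G H.
pose q := S * energy H H - sqnorm (fun x => sw x * W x).
have ineq t : 0 <= 2 * t * (S * c - b) + t ^+ 2 * q.
  have [_] := sw_H10fun rayleigh_supP (H10fun_comb t HU HW).
  have -> : (fun x => sw x * (U x + t * W x)) = (fun x => sw x * U x + t * (sw x * W x)).
    by apply/funext => x; ring.
  rewrite /sqnorm (ip_sqrD swU2 (L2Z t swW2)) (ipZr t swW2 swU2) (ip_sqrZ t swW2).
  rewrite (energy_sqrD G2 (fun i => L2Z t (H2 i))) (energyZr t G2 H2) (energy_sqrZ t H2).
  rewrite -/b -/c -/(sqnorm (fun x => sw x * U x)) SU -/S /q.
  have : S * energy G G <= S by apply: ler_piMr => //; exact: ltW.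
  rewrite -/(sqnorm (fun x => sw x * W x)).
  by set EGG := energy G G; set EHH := energy H H; set BW := sqnorm _; nra.
apply/eqP; rewrite eq_sym -subr_eq0; apply/eqP; set a := S * c - b in ineq *.
have [q0|q0] := lerP q 0.
  have := ineq (- a); have := sqr_ge0 a; nra.
have := ineq (- a / q).
have -> : 2 * (- a / q) * a + (- a / q) ^+ 2 * q = - (a ^+ 2 / q) by field; rewrite gt_eqF.
rewrite oppr_ge0 ler_pdivrMr// mul0r => a0.
by apply/eqP; rewrite -sqrf_eq0 eq_le a0 sqr_ge0.
Qed.

(** What the rest of the proof needs from the maximization: the sharp constant [S] and, if [S > 0],
    an extremal function, which is an eigenfunction for [S^-1]. *)
Lemma rayleigh_attained : exists S : R,
  (forall U G, H10fun Omega U G ->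
    L2 leb ((fun x => sw x * U x) : lebspace R N -> R) /\ sqnorm (fun x => sw x * U x) <= S * energy G G) /\
  (0 < S -> exists U G, [/\ H10fun Omega U G, sqnorm (fun x => sw x * U x) = S &
    forall W H, H10fun Omega W H ->
      ip leb (fun x => sw x * U x) (fun x => sw x * W x) = S * energy G H]).
Proof.
exists rayleigh_sup; split; first by move=> U G; exact: sw_H10fun rayleigh_supP.
move=> S0; have [U [G [HU US EG]]] := rayleigh_maximizer S0.
by exists U, G; split => // W H; exact: rayleigh_euler_lagrange.
Qed.

End rayleigh.

(** * The weight [f] in L^q *)

Section Lfun_local_bound.
Context d (T : measurableType d) (R : realType) (mu : {measure set T -> \bar R}).

Lemma integral_abs_indic (A : set T) (F : T -> R) : measurable A ->
  (\int[mu]_(x in A) `|F x|%:E = Lnorm mu 1 (EFin \o (fun x => (F x * \1_A x)%R)))%E.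
Proof.
move=> mA; rewrite Lnorm1 integral_mkcond; apply: eq_integral => x _.
rewrite /patch /= indicE; case: (x \in A); first by rewrite mulr1.
by rewrite mulr0 normr0.
Qed.

(** Hoelder's inequality against the indicator of [A], with [t = 1/q], or [t = 0] when [q = +oo].
    The condition [t < c^-1] records [c < q]; it is used with [c = N / 2]. *)
Lemma Lfun_local_bound (q : \bar R) (c : R) (F : T -> R) : 1 < c -> (c%:E < q)%E ->
  F \in Lfun mu q -> exists C t : R, [/\ 0 <= C, 0 <= t, t < c^-1 &
    forall A, measurable A -> (mu A < +oo)%E ->
      (\int[mu]_(x in A) `|F x|%:E <= (C * fine (mu A) `^ (1 - t))%:E)%E].
Proof.
move=> c1 cq; rewrite inE => /andP[]; rewrite !inE/= => mF /= nF.
have c0 : 0 < c by lra.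
case: q cq nF => [r| |]; last by rewrite ltNge leNye.
- rewrite lte_fin => cr nF; have r0 : 0 < r by lra.
  have finF : Lnorm mu r%:E (EFin \o F) \is a fin_num.
    by rewrite ge0_fin_numE ?Lnorm_ge0.
  exists (fine (Lnorm mu r%:E (EFin \o F))), r^-1; split.
  + by rewrite fine_ge0// Lnorm_ge0.
  + by rewrite invr_ge0 ltW.
  + by rewrite ltf_pV2.
  + move=> A mA Afin; rewrite integral_abs_indic//.
    have r1 : r^-1 < 1 by rewrite invf_lt1; lra.
    have s0 : 0 < (1 - r^-1)^-1 by rewrite invr_gt0 subr_gt0.
    apply: (le_trans (hoelder mu mF (measurable_indic mA) r0 s0 _)).
      by rewrite invrK; ring.
    rewrite EFinM fineK//; apply: lee_wpmul2l; first exact: Lnorm_ge0.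
    rewrite unlock invrK.
    have -> : (\int[mu]_x `|(EFin \o \1_A) x| `^ ((1 - r^-1)^-1) = mu A)%E.
      transitivity (\int[mu]_x (\1_A x)%:E)%E; last by rewrite integral_indic// setIT.
      apply: eq_integral => x _ /=.
      rewrite indicE; case: (x \in A); first by rewrite normr1 powR1.
      by rewrite normr0 powR0// gt_eqF.
    by rewrite -{1}(@fineK _ (mu A)) ?ge0_fin_numE// poweR_EFin.
- move=> _ nF.
  (* On a space of measure 0 the norm of exponent [+oo] carries no information, but all integrals
     vanish. *)
  have [mu0|mu0] := pselect (0 < mu setT)%E; last first.
    exists 0, 0; split; rewrite ?invr_gt0// => A mA _.
    rewrite null_set_integral ?mul0r//.
      by apply/measurable_EFinP; apply: measurableT_comp => //; exact: measurable_funTS.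
    apply/eqP; rewrite eq_le measure_ge0 andbT.
    have : (mu A <= mu setT)%E by apply: le_measure; rewrite ?inE.
    by move/le_trans; apply; rewrite leNgt; apply/negP.
  have [M MP] : exists M : R, \forall x \ae mu, `|F x| <= M.
    move: nF; rewrite /finite_norm unlock mu0 => nF.
    exact: (@ess_supr_bounded _ _ _ mu (fun x => `|F x|) nF).
  exists `|M|, 0; split; rewrite ?invr_gt0// => A mA Afin.
  have -> : (`|M| * fine (mu A) `^ (1 - 0))%:E = (\int[mu]_(x in A) (cst `|M|%:E x))%E.
    rewrite subr0 powRr1 ?fine_ge0// EFinM fineK ?ge0_fin_numE//.
    by rewrite integral_cst.
  apply: ae_ge0_le_integral => //.
  + by apply/measurable_EFinP; apply: measurableT_comp => //; exact: measurable_funTS.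
  + by move=> x _; rewrite lee_fin.
  + by apply: filterS MP => x Fx _; rewrite lee_fin (le_trans Fx)// ler_norm.
Qed.

Lemma Rintegral_sum_mul (I : Type) (r : seq I) (F G : I -> T -> R) :
  (forall i, L2 mu (F i)) -> (forall i, L2 mu (G i)) ->
  \int[mu]_x (\sum_(i <- r) F i x * G i x) = \sum_(i <- r) ip mu (F i) (G i).
Proof.
move=> F2 G2; elim: r => [|i r IH].
  by under eq_Rintegral do rewrite big_nil; rewrite big_nil Rintegral_cst// mul0r.
under eq_Rintegral do rewrite big_cons; rewrite big_cons -IH RintegralD//.
- exact: L2M.
- rewrite (_ : EFin \o _ = fun x => (\sum_(j <- r) (F j x * G j x)%:E)%E); last first.
    by apply/funext => x /=; rewrite sumEFin.
  by apply: (integrable_sum measurableT) => j _; exact: L2M.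
Qed.

Lemma Rintegral_weight (F sw U W : T -> R) : measurable_fun setT F ->
  measurable_fun setT sw -> measurable_fun setT U -> measurable_fun setT W ->
  {ae mu, forall x, F x = sw x ^+ 2} ->
  \int[mu]_x (F x * U x * W x) = ip mu (fun x => sw x * U x) (fun x => sw x * W x).
Proof.
move=> mF msw mU mW Fsw; congr fine; apply: ae_eq_integral => //.
- by apply/measurable_EFinP; apply: measurable_funM => //; exact: measurable_funM.
- by apply/measurable_EFinP; apply: measurable_funM => //; exact: measurable_funM.
- by apply: filterS Fsw => x -> _; congr EFin; ring.
Qed.

Lemma ae_impl (P Q : T -> Prop) : {ae mu, forall x, P x} -> (forall x, P x -> Q x) ->
  {ae mu, forall x, Q x}.
Proof. by move=> aP PQ; exact: filterS aP. Qed.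

Lemma sqnorm_ae0 (F : T -> R) : measurable_fun setT F -> {ae mu, forall x, F x = 0} ->
  sqnorm mu F = 0.
Proof.
move=> mF F0; have m0 : measurable_fun setT (fun _ : T => 0 : R) by exact: measurable_cst.
rewrite /sqnorm (ip_ae_eq mF mF m0 m0 F0 F0) /ip.
by under eq_Rintegral do rewrite mulr0; rewrite Rintegral_cst// mul0r.
Qed.

End Lfun_local_bound.

Section weight.
Variables (R : realType) (N : nat) (Omega : set 'rV[R]_N).
Notation V := 'rV[R]_N.
Notation leb := (@leb R N).
Notation test := (test_function Omega).
Notation sqnorm := (sqnorm leb).

(** The power [1 - t] of a volume [v / 2^(N j)] brings [2^(- N j)] and [(2^(N t))^j]; the latter is
    written as [(4 * (b / 4))^j] with [b = 2^(N t)] to match the decay required by the dyadic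
    estimate. *)
Lemma cube_pow_bound (C t l : R) j : 0 < l -> 0 < cube_volume N l ->
  C * cube_volume N (l / 2 ^+ j) `^ (1 - t) =
  C * (cube_volume N l / cube_volume N l `^ t) * (4 * (2 `^ (N%:R * t) / 4)) ^+ j / (2 ^+ N) ^+ j.
Proof.
move=> l0 v0; rewrite cube_volume_dyadic//; set v := cube_volume N l in v0 *.
have n0 : (0 : R) < (2 ^+ N) ^+ j by rewrite !exprn_gt0.
have vj : 0 < v / (2 ^+ N) ^+ j by exact: divr_gt0.
rewrite powRB; last by apply/implyP => _; rewrite gt_eqF.
rewrite powRr1 ?ltW// powRM ?invr_ge0 ?ltW//.
have -> : (((2 : R) ^+ N) ^+ j)^-1 `^ t = ((2 `^ (N%:R * t)) ^+ j)^-1.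
  have e : ((2 : R) ^+ N) ^+ j = 2 `^ (N%:R * j%:R) by rewrite -exprM -natrM powR_mulrn.
  rewrite e -powR_inv1 ?powR_ge0// -!powRrM -[RHS]powR_inv1 ?exprn_ge0 ?powR_ge0//.
  rewrite -powR_mulrn ?powR_ge0// -!powRrM; congr (_ `^ _); ring.
rewrite [4 * _]mulrC divfK ?pnatr_eq0//.
have b0 : 0 < (2 `^ (N%:R * t)) ^+ j :> R by rewrite exprn_gt0// powR_gt0.
have w0 : 0 < v `^ t by rewrite powR_gt0.
by field; rewrite !gt_eqF.
Qed.

Hypothesis Omega_open : open Omega.
Hypothesis Omega_bounded : bounded_set Omega.

Lemma bounded_coord : exists2 a : R, 0 < a & forall x i, Omega x -> `|x ord0 i| < a.
Proof.
have [M [_ MP]] := Omega_bounded; exists (`|M| + 2); first by rewrite ltr_wpDl.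
move=> x i Ox; apply: (le_lt_trans (ler_coord_norm x i)).
apply: (@le_lt_trans _ _ (`|M| + 1)); last by rewrite ltrD2l ltr1n.
apply: (MP (`|M| + 1)) => //; apply: (le_lt_trans (ler_norm M)).
by rewrite ltrDl.
Qed.

Let mO : measurable (Omega : set (lebspace R N)).
Proof. exact: open_measurable_rV. Qed.

Let Ofin : (leb Omega < +oo)%E.
Proof. exact: lebesgue_outer_bounded. Qed.

Variable F : V -> R.
Hypothesis F_out : forall x, ~ Omega x -> F x = 0.
Variable q : \bar R.
Hypothesis N_ge3 : (3 <= N)%N.
Hypothesis hq : ((N%:R / 2)%:E < q)%E.
Hypothesis F_Lq : (F : lebspace R N -> R) \in Lfun leb q.
Hypothesis F_neq0 : ~ {ae leb, forall x : lebspace R N, F x = 0}.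

Let wf x := `|F x|.
(** The absolute value gives a square root at every point, whereas [f] is nonnegative only almost
    everywhere. *)
Definition weight_sqrt (x : V) : R := Num.sqrt `|F x|.
Notation sw := weight_sqrt.

Lemma sqr_weight_sqrt x : sw x ^+ 2 = `|F x|.
Proof. by rewrite sqr_sqrtr. Qed.

Let mF : measurable_fun setT (F : lebspace R N -> R).
Proof. by have := sub_Lfun_mfun F_Lq; rewrite inE. Qed.

Lemma weight_sqrt_measurable : measurable_fun setT (sw : lebspace R N -> R).
Proof.
apply: (measurableT_comp (f := @Num.sqrt R)); last exact: measurableT_comp mF.
by apply: continuous_measurable_fun; exact: sqrt_continuous.
Qed.

Let local_bound : exists C t : R, [/\ 0 <= C, 0 <= t, t < (N%:R / 2)^-1 &
  forall A : set (lebspace R N), measurable A -> (leb A < +oo)%E ->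
    (\int[leb]_(x in A) `|F x|%:E <= (C * fine (leb A) `^ (1 - t))%:E)%E].
Proof.
apply: (Lfun_local_bound (c := N%:R / 2) _ hq F_Lq).
by rewrite ltr_pdivlMr// mul1r ltr_nat.
Qed.

Lemma weight_integrable : leb.-integrable setT (EFin \o (wf : lebspace R N -> R)).
Proof.
have [C [t [C0 t0 tN CP]]] := local_bound.
apply/integrableP; split.
  by apply/measurable_EFinP; apply: measurableT_comp mF.
have -> : (\int[leb]_x `|(EFin \o (wf : lebspace R N -> R)) x|)%E =
    (\int[leb]_(x in Omega) `|F x|%:E)%E.
  rewrite [RHS]integral_mkcond; apply: eq_integral => x _.
  rewrite /patch /wf /= normr_id; case: ifPn => // /negP xO.
  by rewrite F_out ?normr0// => Ox; apply: xO; rewrite inE.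
exact: le_lt_trans (CP Omega mO Ofin) (ltry _).
Qed.

Lemma weight_test phi : test phi -> L2 leb ((fun x => sw x * phi x) : lebspace R N -> R).
Proof.
move=> tphi; split.
  exact: (measurable_funM weight_sqrt_measurable (test_measurable tphi)).
have := wf_sqr_integrable weight_integrable 0 tphi; congr (_.-integrable _ _).
by apply/funext => x /=; rewrite exprMn sqr_weight_sqrt subr0.
Qed.

Lemma weight_poincare : exists2 CP : R, 0 <= CP & forall phi, test phi ->
  sqnorm phi <= CP * energy (fun i => partial i phi) (fun i => partial i phi).
Proof.
have [a a0 aP] := bounded_coord; have N0 : (0 < N)%N by exact: leq_trans N_ge3.
exists (16 * a ^+ 2) => [|phi tphi]; first by rewrite mulr_ge0 ?sqr_ge0.
pose i : 'I_N := Ordinal N0.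
apply: le_trans (poincare mO Ofin a0 (fun x => aP x i) tphi) _.
apply: ler_wpM2l; first by rewrite mulr_ge0 ?sqr_ge0.
rewrite /energy (bigD1 i)//= lerDl; apply: sumr_ge0 => j _; exact: ip_ge0.
Qed.

Lemma weight_compact (eta : R) : 0 < eta -> exists (C : R) (n : nat) (chi : 'I_n -> V -> R),
  [/\ 0 <= C, forall k, L2 leb (chi k : lebspace R N -> R) &
  forall phi, test phi -> sqnorm (fun x => sw x * phi x) <=
    eta * energy (fun i => partial i phi) (fun i => partial i phi) +
    C * \sum_k (ip leb (chi k) phi) ^+ 2].
Proof.
move=> eta0; have [a a0 aP] := bounded_coord.
have [C [t [C0 t0 tN CP]]] := local_bound.
pose l0 := 2 * a; have l0_gt0 : 0 < l0 by exact: mulr_gt0.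
pose p0 : V := const_mx (- a).
have OQ : Omega `<=` cube p0 l0.
  move=> x Ox i; have := aP x i Ox; rewrite ltr_norml mxE => /andP[/ltW -> /=].
  by move=> xa; rewrite /l0 mulr_natl mulr2n addrA addNr add0r.
(* If the cube containing [Omega] were null, [F] would vanish almost everywhere. *)
have v0 : 0 < cube_volume N l0.
  rewrite lt_neqAle cube_volume_ge0 andbT eq_sym; apply/eqP => v0.
  apply: F_neq0; apply/ae_lebP; apply/eqP; rewrite eq_le lebesgue_outer_ge0 andbT.
  have <- : leb (cube p0 l0) = 0%E by rewrite cube_volumeE v0.
  apply: le_lebesgue_outer => x /= Fx; apply: OQ.
  by have [//|/F_out] := pselect (Omega x).
pose b := 2 `^ (N%:R * t) : R; have b_gt0 : 0 < b by exact: powR_gt0.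
(* The place where q > N/2 acts: [t < 2 / N] means [2^(N t) < 4], that is, decay in the dyadic
   estimate. *)
have b4 : b < 4.
  have -> : (4 : R) = 2 `^ 2%:R by rewrite powR_mulrn// expr2; lra.
  have N0 : (0 : R) < N%:R by rewrite ltr0n; exact: leq_trans N_ge3.
  rewrite /b /powR (gt_eqF (@ltr0Sn R 1)) ltr_expR ltr_pM2r; last by rewrite ln_gt0// ltr1n.
  by move: tN; rewrite invf_div ltr_pdivlMr// mulrC.
(* The dyadic estimate wants a ratio of at least 1/2; enlarging [b / 4] only weakens the bound. *)
pose th := Num.max 2^-1 (b / 4).
have th_bounds : 2^-1 <= th < 1.
  by rewrite /th le_max lexx/= gt_max; apply/andP; split; lra.
pose K := C * (cube_volume N l0 / cube_volume N l0 `^ t).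
have K0 : 0 <= K by rewrite mulr_ge0// divr_ge0 ?powR_ge0// ltW.
have wf_cube j p : \int[leb]_(x in cube p (l0 / 2 ^+ j)) wf x <= K * (4 * th) ^+ j / (2 ^+ N) ^+ j.
  have := CP _ (cube_measurable p (l0 / 2 ^+ j)) (cube_finite p _).
  rewrite cube_volumeE /= cube_pow_bound// -/b -/K => h.
  apply: (@le_trans _ _ (K * (4 * (b / 4)) ^+ j / (2 ^+ N) ^+ j)).
    rewrite -lee_fin; apply: le_trans (h); rewrite /Rintegral fineK//.
    rewrite ge0_fin_numE; last by apply: integral_ge0 => x _; rewrite lee_fin /wf.
    exact: le_lt_trans h (ltry _).
  apply: ler_wpM2r; first by rewrite invr_ge0 !exprn_ge0.
  apply: ler_wpM2l => //; rewrite lerXn2r// ?nnegrE.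
  - by rewrite mulr_ge0// divr_ge0// ltW.
  - by case/andP: th_bounds => h1 _; rewrite mulr_ge0//; lra.
  - by apply: ler_wpM2l => //; rewrite /th le_max lexx orbT.
have wf0 x : 0 <= wf x by exact: normr_ge0.
have [D [s [D0 sP]]] := compact_estimate wf0 weight_integrable l0_gt0 v0 K0 th_bounds wf_cube OQ eta0.
pose chi (k : 'I_(size s)) : V -> R :=
  \1_(cube (tnth (in_tuple s) k).1 (tnth (in_tuple s) k).2 : set V).
exists D, (size s), chi; split => // [k|phi tphi]; first exact: cube_indic_L2.
rewrite (test_energy tphi); have := sP phi tphi; rewrite big_tnth; congr (_ <= _).
by apply: eq_Rintegral => x _; rewrite /wf -sqr_weight_sqrt; ring.
Qed.

End weight.

(** * The Rayleigh inequality for the first positive eigenvalue *)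

Section first_eigenvalue.
Variables (R : realType) (N : nat) (Omega : set 'rV[R]_N).
Notation V := 'rV[R]_N.
Notation leb := (@leb R N).
Notation sqnorm := (sqnorm leb).
Hypothesis N_ge3 : (3 <= N)%N.
Hypothesis Omega_open : open Omega.
Hypothesis Omega_bounded : bounded_set Omega.
Variables (f : V -> R) (q : \bar R).
Hypothesis hq : ((N%:R / 2)%:E < q)%E.
Hypothesis f_Lq : in_Lp Omega q f.
Hypothesis f_ge0 : ae_in Omega (fun x => 0 <= f x).
Hypothesis f_neq0 : ~ ae_in Omega (fun x => f x = 0).
Notation sw := (weight_sqrt (f \_ Omega)).

Let mO : measurable (Omega : set (lebspace R N)).
Proof. exact: open_measurable_rV. Qed.

Let F_out x : ~ Omega x -> (f \_ Omega) x = 0.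
Proof. by move=> xO; rewrite /patch; case: ifPn => //; rewrite inE. Qed.

Let F_neq0 : ~ {ae leb, forall x : lebspace R N, (f \_ Omega) x = 0}.
Proof.
apply: contra_not f_neq0; apply: filterS => x.
by rewrite /patch; case: ifPn => // /negP xO _ /mem_set.
Qed.

Lemma weight_sqrt_patch U : (fun x => sw x * (U \_ Omega) x) = (fun x => sw x * U x).
Proof.
apply/funext => x; have [Ox|xO] := pselect (Omega x); first by rewrite /patch mem_set.
by rewrite /weight_sqrt F_out// normr0 sqrtr0 !mul0r.
Qed.

Lemma weight_ip (U W : V -> R) : measurable_fun setT (U \_ Omega : lebspace R N -> R) ->
  measurable_fun setT (W \_ Omega : lebspace R N -> R) ->
  \int[leb]_(x in Omega) (f x * U x * W x) =
  ip leb (fun x => sw x * U x) (fun x => sw x * W x).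
Proof.
move=> mU mW; rewrite -(weight_sqrt_patch U) -(weight_sqrt_patch W).
have mF : measurable_fun setT (f \_ Omega : lebspace R N -> R).
  by have := sub_Lfun_mfun f_Lq; rewrite inE.
have msw := weight_sqrt_measurable f_Lq.
rewrite Rintegral_mkcond.
have -> : ((fun x => f x * U x * W x) \_ Omega) =
    (fun x => (f \_ Omega) x * (U \_ Omega) x * (W \_ Omega) x).
  by apply/funext => x; rewrite /patch; case: ifPn => //; rewrite mulr0.
apply: (Rintegral_weight mF msw mU mW); apply: (ae_impl f_ge0) => x fx.
rewrite sqr_weight_sqrt ger0_norm// /patch; case: ifPn => //.
by rewrite inE => /fx.
Qed.

Lemma energy_components (Du Dv : V -> 'cV[R]_N) : (forall i, L2 leb (components Omega Du i)) ->
  (forall i, L2 leb (components Omega Dv i)) ->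
  \int[leb]_(x in Omega) dot (Du x) (Dv x) = energy (components Omega Du) (components Omega Dv).
Proof.
move=> Du2 Dv2; rewrite Rintegral_mkcond.
have -> : ((fun x => dot (Du x) (Dv x)) \_ Omega) =
    (fun x => \sum_i components Omega Du i x * components Omega Dv i x).
  apply/funext => x; rewrite /components /patch /dot; case: ifPn => // _.
  by rewrite big1// => i _; rewrite mulr0.
exact: (Rintegral_sum_mul _ Du2 Dv2).
Qed.

(** The maximizer makes [S^-1] a positive eigenvalue, so [lambda1 <= S^-1], and the inequality with
    constant [S] becomes the one with [lambda1]. *)
Lemma first_eigenvalue_rayleigh lambda1 U G : first_positive_eigenvalue Omega f lambda1 ->
  H10fun Omega U G ->
  L2 leb ((fun x => sw x * U x) : lebspace R N -> R) /\
  lambda1 * sqnorm (fun x => sw x * U x) <= energy G G.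
Proof.
move=> [l0 _ lmin] HUG.
have [CP CP0 poin] := weight_poincare Omega_open Omega_bounded N_ge3.
have [S [SP Seig]] := rayleigh_attained (weight_sqrt_measurable f_Lq)
  (fun phi => @weight_test _ _ _ Omega_open Omega_bounded _ F_out _ N_ge3 hq f_Lq phi) CP0 poin
  (weight_compact Omega_open Omega_bounded F_out N_ge3 hq f_Lq F_neq0).
have [swU2 swUle] := SP U G HUG; split => //.
have sq0 : 0 <= sqnorm (fun x => sw x * U x) by exact: ip_ge0.
have E0 : 0 <= energy G G by apply: sumr_ge0 => i _; exact: ip_ge0.
have [S0|S0] := lerP S 0.
  have -> : sqnorm (fun x => sw x * U x) = 0.
    by apply/eqP; rewrite eq_le sq0 andbT (le_trans swUle)// mulr_le0_ge0.
  by rewrite mulr0.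
suff lS : lambda1 <= S^-1.
  apply: le_trans (ler_wpM2l (ltW l0) swUle) _.
  rewrite mulrA; apply: ler_piMl => //.
  by rewrite -ler_pdivlMr// mul1r.
apply: lmin; first by rewrite invr_gt0.
have [W [H [HWH WS EL]]] := Seig S0.
have HW := H10_H10fun mO HWH.
exists W, (fun x => \col_i H i x); split => //.
  (* The eigenfunction is not trivial, because its weighted norm is [S > 0]. *)
  move=> W0; have : S = 0; last by move=> S00; rewrite S00 ltxx in S0.
  rewrite -WS; apply: sqnorm_ae0; first exact: (SP _ _ HWH).1.1.
  apply: (ae_impl W0) => x Wx; have [/Wx ->|xO] := pselect (Omega x); first by rewrite mulr0.
  by rewrite /weight_sqrt F_out// normr0 sqrtr0 mul0r.
move=> v Dv /H10P Hv; have /H10P [W2 D2 _] := HW; have [v2 Dv2 _] := Hv.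
rewrite (energy_components D2 Dv2) (weight_ip W2.1 v2.1).
have := EL _ _ Hv; rewrite weight_sqrt_patch => ->; rewrite mulKf ?gt_eqF//.
apply: eq_bigr => i _; apply: eq_Rintegral => x _; rewrite /components /patch.
by case: ifPn => _; rewrite ?mulr0// mxE.
Qed.

End first_eigenvalue.

(** * Chain rule in H^1_0 *)

Section bernstein.
Variable R : realType.

(** Compactness of [[a, b]] gives a common radius; only [x] is confined to the interval, and [y] may
    lie outside. *)
Lemma unif_continuous_itv (f : R -> R) (a b e : R) : continuous f -> 0 < e ->
  exists2 d : R, 0 < d & forall x y, a <= x <= b -> `|x - y| < d -> `|f x - f y| <= e.
Proof.
move=> cf e0.
pose P (d x : R) := forall y, `|x - y| < d -> `|f x - f y| <= e.
have /compact_near_coveringP cK : compact `[a, b]%classic by exact: segment_compact.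
have H : \forall d \near (0 : R)^'+, `[a, b]%classic `<=` P d.
  apply: cK => x _.
  have e2 : 0 < e / 2 by exact: divr_gt0.
  have /cvgrPdist_lt/(_ _ e2) /nbhs_ballP[r /= r0 rP] := cf x.
  have r2 : 0 < r / 2 by exact: divr_gt0.
  exists (ball x (r / 2), [set d | d < r / 2]).
    by split; [exact: nbhsx_ballx | exact: nbhs_right_lt].
  move=> [z d] /= [xz dr] y zy.
  have h1 : `|f x - f z| < e / 2 by apply: rP; apply: le_ball xz; lra.
  have h2 : `|f x - f y| < e / 2.
    apply: rP; rewrite /ball/=; move: xz; rewrite /ball/= => xz.
    have -> : x - y = (x - z) + (z - y) by ring.
    by apply: le_lt_trans (ler_normD _ _) _; lra.
  have -> : f z - f y = (f x - f y) - (f x - f z) by ring.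
  by apply: le_trans (ler_normB _ _) _; lra.
have [d [d0 dP]] := filter_ex (filterI (nbhs_right_gt 0) H).
by exists d => // x y xab; apply: dP; rewrite /= in_itv.
Qed.

(** Bernstein's operator, by conditioning on the first of the [n] trials; this recursion avoids
    binomial coefficients. *)
Fixpoint bern n (phi : nat -> R) : {poly R} :=
  if n is m.+1 then 'X * bern m (phi \o succn) + (1 - 'X) * bern m phi
  else (phi 0%N)%:P.

(* [(bern n phi).[x]] is the mean of [phi] at a binomial variable of parameters
   [n] and [x], whose second moment about [c] is [(n x - c)^2 + n x (1 - x)]. *)
Lemma bern_dist n (phi : nat -> R) (v e K c x : R) : 0 <= x <= 1 -> 
  (forall k : nat, `|phi k - v| <= e + K * (k%:R - c) ^+ 2) ->
  `|(bern n phi).[x] - v| <= e + K * ((n%:R * x - c) ^+ 2 + n%:R * x * (1 - x)).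
Proof.
move=> /andP[x0 x1]; elim: n phi c => [|n IH] phi c h /=.
  by rewrite hornerC; have := h 0%N; rewrite !mul0r addr0.
(* After a success the remaining trials count from 1, so the centre is shifted. *)
have hA := IH (phi \o succn) (c - 1).
have {}hA : `|(bern n (phi \o succn)).[x] - v| <= e + K * ((n%:R * x - (c - 1)) ^+ 2 + n%:R * x * (1 - x)).
  apply: hA => k /=; apply: le_trans (h k.+1) _.
  by rewrite -natr1 (_ : k%:R - (c - 1) = k%:R + 1 - c)//; ring.
have hB := IH phi c h; rewrite !hornerE.
set A := (bern _ _).[x] in hA *; set B := (bern _ _).[x] in hB *.
have -> : x * A + (1 - x) * B - v = x * (A - v) + (1 - x) * (B - v) by ring.
apply: le_trans (ler_normD _ _) _; rewrite !normrM (ger0_norm x0) (ger0_norm (_ : 0 <= 1 - x)) ?subr_ge0//.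
apply: le_trans (lerD (ler_wpM2l x0 hA) (ler_wpM2l _ hB)) _; first by rewrite subr_ge0.
by rewrite -natr1 le_eqVlt; apply/orP; left; apply/eqP; ring.
Qed.

(** Chebyshev's argument: [|f y - f x|] is at most [e / 2 + K (y - x)^2] for all [y], and the
    binomial mean of the quadratic term is of order [1 / n]. *)
Lemma weierstrass (f : R -> R) (M B e : R) : continuous f -> (forall x, `|f x| <= M) ->
  0 < B -> 0 < e -> exists p : {poly R}, forall x, `|x| <= B -> `|p.[x] - f x| <= e.
Proof.
move=> cf fM B0 e0; have e2 : 0 < e / 2 by exact: divr_gt0.
have M0 : 0 <= M by exact: le_trans (normr_ge0 _) (fM 0).
have [d d0 dP] := unif_continuous_itv (- B) B cf e2.
(* At distance [d] or more the trivial bound [2 M] is below [K (y - x)^2]. *)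
pose K := 2 * M / d ^+ 2; have K0 : 0 <= K by rewrite divr_ge0 ?sqr_ge0// mulr_ge0.
have fK x y : `|x| <= B -> `|f y - f x| <= e / 2 + K * (y - x) ^+ 2.
  move=> xB; have [xy|xy] := ltP `|x - y| d.
    rewrite distrC; apply: (@le_trans _ _ (e / 2)); first by apply: dP => //; rewrite -ler_norml.
    by rewrite lerDl mulr_ge0// sqr_ge0.
  have h1 : `|f y - f x| <= 2 * M.
    by apply: le_trans (ler_normB _ _) _; rewrite mulr_natl mulr2n; exact: lerD.
  have h2 : 2 * M <= K * (y - x) ^+ 2.
    rewrite /K mulrAC -mulrA ler_peMr ?mulr_ge0// ler_pdivlMr ?exprn_gt0// mul1r.
    by rewrite -(sqr_normr (y - x)) distrC ler_sqr ?nnegrE// ltW.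
  by apply: (le_trans (le_trans h1 h2)); rewrite lerDr ltW.
have KB0 : 0 <= 4 * K * B ^+ 2 by apply: mulr_ge0; [exact: mulr_ge0 | exact: sqr_ge0].
have D0 : 0 < 4 * K * B ^+ 2 + 1 by rewrite ltr_wpDl.
have [n0 /(_ n0 (leqnn n0)) n0P] := cvg0_le (@cvg_harmonic R) (divr_gt0 e2 D0).
have n_gt0 : (0 : R) < n0.+1%:R by rewrite ltr0n.
move: n0.+1 n0P n_gt0 => n n0P n_gt0.
(* The nodes [k / n] are carried from [[0, 1]] to [[- B, B]]; the composition below is the inverse
   change of variable. *)
pose phi (k : nat) := f (2 * B * (k%:R / n%:R) - B).
exists (bern n phi \Po ((2 * B)^-1 *: 'X + (2^-1)%:P)) => x xB.
pose t := (2 * B)^-1 * x + 2^-1.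
have xt : x = 2 * B * t - B by rewrite /t; field; rewrite gt_eqF.
have t01 : 0 <= t <= 1.
  move: xB; rewrite ler_norml => /andP[x1 x2]; rewrite xt in x1 x2.
  by apply/andP; split; rewrite -(ler_pM2l B0); lra.
rewrite horner_comp hornerD hornerZ hornerX hornerC -/t.
have h k : `|phi k - f x| <= e / 2 + (4 * K * B ^+ 2 / n%:R ^+ 2) * (k%:R - n%:R * t) ^+ 2.
  apply: le_trans (fK x _ xB) _; rewrite lerD2l {1}xt.
  by rewrite le_eqVlt; apply/orP; left; apply/eqP; field; rewrite gt_eqF.
(* Centred at [c = n t], the second moment reduces to the variance [n t (1 - t)]. *)
apply: le_trans (bern_dist n t01 h) _.
rewrite subrr expr0n add0r; case/andP: t01 => t0 t1.
have tt : t * (1 - t) <= 1 by nra.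
have -> : 4 * K * B ^+ 2 / n%:R ^+ 2 * (n%:R * t * (1 - t)) = 4 * K * B ^+ 2 * n%:R^-1 * (t * (1 - t)).
  by field; rewrite gt_eqF.
have c0 : 0 <= 4 * K * B ^+ 2 * n%:R^-1 by apply: mulr_ge0 => //; rewrite invr_ge0 ltW.
have : 4 * K * B ^+ 2 * n%:R^-1 * (t * (1 - t)) <= 4 * K * B ^+ 2 * n%:R^-1.
  by rewrite -[leRHS]mulr1; exact: ler_wpM2l.
have : 4 * K * B ^+ 2 * n%:R^-1 <= e / 2.
  move: n0P; rewrite ler_pdivlMr// mulrC mulrDl mul1r; apply: le_trans.
  by rewrite lerDl invr_ge0 ltW.
lra.
Qed.

Lemma poly_primitive (p : {poly R}) : exists q : {poly R}, q^`() = p /\ q.[0] = 0.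
Proof.
exists (\poly_(i < (size p).+1) (if i is j.+1 then p`_j / j.+1%:R else 0)); split.
  apply/polyP => i; rewrite coef_deriv coef_poly ltnS.
  case: ltnP => ip; last by rewrite mul0rn nth_default.
  by rewrite -[_ *+ _]mulr_natr divfK// pnatr_eq0.
by rewrite horner_coef0 coef_poly.
Qed.

Lemma derive_bounded_lipschitz (F F' : R -> R) (a b e : R) :
  (forall x : R, is_derive x (1 : R) F (F' x)) -> (forall x, a <= x <= b -> `|F' x| <= e) ->
  forall x y, a <= x <= b -> a <= y <= b -> `|F x - F y| <= e * `|x - y|.
Proof.
move=> dF Fe.
have cF : continuous F by move=> x; apply: differentiable_continuous; apply/derivable1_diffP; case: (dF x).
have aux x y : x < y -> a <= x <= b -> a <= y <= b -> `|F y - F x| <= e * `|y - x|.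
  move=> xy /andP[ax xb] /andP[ay yb].
  have [|c0 cxy ->] := MVT xy (fun z _ => dF z).
    by apply: continuous_subspaceT => z; exact: cF.
  rewrite normrM; apply: ler_wpM2r => //; apply: Fe; move: cxy; rewrite in_itv/=.
  by move=> /andP[c1 c2]; apply/andP; split; lra.
move=> x y xab yab; have [xy|yx|->] := ltgtP x y.
- by rewrite distrC [`|x - y|]distrC; exact: aux.
- exact: aux.
- by rewrite !subrr normr0 mulr0.
Qed.

Section C1_approximation.
Variables (G g : R -> R) (L : R).
Hypothesis dG : forall x : R, is_derive x (1 : R) G (g x).
Hypothesis cg : continuous g.
Hypothesis gL : forall x, `|g x| <= L.
Hypothesis G0 : G 0 = 0.

Lemma C1_continuous : continuous G.
Proof. by move=> x; apply: differentiable_continuous; apply/derivable1_diffP; case: (dG x). Qed.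

Lemma C1_lipschitz x y : `|G x - G y| <= L * `|x - y|.
Proof.
apply: (@derive_bounded_lipschitz G g (Num.min x y) (Num.max x y) L dG) => [z _| |].
- exact: gL.
- by rewrite ge_min le_max lexx.
- by rewrite ge_min le_max lexx !orbT.
Qed.

(** The derivative is approximated and then integrated from 0. The resulting error, proportional to
    [|x|], turns into an L^2 error controlled by the norm of the inner function. *)
Lemma C1_poly_approx (B e : R) : 0 < B -> 0 < e -> exists Q : {poly R},
  [/\ Q.[0] = 0, forall x, `|x| <= B -> `|Q^`().[x] - g x| <= e &
  forall x, `|x| <= B -> `|Q.[x] - G x| <= e * `|x|].
Proof.
move=> B0 e0; have [p pP] := weierstrass cg gL B0 e0.
have [Q [Qp Q0]] := poly_primitive p; exists Q; split; rewrite ?Qp// => x xB.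
have dF (z : R) : is_derive z (1 : R) (fun z => Q.[z] - G z) (p.[z] - g z).
  rewrite -Qp; apply: is_deriveB.
have h : forall z, - B <= z <= B -> `|p.[z] - g z| <= e by move=> z zB; apply: pP; rewrite ler_norml.
have := @derive_bounded_lipschitz _ _ (- B) B e dF h x 0.
rewrite Q0 G0 !subr0 -ler_norml xB; apply => //; apply/andP; split; lra.
Qed.

End C1_approximation.
End bernstein.

Section L2_composition.
Context d (T : measurableType d) (R : realType) (mu : {measure set T -> \bar R}).
Notation sqnorm := (sqnorm mu).
Notation L2cvg := (L2cvg mu).

Lemma sqnorm_le_scale (F H : T -> R) (c : R) : L2 mu F -> L2 mu H ->
  (forall x, `|F x| <= c * `|H x|) -> sqnorm F <= c ^+ 2 * sqnorm H.
Proof.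
move=> F2 H2 FH; rewrite /sqnorm -(ip_sqrZ c H2).
apply: (le_Rintegral measurableT (L2M F2 F2) (L2M (L2Z c H2) (L2Z c H2))) => x _.
rewrite -!expr2 -sqr_normr exprMn -(sqr_normr (H x)) -exprMn.
by rewrite ler_sqr ?nnegrE ?normr_ge0//; exact: le_trans (normr_ge0 _) (FH x).
Qed.

Lemma sqnorm_scale_cvg0 (F_ H_ : nat -> T -> R) (c : nat -> R) : (forall n, L2 mu (F_ n)) ->
  (forall n, L2 mu (H_ n)) -> (forall n x, `|F_ n x| <= c n * `|H_ n x|) ->
  c n ^+ 2 * sqnorm (H_ n) @[n --> \oo] --> 0 ->
  sqnorm (F_ n) @[n --> \oo] --> 0.
Proof.
move=> F2 H2 FH; apply: squeeze_cvg0 => n; first exact: ip_ge0.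
exact: sqnorm_le_scale.
Qed.

Let harm2 (a : nat -> R) (l : R) : a n @[n --> \oo] --> l ->
  (n.+1%:R^-1 : R) ^+ 2 * a n @[n --> \oo] --> 0.
Proof.
move=> al; rewrite (_ : (0 : R) = 0 * 0 * l); last by rewrite !mul0r.
by apply: cvgM => //; apply: cvgM; exact: cvg_harmonic.
Qed.

Variables (G g : R -> R) (L : R).
Hypothesis dG : forall x : R, is_derive x (1 : R) G (g x).
Hypothesis cg : continuous g.
Hypothesis gL : forall x, `|g x| <= L.
Hypothesis G0 : G 0 = 0.

Let L0 : 0 <= L := le_trans (normr_ge0 _) (gL 0).

Lemma measurable_comp_continuous (k : R -> R) (F : T -> R) : continuous k ->
  measurable_fun setT F -> measurable_fun setT (k \o F).
Proof.
by move=> ck mF; apply: measurableT_comp mF; exact: continuous_measurable_fun.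
Qed.

Lemma L2_comp (F : T -> R) : L2 mu F -> L2 mu (G \o F).
Proof.
move=> F2; apply: (L2_le _ (L2Z L F2)).
  exact: measurable_comp_continuous (C1_continuous dG) F2.1.
move=> x /=; have := C1_lipschitz dG gL (F x) 0; rewrite G0 !subr0 => h.
rewrite -sqr_normr exprMn -(sqr_normr (F x)) -exprMn ler_sqr ?nnegrE ?normr_ge0//.
exact: le_trans (normr_ge0 _) h.
Qed.

Lemma L2cvg_comp (phi psi : nat -> T -> R) (U : T -> R) : (forall n, L2 mu (phi n)) ->
  (forall n, L2 mu (psi n)) -> L2 mu U -> L2cvg phi U ->
  (forall n x, `|psi n x - G (phi n x)| <= n.+1%:R^-1 * `|phi n x|) ->
  L2cvg psi (G \o U).
Proof.
move=> phi2 psi2 U2 cphi near.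
have G2 n := L2_comp (phi2 n); have GU2 := L2_comp U2.
have A2 n := L2B (psi2 n) (G2 n); have B2 n := L2B (G2 n) GU2.
have cA : sqnorm (fun x => psi n x - (G \o phi n) x) @[n --> \oo] --> 0.
  apply: (sqnorm_scale_cvg0 A2 phi2 near).
  exact: (harm2 (L2cvg_sqnorm phi2 U2 cphi)).
have cB : sqnorm (fun x => (G \o phi n) x - (G \o U) x) @[n --> \oo] --> 0.
  apply: (sqnorm_scale_cvg0 (c := fun=> L) B2 (fun n => L2B (phi2 n) U2)).
    by move=> n x; exact: C1_lipschitz.
  by rewrite -(mulr0 (L ^+ 2)); apply: cvgM; [exact: cvg_cst | exact: cphi].
have := sqnormD_cvg0 A2 B2 cA cB.
by apply: cvg_ext => n; congr sqnorm; apply/funext => x; ring.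
Qed.

(** Dominated convergence, with dominating function [c^2 D^2]. *)
Lemma sqnorm_mul_cvg0 (m : nat -> T -> R) (D : T -> R) (c : R) : L2 mu D ->
  (forall n, measurable_fun setT (m n)) -> (forall n x, `|m n x| <= c) ->
  {ae mu, forall x, m n x @[n --> \oo] --> 0} ->
  sqnorm (fun x => m n x * D x) @[n --> \oo] --> 0.
Proof.
move=> D2 mm mc m0; have c0 : 0 <= c by exact: le_trans (normr_ge0 _) (mc 0%N point).
pose f_ n x := (m n x * D x * (m n x * D x))%:E.
have cf : {ae mu, forall x, setT x -> f_ n x @[n --> \oo] --> (0 : R)%:E}.
  apply: filterS m0 => x mx _; apply: cvg_EFin; first exact: nearW.
  rewrite -[X in _ --> X](mulr0 (0 * D x)).
  have h : m n x * D x @[n --> \oo] --> 0 * D x by apply: cvgM => //; exact: cvg_cst.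
  by rewrite -{2}(mul0r (D x)); exact: cvgM.
have bnd : {ae mu, forall x, forall n : nat, setT x -> (`|f_ n x| <= (c ^+ 2 * (D x ^+ 2))%:E)%E}.
  apply: nearW => x n _; rewrite /f_ -expr2 exprMn gee0_abs; last by rewrite lee_fin mulr_ge0// sqr_ge0.
  rewrite lee_fin; apply: ler_wpM2r; first exact: sqr_ge0.
  by rewrite -(sqr_normr (m n x)) ler_sqr ?nnegrE ?normr_ge0//; exact: mc.
have intg : mu.-integrable setT (fun x => (c ^+ 2 * (D x ^+ 2))%:E).
  exact: (integrable_EFinZ measurableT (c ^+ 2) D2.2).
have mf n : measurable_fun setT (f_ n).
  apply/measurable_EFinP; have mD := measurable_funM (mm n) D2.1.
  exact: measurable_funM.
have [_ _ h] := dominated_convergence measurableT mf (measurable_cst 0%E) cf intg bnd.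
rewrite integral0 in h.
by have h' := fine_cvg h; exact: h'.
Qed.

(** Three successive replacements: [a n] by [g (phi n)] against the bounded norms of [P n], then
    [P n] by [D] with a bounded factor, and finally [g (phi n)] by [g U] against the fixed [D]. *)
Lemma L2cvg_chain (phi P a : nat -> T -> R) (U D : T -> R) : (forall n, L2 mu (phi n)) ->
  (forall n, L2 mu (P n)) -> L2 mu U -> L2 mu D ->
  (forall n, L2 mu (fun x => a n x * P n x)) -> L2cvg P D ->
  {ae mu, forall x, phi n x @[n --> \oo] --> U x} ->
  (forall n x, `|a n x - g (phi n x)| <= n.+1%:R^-1) ->
  L2 mu (fun x => g (U x) * D x) /\ L2cvg (fun n x => a n x * P n x) (fun x => g (U x) * D x).
Proof.
move=> phi2 P2 U2 D2 aP2 cP aephi near.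
have mg n : measurable_fun setT (g \o phi n) by exact: measurable_comp_continuous (phi2 n).1.
have mgU : measurable_fun setT (g \o U) by exact: measurable_comp_continuous U2.1.
have gU2 : L2 mu (fun x => g (U x) * D x) by exact: (L2_bounded_mul D2 mgU (fun x => gL _)).
have gP2 n : L2 mu (fun x => g (phi n x) * P n x) by exact: (L2_bounded_mul (P2 n) (mg n) (fun x => gL _)).
have gD2 n : L2 mu (fun x => g (phi n x) * D x) by exact: (L2_bounded_mul D2 (mg n) (fun x => gL _)).
split => //.
have A2 n := L2B (aP2 n) (gP2 n); have B2 n := L2B (gP2 n) (gD2 n); have C2 n := L2B (gD2 n) gU2.
have cA : sqnorm (fun x => a n x * P n x - g (phi n x) * P n x) @[n --> \oo] --> 0.
  apply: (sqnorm_scale_cvg0 A2 P2 (c := fun n => n.+1%:R^-1)) => [n x|].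
    by rewrite -mulrBl normrM ler_wpM2r.
  exact: (harm2 (L2cvg_sqnorm P2 D2 cP)).
have cB : sqnorm (fun x => g (phi n x) * P n x - g (phi n x) * D x) @[n --> \oo] --> 0.
  apply: (sqnorm_scale_cvg0 B2 (fun n => L2B (P2 n) D2) (c := fun=> L)) => [n x|].
    by rewrite -mulrBr normrM ler_wpM2r.
  by rewrite -(mulr0 (L ^+ 2)); apply: cvgM; [exact: cvg_cst | exact: cP].
have cC : sqnorm (fun x => g (phi n x) * D x - g (U x) * D x) @[n --> \oo] --> 0.
  apply: (cvg_ext (u := fun n => sqnorm (fun x => (g (phi n x) - g (U x)) * D x))).
    by move=> n; congr sqnorm; apply/funext => x; ring.
  apply: (sqnorm_mul_cvg0 (c := 2 * L)) => //.
  - by move=> n; exact: (measurable_funB (mg n) mgU).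
  - by move=> n x; apply: le_trans (ler_normB _ _) _; rewrite mulr_natl mulr2n; exact: lerD.
  - apply: filterS aephi => x cx; rewrite -(subrr (g (U x))); apply: cvgB; last exact: cvg_cst.
    by apply: continuous_cvg; [exact: cg | exact: cx].
have := sqnormD_cvg0 A2 (fun n => L2D (B2 n) (C2 n)) cA (sqnormD_cvg0 B2 C2 cB cC).
by apply: cvg_ext => n; congr sqnorm; apply/funext => x; ring.
Qed.

End L2_composition.

Section chain_rule.
Variables (R : realType) (N : nat) (Omega : set 'rV[R]_N).
Notation V := 'rV[R]_N.
Notation leb := (@leb R N).
Variables (G g : R -> R) (L : R).
Hypothesis dG : forall x : R, is_derive x (1 : R) G (g x).
Hypothesis cg : continuous g.
Hypothesis gL : forall x, `|g x| <= L.
Hypothesis G0 : G 0 = 0.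

(** Each [phi n] is bounded, so a polynomial [Q n] approximates [G] to within the tolerance
    [1 / (n + 1)] on its range, and [Q n (phi n)] is a test function because [Q n] vanishes at 0. *)
Lemma H10fun_comp (U : V -> R) (D : 'I_N -> V -> R) : H10fun Omega U D ->
  H10fun Omega (G \o U) (fun i x => g (U x) * D i x).
Proof.
move=> [U2 D2 [phi0 [tphi0 phi0U phi0D]]].
(* Almost everywhere convergence is needed for [g (phi n)] to tend to [g U]. *)
have [k [kn aephi]] := L2cvg_ae (fun n => test_L2 (tphi0 n)) U2 phi0U.
pose phi n := phi0 (k n); have tphi n : test_function Omega (phi n) := tphi0 (k n).
have phiU : L2cvg leb phi U by exact: (cvg_subseq kn phi0U).
have phiD i : L2cvg leb (fun n => partial i (phi n)) (D i) by exact: (cvg_subseq kn (phi0D i)).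
have /choice[Q QP] : forall n : nat, exists Q : {poly R}, Q.[0] = 0 /\ forall x,
    `|Q^`().[phi n x] - g (phi n x)| <= n.+1%:R^-1 /\
    `|Q.[phi n x] - G (phi n x)| <= n.+1%:R^-1 * `|phi n x|.
  move=> n; have [M M0 MP] := test_bounded (tphi n).
  have n0 : (0 : R) < n.+1%:R^-1 by rewrite invr_gt0.
  have [Q [Q0 Q1 Q2]] := C1_poly_approx dG cg gL G0 M0 n0.
  by exists Q; split => // x; split; [exact: Q1 | exact: Q2].
pose psi n : V -> R := fun x => (Q n).[phi n x].
have tpsi n : test_function Omega (psi n) by apply: test_horner (tphi n) _; exact: (QP n).1.
have phi2 n := test_L2 (tphi n); have psi2 n := test_L2 (tpsi n).
have dphi2 i n := test_L2 (test_partial i (tphi n)).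
have dpsi i n : partial i (psi n) = fun x => (Q n)^`().[phi n x] * partial i (phi n) x.
  by apply/funext => x; apply: partial_horner; exact: test_smooth (tphi n).
have dpsi2 i n : L2 leb ((fun x => (Q n)^`().[phi n x] * partial i (phi n) x) : lebspace R N -> R).
  by rewrite -dpsi; exact: test_L2 (test_partial i (tpsi n)).
have chain i := L2cvg_chain cg gL phi2 (dphi2 i) U2 (D2 i) (dpsi2 i) (phiD i) aephi
  (fun n x => ((QP n).2 x).1).
split; first exact: (L2_comp dG gL G0 U2).
  by move=> i; exact: (chain i).1.
exists psi; split => //.
  exact: (L2cvg_comp dG gL G0 phi2 psi2 U2 phiU (fun n x => ((QP n).2 x).2)).
move=> i; have -> : (fun n => partial i (psi n)) =
    (fun n x => (Q n)^`().[phi n x] * partial i (phi n) x) by apply/funext => n; exact: dpsi.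
exact: (chain i).2.
Qed.

End chain_rule.

(** * The singular test function *)

Section real_derivatives.
Variable R : realType.
Notation mu := (@lebesgue_measure R).

Lemma is_derive_eps (f : R -> R) (x l : R) :
  (forall e : R, 0 < e -> exists2 d, 0 < d & forall h, `|h| < d -> `|f (h + x) - f x - h * l| <= e * `|h|) ->
  is_derive x (1 : R) f l.
Proof.
move=> H.
have c : (h^-1 *: ((f \o shift x) (h *: (1 : R)) - f x)) @[h --> 0^'] --> l.
  apply/cvgrPdist_le => e e0; have [d d0 dP] := H e e0.
  near=> h; have h0 : h != 0 by near: h; exact: nbhs_dnbhs_neq.
  have hd : `|h| < d by near: h; exact: dnbhs0_lt.
  rewrite /= /shift /GRing.scale/= mulr1.
  have -> : l - h^-1 * (f (h + x) - f x) = - (h^-1 * (f (h + x) - f x - h * l)) by field.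
  by rewrite normrN normrM normfV ler_pdivrMl ?normr_gt0// [leRHS]mulrC; exact: dP.
by split; [apply/cvg_ex; exists l | apply/cvg_lim].
Unshelve. all: by end_near. Qed.

(** The squared positive part is C^1, which is why the truncation of the singular test function
    carries a square. *)
Lemma is_derive_sqr_pos (x : R) :
  is_derive x (1 : R) (fun y => Num.max y 0 ^+ 2) (2 * Num.max x 0).
Proof.
apply: is_derive_eps => e e0; exists e => // h he.
apply: (@le_trans _ _ (`|h| * `|h|)); last by rewrite ler_wpM2r// ltW.
rewrite -expr2 sqr_normr ler_norml; case: (leP (h + x) 0) => h1; case: (leP x 0) => h2;
  apply/andP; split; nra.
Qed.

Lemma is_derive_continuous (f : R -> R) (x l : R) : is_derive x (1 : R) f l -> {for x, continuous f}.
Proof. by case=> d _; apply: differentiable_continuous; apply/derivable1_diffP. Qed.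

Lemma near_gt0 (x : R) : 0 < x -> \forall y \near x, 0 < y.
Proof. by move=> x0; exact: lt_nbhsr. Qed.

Lemma near_eq_cvgr (F : set_system R) {FF : Filter F} (f g : R -> R) (l : R) :
  (\forall y \near F, f y = g y) -> f y @[y --> F] --> l -> g y @[y --> F] --> l.
Proof.
move=> fg /cvgrPdist_le fl; apply/cvgrPdist_le => e /fl; apply: filterS2 fg => y ->.
exact: id.
Qed.

Lemma near_eq_continuous (f g : R -> R) (x : R) : (\forall y \near x, f y = g y) ->
  {for x, continuous f} -> {for x, continuous g}.
Proof.
move=> fg cf; have := near_eq_cvgr fg cf; rewrite (nbhs_singleton fg); exact.
Qed.

Section primitive.
Variable k : R -> R.
Hypothesis ck : forall s, 0 < s -> {for s, continuous k}.

Let intk (a b : R) : 0 < a -> mu.-integrable `[a, b] (EFin \o k).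
Proof.
move=> a0; apply: continuous_compact_integrable; first exact: segment_compact.
by apply: continuous_in_subspaceT => s; rewrite inE/= in_itv/= => /andP[sa _]; apply: ck; exact: lt_le_trans sa.
Qed.

Let Rint_split (a b c : R) : 0 < a -> a <= b -> b <= c ->
  \int[mu]_(t in `[b, c]) k t = \int[mu]_(t in `[a, c]) k t - \int[mu]_(t in `[a, b]) k t.
Proof.
move=> a0 ab bc; rewrite (Rintegral_itvB (intk c a0)) ?bnd_simp//.
rewrite Rintegral_itv_obnd_cbnd//.
apply: (integrableS _ _ _ (intk c (lt_le_trans a0 ab))) => //.
by apply: subset_itvr; rewrite bnd_simp.
Qed.

Let Rint_ge (a b : R) : b <= a -> \int[mu]_(t in `[a, b]) k t = 0.
Proof.
rewrite le_eqVlt => /orP[/eqP ->|ba]; first by rewrite set_itv1 Rintegral_set1.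
by rewrite set_itv_ge ?Rintegral_set0// bnd_simp -ltNge.
Qed.

(** A base point [a] below both 1 and [s] makes the oriented integral a difference of ordinary ones,
    ready for the fundamental theorem of calculus. *)
Lemma oint_split (a s : R) : 0 < a -> a <= 1 -> a <= s ->
  oint k 1 s = \int[mu]_(t in `[a, s]) k t - \int[mu]_(t in `[a, 1]) k t.
Proof.
move=> a0 a1 sa; rewrite /oint; have [s1|/ltW s1] := leP s 1.
  by rewrite (Rint_ge s1) (Rint_split a0 sa s1); ring.
by rewrite (Rint_ge s1) (Rint_split a0 a1 s1); ring.
Qed.

Lemma oint_ge0 (s : R) : (forall t, 0 <= k t) -> 1 <= s -> 0 <= oint k 1 s.
Proof. by move=> k0 s1; rewrite /oint (Rint_ge s1) subr0; exact: Rintegral_ge0. Qed.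

Lemma is_derive_oint (s : R) : 0 < s -> is_derive s (1 : R) (oint k 1) (k s).
Proof.
move=> s0; pose a := Num.min s 1 / 2.
have a0 : 0 < a by rewrite divr_gt0// lt_min s0 ltr01.
have as_ : a < s by rewrite /a; case: (leP s 1); lra.
have a1 : a <= 1 by rewrite /a; case: (leP s 1); lra.
apply: (near_eq_is_derive (f := fun s => \int[mu]_(t in `[a, s]) k t - \int[mu]_(t in `[a, 1]) k t)).
  have : \forall y \near s, a < y by exact: lt_nbhsr.
  by apply: filterS => y ay; rewrite (oint_split a0 a1 (ltW ay)).
have s1 : s < s + 1 by rewrite ltrDl.
have [dF F'] := continuous_FTC1 s1 (intk (s + 1) a0) as_ (ck s0).
rewrite -[k s]subr0; apply: is_deriveB.
by rewrite derive1E in F'; exact: (DeriveDef dF F').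
Qed.

End primitive.

(** The approximating test functions may change sign, so the chain rule wants a C^1 function on the
    whole line. At 0 the derivative is [l] by the mean value theorem, since [F t = q c * t] with
    [0 < c < t]. *)
Lemma odd_extension (F q : R -> R) (l : R) :
  (forall s : R, 0 < s -> is_derive s (1 : R) F (q s)) ->
  (forall s : R, 0 < s -> {for s, continuous q}) ->
  F s @[s --> 0^'+] --> 0 -> q s @[s --> 0^'+] --> l ->
  exists w p : R -> R, [/\ forall s : R, is_derive s (1 : R) w (p s), continuous p, w 0 = 0,
    forall s : R, 0 < s -> w s = F s /\ p s = q s & forall s : R, 0 < s -> w (- s) = - F s /\ p (- s) = q s].
Proof.
move=> dF cq F0 q0.
pose w (s : R) := if 0 < s then F s else if s < 0 then - F (- s) else 0.
pose p (s : R) := if 0 < s then q s else if s < 0 then q (- s) else l.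
have wpos (s : R) : 0 < s -> w s = F s by rewrite /w => ->.
have ppos (s : R) : 0 < s -> p s = q s by rewrite /p => ->.
have wneg (s : R) : s < 0 -> w s = - F (- s) by rewrite /w => s0; rewrite ltNge (ltW s0) s0.
have pneg (s : R) : s < 0 -> p s = q (- s) by rewrite /p => s0; rewrite ltNge (ltW s0) s0.
have w0 : w 0 = 0 by rewrite /w ltxx.
have p0 : p 0 = l by rewrite /p ltxx.
have near_lt0 (s : R) : s < 0 -> \forall y \near s, y < 0 by move=> s0; exact: lt_nbhsl.
have mvt (t : R) : 0 < t -> exists2 c, 0 < c < t & F t = q c * t.
  move=> t0; have [| |c] := MVT (f := w) (df := q) t0.
  - move=> x; rewrite in_itv/= => /andP[x0 _]; apply: (near_eq_is_derive _ (dF x x0)).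
    by apply: filterS (near_gt0 x0) => y y0; rewrite wpos.
  - apply/(continuous_within_itvP _ t0); split.
    + move=> x; rewrite in_itv/= => /andP[x0 _]; apply: is_derive_continuous.
      apply: (near_eq_is_derive _ (dF x x0)).
      by apply: filterS (near_gt0 x0) => y y0; rewrite wpos.
    + rewrite w0; apply: near_eq_cvgr F0.
      by apply: filterS (nbhs_right_gt 0) => y y0; exact/esym/wpos.
    + apply: cvg_at_left_filter; apply: is_derive_continuous.
      apply: (near_eq_is_derive _ (dF t t0)).
      by apply: filterS (near_gt0 t0) => y y0; rewrite wpos.
  by rewrite in_itv/= => ct; rewrite wpos// w0 !subr0 => ->; exists c.
have qnear (e : R) : 0 < e -> exists2 d, 0 < d & forall c, 0 < c < d -> `|q c - l| <= e.
  move=> e0; have /cvgrPdist_le/(_ _ e0) := q0.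
  move=> /nbhs_ballP[d /= d0 dP]; exists d => // c /andP[c0 cd].
  by rewrite distrC; apply: dP => //=; rewrite /ball/= sub0r normrN gtr0_norm.
exists w, p; split => //.
- move=> s; have [s0|s0|->] := ltgtP s 0.
  + rewrite pneg//; apply: (near_eq_is_derive (f := fun s => - F (- s))).
      by apply: filterS (near_lt0 s s0) => y y0; rewrite wneg.
    have ns0 : 0 < - s by rewrite oppr_gt0.
    have d1 := dF _ ns0.
    have d2 : is_derive s (1 : R) (F \o -%R) (q (- s) * -1).
      apply: is_derive1_comp.
    by have := is_deriveN d2; rewrite mulrN1 opprK.
  + rewrite ppos//; apply: (near_eq_is_derive _ (dF s s0)).
    by apply: filterS (near_gt0 s0) => y y0; rewrite wpos.
  + rewrite p0; apply: is_derive_eps => e e0; have [d d0 dP] := qnear e e0.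
    exists d => // h hd; rewrite addr0 w0 subr0.
    have [h0|h0|->] := ltgtP h 0; last by rewrite w0 mul0r subrr !normr0 mulr0.
    * have nh0 : 0 < - h by rewrite oppr_gt0.
      have [c /andP[c0 ch] Fc] := mvt _ nh0.
      rewrite wneg// Fc (_ : - (q c * - h) - h * l = (q c - l) * h); last by ring.
      rewrite normrM ler_wpM2r// dP// c0 /= (lt_trans ch)//.
      by rewrite -(ger0_norm (ltW nh0)) normrN.
    * have [c /andP[c0 ch] Fc] := mvt _ h0.
      rewrite wpos// Fc (_ : q c * h - h * l = (q c - l) * h); last by ring.
      rewrite normrM ler_wpM2r// dP// c0 /= (lt_trans ch)//.
      by rewrite -(ger0_norm (ltW h0)).
- move=> s; have [s0|s0|->] := ltgtP s 0.
  + apply: (near_eq_continuous (f := q \o -%R)).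
      by apply: filterS (near_lt0 s s0) => y y0; rewrite pneg.
    have ns0 : 0 < - s by rewrite oppr_gt0.
    by apply: continuous_comp; [exact: opp_continuous | exact: cq].
  + apply: (near_eq_continuous _ (cq s s0)).
    by apply: filterS (near_gt0 s0) => y y0; rewrite ppos.
  + rewrite /continuous_at p0; apply/cvgrPdist_le => e e0; have [d d0 dP] := qnear e e0.
    apply/nbhs_ballP; exists d => // h; rewrite /ball/= sub0r normrN => hd.
    have [h0|h0|->] := ltgtP h 0; last by rewrite p0 subrr normr0 ltW.
    * rewrite pneg// distrC dP// oppr_gt0 h0 /=.
      by rewrite -(ltr0_norm h0).
    * by rewrite ppos// distrC dP// h0 /= -(gtr0_norm h0).
- by move=> s s0; rewrite wpos// ppos.
- by move=> s s0; rewrite wneg ?pneg ?oppr_lt0// opprK.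
Qed.

Lemma oint_opp (k : R -> R) (a b : R) : oint k a b = - oint k b a.
Proof. by rewrite /oint opprB. Qed.

(* With [W s = exp (int_1^s (sqrt h))], so that [W' = sqrt h * W], the function is
   [1 - (max (1 - W) 0)^2]: it equals [W * (2 - W)] near [0] and is constant past [1]. *)
Lemma singular_test_function (h : R -> R) (h0 : R) :
  (forall s : R, 0 < s -> 0 <= h s) -> {within `]0, +oo[, continuous h} ->
  oint (fun t => Num.sqrt (h t)) s 1 @[s --> 0^'+] --> +oo ->
  Num.sqrt (h s) * expR (oint (fun t => Num.sqrt (h t)) 1 s) @[s --> 0^'+] --> h0 ->
  exists (w p : R -> R) (L : R), [/\ forall s : R, is_derive s (1 : R) w (p s), continuous p,
    w 0 = 0, forall s, `|w s| <= 1 & forall s, `|p s| <= L] /\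
    forall s : R, 0 < s -> [/\ 0 < w s, 0 <= p s & p s ^+ 2 <= h s * w s ^+ 2].
Proof.
move=> h_ge0 h_cont; pose k t := Num.sqrt (h t) => h_int h_exp.
have ck (s : R) : 0 < s -> {for s, continuous k}.
  move=> s0; apply: continuous_comp; last exact: sqrt_continuous.
  have oI : open (`]0, +oo[%classic : set R) by exact: rray_open.
  move: h_cont; rewrite (continuous_open_subspace h oI); apply.
  by rewrite inE/= in_itv/= s0.
pose W (s : R) : R := expR (oint k 1 s).
have W_gt0 s : 0 < W s by exact: expR_gt0.
have dW (s : R) : 0 < s -> is_derive s (1 : R) W (W s * k s).
  move=> s0; have d1 := is_derive_oint ck s0.
  exact: (is_derive1_comp (is_derive_expR _) d1).
pose m (s : R) : R := Num.max (1 - W s) 0.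
pose F (s : R) : R := 1 - m s ^+ 2.
pose q (s : R) : R := 2 * m s * (k s * W s).
have m_ge0 s : 0 <= m s by rewrite le_max lexx orbT.
have m_lt1 s : m s < 1 by rewrite gt_max ltr01 andbT ltrBlDr ltrDl.
have dF (s : R) : 0 < s -> is_derive s (1 : R) F (q s).
  move=> s0.
  have d1 : is_derive s (1 : R) (fun s => 1 - W s) (0 - W s * k s).
    have dWs := dW s s0; apply: is_deriveB.
  have d2 := is_derive1_comp (g := fun s : R => 1 - W s) (is_derive_sqr_pos (1 - W s)) d1.
  have : is_derive s (1 : R) F (0 - 2 * m s * (0 - W s * k s)) by apply: is_deriveB.
  by congr is_derive; rewrite /q; ring.
have cm (s : R) : 0 < s -> {for s, continuous m}.
  move=> s0; apply: continuous_max; last exact: cst_continuous.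
  by apply: continuousB; [exact: cst_continuous | exact: is_derive_continuous (dW s s0)].
have cq (s : R) : 0 < s -> {for s, continuous q}.
  move=> s0; apply: continuousM; apply: continuousM.
  - exact: cst_continuous.
  - exact: cm.
  - exact: ck.
  - exact: is_derive_continuous (dW s s0).
(* [W s] is the exponential of minus the integral of [k] from [s] to 1, which diverges. *)
have W0 : W s @[s --> 0^'+] --> 0.
  have := cvg_comp _ _ h_int (@cvgr_expR R); apply: near_eq_cvgr.
  by apply: nearW => s; rewrite /W [in RHS]oint_opp.
have m0 : m s @[s --> 0^'+] --> (1 : R).
  apply/cvgrPdist_le => e e0; have /cvgrPdist_le/(_ _ e0) := W0.
  apply: filterS => s; rewrite sub0r normrN gtr0_norm// => We.
  rewrite ger0_norm ?subr_ge0; last exact: ltW.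
  by rewrite /m; case: (leP (1 - W s) 0); have := W_gt0 s; lra.
have F0 : F s @[s --> 0^'+] --> 0.
  have e0 : (0 : R) = 1 - 1 * 1 by rewrite mulr1 subrr.
  rewrite [X in _ --> X]e0.
  by apply: cvgB; [exact: cvg_cst | exact: cvgM].
(* The hypothesis on [h0] makes the derivative extend continuously to 0. *)
have q0 : q s @[s --> 0^'+] --> 2 * 1 * h0.
  by apply: cvgM; [apply: cvgM; [exact: cvg_cst|] |].
have [w [p [dw cp w0 wpos wneg]]] := odd_extension dF cq F0 q0.
have F01 s : 0 < F s <= 1.
  by rewrite /F subr_gt0 gerBl sqr_ge0 expr_lt1// m_lt1.
have q1 s : 1 <= s -> q s = 0.
  move=> s1; rewrite /q /m (_ : Num.max _ _ = 0) ?mulr0 ?mul0r//.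
  apply/max_idPr; rewrite subr_le0 -expR0 ler_expR; apply: oint_ge0 => // t; exact: sqrtr_ge0.
(* [p] is even, vanishes from 1 on since [W >= 1] there, and is continuous on [[0, 1]]. *)
have [L LP] : exists L : R, forall s, `|p s| <= L.
  have c1 : {within `[0, 1], continuous (fun s => `|p s|)}.
    apply: continuous_subspaceT => s; apply: continuous_comp; [exact: cp | exact: norm_continuous].
  have [c _ cP] := EVT_max ler01 c1.
  have pos s : 0 < s -> `|p s| <= `|p c|.
    move=> s0; have [s1|s1] := leP s 1; first by apply: cP; rewrite in_itv/= ltW.
    by rewrite (wpos s s0).2 (q1 s (ltW s1)) normr0 normr_ge0.
  exists `|p c| => s; have [s0|s0|->] := ltgtP s 0.
  - have ns0 : 0 < - s by rewrite oppr_gt0.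
    have := (wneg _ ns0).2; rewrite opprK => ->.
    by rewrite -(wpos _ ns0).2; exact: pos.
  - exact: pos.
  - by apply: cP; rewrite in_itv/= lexx ler01.
exists w, p, L; split; first split => //.
  move=> s; have [s0|s0|->] := ltgtP s 0.
  - have ns0 : 0 < - s by rewrite oppr_gt0.
    have := (wneg _ ns0).1; rewrite opprK => ->.
    by have /andP[f0 f1] := F01 (- s); rewrite normrN gtr0_norm.
  - by have /andP[f0 f1] := F01 s; rewrite (wpos s s0).1 gtr0_norm.
  - by rewrite w0 normr0.
move=> s s0; have [-> ->] := wpos s s0; have k0 : 0 <= k s by exact: sqrtr_ge0.
split; first by case/andP: (F01 s).
  by rewrite /q mulr_ge0// mulr_ge0// ltW.
have hk : h s = k s ^+ 2 by rewrite sqr_sqrtr// h_ge0.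
rewrite hk -exprMn.
have /andP[/ltW F0' _] := F01 s.
rewrite ler_sqr ?nnegrE ?mulr_ge0// ?(ltW (W_gt0 s))//.
rewrite /q (_ : 2 * m s * (k s * W s) = k s * (2 * m s * W s)); last by ring.
(* What remains is [2 m W <= 1 - m^2]: for [W < 1] it reads [2 (1 - W) W <= W (2 - W)], and
   otherwise [m = 0]. *)
apply: ler_wpM2l => //; rewrite /F /m; have Ws := W_gt0 s.
by case: (leP (1 - W s) 0) => h1; nra.
Qed.

End real_derivatives.

(** * Integrals under almost everywhere conditions *)

Section ae_integrals.
Context d (T : measurableType d) (R : realType) (mu : {measure set T -> \bar R}).

Lemma ae_impl2 (P Q S : T -> Prop) : {ae mu, forall x, P x} -> {ae mu, forall x, Q x} ->
  (forall x, P x -> Q x -> S x) -> {ae mu, forall x, S x}.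
Proof. by move=> aP aQ PQS; exact: filterS2 aP aQ. Qed.

(** Each preimage is negligible or has a negligible complement, according to whether the set
    contains 0. *)
Lemma ae0_measurable (F : T -> \bar R) : (forall A, mu.-negligible A -> measurable A) ->
  {ae mu, forall x, F x = 0%E} -> measurable_fun setT F.
Proof.
move=> cmpl F0 _ Y mY; rewrite setTI.
have [Y0|Y0] := pselect (Y 0%E).
  rewrite -[F @^-1` Y]setCK; apply: measurableC; apply: cmpl.
  by apply: negligibleS F0 => x /= FY Fx; apply: FY; rewrite Fx.
by apply: cmpl; apply: negligibleS F0 => x /= FY Fx; apply: Y0; rewrite -Fx.
Qed.

(* No measurability of [F] is assumed: by completeness its negative part is measurable. *)
Lemma ae_ge0_Rintegral (F : T -> R) : (forall A, mu.-negligible A -> measurable A) ->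
  {ae mu, forall x, 0 <= F x} -> 0 <= \int[mu]_x F x.
Proof.
move=> cmpl F0; apply: fine_ge0; rewrite integralE.
have n0 : {ae mu, forall x, ((fun y => (F y)%:E)^\-)%E x = 0%E}.
  apply: (ae_impl F0) => x Fx; rewrite funenegE; apply/max_idPr.
  by rewrite leeNl oppe0 lee_fin.
have -> : (\int[mu]_x ((fun y => (F y)%:E)^\-) x = 0)%E.
  rewrite (ae_eq_integral (cst 0%E)) ?integral0//.
    exact: ae0_measurable.
  by apply: (ae_impl n0) => x -> _.
by rewrite sube0; apply: integral_ge0.
Qed.

(** [G] is replaced by the maximum of [F] and [G], which equals it almost everywhere and lies above
    [F] at every point. *)
Lemma ae_le_Rintegral (F G : T -> R) : mu.-integrable setT (EFin \o F) ->
  mu.-integrable setT (EFin \o G) -> {ae mu, forall x, F x <= G x} ->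
  \int[mu]_x F x <= \int[mu]_x G x.
Proof.
move=> iF iG FG.
have [mF mG] : measurable_fun setT F /\ measurable_fun setT G.
  by split; apply/measurable_EFinP; apply: measurable_int; eassumption.
have mM : measurable_fun setT (fun x => Num.max (F x) (G x)) by exact: measurable_maxr.
have iM : mu.-integrable setT (EFin \o (fun x => Num.max (F x) (G x))).
  have iFG := integrableD measurableT (integrable_abse iF) (integrable_abse iG).
  apply: le_integrable iFG => //; first exact/measurable_EFinP.
  move=> x _ /=; rewrite lee_fin [leRHS]ger0_norm ?addr_ge0//.
  by case: (leP (F x) (G x)) => _; rewrite ?lerDl ?lerDr.
have -> : \int[mu]_x G x = \int[mu]_x Num.max (F x) (G x).
  congr fine; apply: ae_eq_integral => //; [exact/measurable_EFinP|exact/measurable_EFinP|].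
  by apply: (ae_impl FG) => x /max_idPr -> _.
by apply: le_Rintegral => // x _; rewrite le_max lexx.
Qed.

Lemma bounded_Lfun_oo (F : T -> R) (c : R) : measurable_fun setT F -> (forall x, `|F x| <= c) ->
  F \in Lfun mu +oo%E.
Proof.
move=> mF Fc; rewrite inE; apply/andP; split; rewrite inE//=.
rewrite /finite_norm unlock; case: ifP => [_|_]; last exact: ltry.
apply: le_lt_trans (ltry c); apply/ess_supP; apply: nearW => x /=.
by rewrite lee_fin.
Qed.

End ae_integrals.

(** * Testing the equation with the square of [w(u)] *)

Section main.
Variables (R : realType) (N : nat).
Notation V := 'rV[R]_N.
Notation leb := (@leb R N).

(** Supplies the completeness hypothesis of [ae_ge0_Rintegral], which is applied to the elliptic
    term. *)
Lemma leb_complete (A : set (lebspace R N)) : leb.-negligible A -> measurable A.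
Proof.
move=> [B [mB B0 AB]]; have A0 : lebesgue_outer (A : set V) = 0%E.
  by apply/eqP; rewrite eq_le lebesgue_outer_ge0 andbT -B0; exact: le_lebesgue_outer.
apply: le_caratheodory_measurable => X.
rewrite -[leRHS]add0e leeD ?le_lebesgue_outer//.
by rewrite -A0; exact: le_lebesgue_outer.
Qed.

Lemma dotZr (a : R) (v w : 'cV[R]_N) : dot v (\col_i (a * w i ord0)) = a * dot v w.
Proof. by rewrite /dot mulr_sumr; apply: eq_bigr => i _; rewrite mxE; ring. Qed.

Lemma sqr_enorm (v : 'cV[R]_N) : enorm v ^+ 2 = \sum_i v i ord0 ^+ 2.
Proof.
rewrite /enorm sqr_sqrtr; first by apply: eq_bigr => i _; rewrite expr2.
by apply: sumr_ge0 => i _; rewrite -expr2 sqr_ge0.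
Qed.

End main.

Theorem theorem1p4 (R : realType) (N : nat) (hN : (3 <= N)%N)
  (Omega : set 'rV[R]_N) (Omega_open : open Omega)
  (Omega_bounded : bounded_set Omega)
  (M : 'rV[R]_N -> R -> 'M[R]_N)
  (M_car : forall i j, caratheodory_fun Omega setT (fun x s => M x s i j))
  (alpha beta : R) (alpha_gt0 : 0 < alpha) (alpha_le_beta : alpha <= beta)
  (M_elliptic : ae_in Omega (fun x => forall (s : R) (z : 'cV[R]_N),
     alpha * enorm z ^+ 2 <= dot (M x s *m z) z))
  (M_bounded : ae_in Omega (fun x => forall s : R, opnorm (M x s) <= beta))
  (f : 'rV[R]_N -> R) (q : \bar R) (hq : ((N%:R / 2)%:E < q)%E)
  (f_Lq : in_Lp Omega q f)
  (f_ge0 : ae_in Omega (fun x => 0 <= f x))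
  (f_neq0 : ~ ae_in Omega (fun x => f x = 0))
  (g : 'rV[R]_N -> R -> R) (g_car : caratheodory_fun Omega `]0, +oo[ g)
  (h : R -> R) (h_ge0 : forall s : R, 0 < s -> 0 <= h s)
  (h_cont : {within `]0, +oo[, continuous h})
  (h_le_g : ae_in Omega (fun x => forall s : R, 0 < s -> h s <= g x s))
  (h_lim : h s @[s --> 0^'+] --> +oo)
  (h_int : oint (fun t => Num.sqrt (h t)) s 1 @[s --> 0^'+] --> +oo)
  (h0 : R) (h0_ge0 : 0 <= h0)
  (h_exp : Num.sqrt (h s) * expR (oint (fun t => Num.sqrt (h t)) 1 s)
             @[s --> 0^'+] --> h0)
  (lambda1 : R) (lambda1_f : first_positive_eigenvalue Omega f lambda1)
  (lambda1_gt : beta / alpha < lambda1) :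
  ~ exists u, finite_energy_solution Omega M g f u.
Proof.
move=> [u [Du [Hu u_gt0 gDu test_eq]]].
have mO : measurable (Omega : set (lebspace R N)) by exact: open_measurable_rV.
have [w [p [L [[dw cp w0 w1 pL] wp]]]] := singular_test_function h_ge0 h_cont h_int h_exp.
have cw : continuous w by move=> s; exact: is_derive_continuous (dw s).
pose U : 'rV[R]_N -> R := u \_ Omega; pose D := components Omega Du.
have HU : H10fun Omega U D by apply/H10P.
have U2 : L2 leb U by have [] := HU.
have D2 i : L2 leb (D i) by have [] := HU.
(* [psi] is admissible: it is bounded by 1, and it is in H^1_0 by the chain rule, as [w^2] vanishes
   at 0 and has a continuous derivative bounded by [2 L]. *)
pose v := w \o U; pose psi : 'rV[R]_N -> R := fun x => v x ^+ 2.
have Uout x : ~ Omega x -> U x = 0 by move=> xO; rewrite /U /patch; case: ifPn => //; rewrite inE.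
have Uin x : Omega x -> U x = u x by move=> Ox; rewrite /U /patch mem_set.
have Dout i x : ~ Omega x -> D i x = 0.
  by move=> xO; rewrite /D /components /patch; case: ifPn => //; rewrite inE.
have Din i x : Omega x -> D i x = Du x i ord0 by move=> Ox; rewrite /D /components /patch mem_set.
have vout x : ~ Omega x -> v x = 0 by move=> xO; rewrite /v /= Uout.
have Hv : H10fun Omega v (fun i x => p (U x) * D i x) := H10fun_comp dw cp pL w0 HU.
have d2w (s : R) : is_derive s (1 : R) (fun s => w s ^+ 2) (2 * w s * p s).
  have h2 : is_derive s (1 : R) (w * w) (w s *: p s + w s *: p s) by exact: is_deriveM.
  have -> : 2 * w s * p s = w s *: p s + w s *: p s by rewrite /GRing.scale/=; ring.
  by have -> : (fun s => w s ^+ 2) = w * w by apply/funext => t; rewrite expr2.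
have c2w : continuous (fun s => 2 * w s * p s).
  by move=> s; apply: cvgM; [apply: cvgM; [exact: cvg_cst | exact: cw] | exact: cp].
have b2w (s : R) : `|2 * w s * p s| <= 2 * L.
  rewrite -mulrA normrM ger0_norm// ler_wpM2l// normrM.
  by rewrite -[L]mul1r; exact: ler_pM.
have Hpsi : H10fun Omega psi (fun i x => 2 * w (U x) * p (U x) * D i x).
  by apply: (H10fun_comp d2w c2w b2w _ HU); rewrite w0 expr0n.
pose Dpsi x : 'cV[R]_N := \col_i (2 * w (U x) * p (U x) * D i x).
have HpsiO : H10 Omega psi Dpsi := H10_H10fun mO Hpsi.
have v2 : L2 leb v by have [] := Hv.
have psi_patch : psi \_ Omega = psi.
  apply/funext => x; rewrite /patch; case: ifPn => // /negP xO.
  by rewrite /psi vout ?expr0n// => /mem_set.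
have psi_ge0 x : 0 <= psi x by exact: sqr_ge0.
have psi_le1 x : `|psi x| <= 1.
  by rewrite normrX expr_le1//; exact: w1.
have mpsi : measurable_fun setT (psi : lebspace R N -> R) by exact: measurable_funX v2.1.
have psi_oo : in_Lp Omega +oo%E psi.
  by rewrite /in_Lp psi_patch; exact: (bounded_Lfun_oo leb mpsi psi_le1).
have := test_eq psi Dpsi HpsiO psi_oo.
have [swv2 rayleigh] := first_eigenvalue_rayleigh hN Omega_open Omega_bounded hq f_Lq f_ge0 f_neq0
  lambda1_f Hv.
set B := sqnorm _ _ in rayleigh; set E := energy _ _ in rayleigh.
have -> : \int[leb]_(x in Omega) (f x * psi x) = B.
  have mvO : measurable_fun setT (v \_ Omega : lebspace R N -> R) by exact: (L2_patch mO v2).1.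
  rewrite /B /sqnorm -(weight_ip f_Lq f_ge0 mvO mvO).
  by apply: eq_Rintegral => x _; rewrite /psi expr2 mulrA.
set T1 := Rintegral _ _ _; set T2 := Rintegral _ _ _ => T12.
(* The gradient of [psi] is a nonnegative multiple of [Du], as [w] and its derivative [p] are
   nonnegative on positive reals, so ellipticity gives the sign pointwise. *)
have T1_ge0 : 0 <= T1.
  rewrite /T1 Rintegral_mkcond; apply: (ae_ge0_Rintegral (@leb_complete R N)).
  apply: (ae_impl2 M_elliptic u_gt0) => x Mx ux; rewrite /patch; case: ifPn => //.
  rewrite inE => Ox; have ux0 := ux Ox.
  have -> : Dpsi x = \col_i (2 * w (U x) * p (U x) * Du x i ord0).
    by apply/colP => i; rewrite !mxE Din.
  have [wu pu _] := wp _ ux0; rewrite dotZr Uin// mulr_ge0//.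
    by rewrite mulr_ge0// mulr_ge0// ltW.
  apply: le_trans (Mx Ox (u x) (Du x)); rewrite mulr_ge0//; first exact: ltW.
  exact: sqr_ge0.
(* Pointwise, [p(u)^2 <= h(u) w(u)^2 <= g(x, u) w(u)^2]; the right-hand integrand is integrable by
   the finite energy condition, [psi] being bounded. *)
have ET2 : E <= T2.
  have vD2 i : L2 leb ((fun x => p (U x) * D i x) : lebspace R N -> R) by have [] := Hv.
  rewrite /E /energy -(Rintegral_sum_mul (index_enum _) vD2 vD2) /T2 [leRHS]Rintegral_mkcond.
  have -> : (fun x => g x (u x) * enorm (Du x) ^+ 2 * psi x) \_ Omega =
      (fun x => ((fun x => g x (u x) * enorm (Du x) ^+ 2) \_ Omega) x * psi x).
    by apply/funext => x; rewrite /patch; case: ifPn => // _; rewrite mul0r.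
  apply: ae_le_Rintegral.
  - rewrite (_ : EFin \o _ = fun x : lebspace R N =>
      (\sum_i (p (U x) * D i x * (p (U x) * D i x))%:E)%E); last first.
      by apply/funext => x /=; rewrite sumEFin.
    by apply: (integrable_sum measurableT) => i _; exact: (L2M (vD2 i) (vD2 i)).
  - apply: (integrable_bounded_mul measurableT _ mpsi psi_le1).
    exact/Lfun1_integrable.
  apply: (ae_impl2 h_le_g u_gt0) => x gx ux; have [Ox|xO] := pselect (Omega x); last first.
    rewrite big1 => [|i _]; last by rewrite Dout// !mulr0.
    by rewrite /psi vout// expr0n mulr0.
  have [wu pu phw] := wp _ (ux Ox).
  rewrite [X in _ <= X * _]/patch mem_set// sqr_enorm.
  rewrite (eq_bigr (fun i => p (u x) ^+ 2 * Du x i ord0 ^+ 2)); last first.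
    by move=> i _; rewrite Uin// Din//; ring.
  rewrite -mulr_sumr /psi /v /= Uin//; set S := \sum_i _.
  have S0 : 0 <= S by apply: sumr_ge0 => i _; exact: sqr_ge0.
  rewrite [leRHS]mulrAC; apply: ler_wpM2r => //; apply: le_trans phw _.
  by apply: ler_wpM2r; [exact: sqr_ge0 | exact: (gx Ox _ (ux Ox))].
(* Since [w(u) > 0] almost everywhere in [Omega], [B = 0] would make [f] vanish almost
   everywhere. *)
have B_gt0 : 0 < B.
  rewrite lt_neqAle eq_sym ip_ge0 andbT; apply/eqP => B0; apply: f_neq0.
  apply: (ae_impl2 (sqnorm_eq0_ae swv2 B0) u_gt0) => x swv ux Ox.
  have [wu _ _] := wp _ (ux Ox).
  have := sqr_weight_sqrt (f \_ Omega) x; move: swv; rewrite /v /= Uin// => /eqP.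
  rewrite mulf_eq0 (gt_eqF wu) orbF => /eqP ->; rewrite expr0n/= => /esym/normr0P/eqP.
  by rewrite /patch mem_set.
have l1 : 1 < lambda1.
  apply: le_lt_trans lambda1_gt; by rewrite ler_pdivlMr// mul1r.
have EB : E <= B by rewrite -T12; lra.
have : B < lambda1 * B by rewrite ltr_pMl.
by rewrite ltNge => /negP; apply; exact: le_trans rayleigh EB.
Qed.
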